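(* Suppose that $q \in C^\infty(\mathbb{R})$ is strictly positive, that $x(t)=\int_0^t \sqrt{q(u)}\,du$ (a diffeomorphism of $\mathbb{R}$ onto $\mathbb{R}$ with inverse $t(x)$), and that the function $p(x) = 2\{t,x\}$ is an element of the Schwartz space $\mathcal{S}(\mathbb{R})$. Suppose furthermore that there exist positive real numbers $\lambda,\Gamma,\mu$ such that $$\lambda > 2\max\left\{\frac{1}{\mu},\Gamma\right\}$$ and $$|\widehat{p}(\xi)| \le \Gamma \exp(-\mu|\xi|)\quad\text{for all } \xi\in\mathbb{R}.$$ Then there exist functions $\sigma$ and $\nu$ in $\mathcal{S}(\mathbb{R})$ such that $$\sigma(x) = S\left[T[\sigma]\right](x) + p(x) + \nu(x)\quad\text{for all } x\in\mathbb{R},$$ $$|\widehat{\sigma}(\xi)| \le \left(1+\frac{2\Gamma}{\lambda}\right)\Gamma\exp(-\mu|\xi|)\quad\text{for all } |\xi|\le\sqrt{2}\lambda,$$ $$\widehat{\sigma}(\xi)=0\quad\text{for all } |\xi|>\sqrt{2}\lambda,$$ and $$\|\nu\|_\infty \le \frac{\Gamma}{2\mu}\left(1+\frac{4\Gamma}{\lambda}\right)\exp(-\mu\lambda).$$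
   Context: Schwarzian derivative: $\{t,x\} = \frac{t'''(x)}{t'(x)} - \frac{3}{2}\left(\frac{t''(x)}{t'(x)}\right)^2$, where $t(x)$ is the inverse of $x(t)$ and primes are derivatives in $x$. Fourier transform: $\widehat{f}(\xi)=\int_{-\infty}^\infty e^{-ix\xi}f(x)\,dx$. Functions may be complex-valued. The linear operator $T$ (depending on $\lambda$) is defined for $f\in L^2(\mathbb{R})$ with $\widehat f$ supported in $(-2\lambda,2\lambda)$ by $$T[f](x)=\frac{1}{2\pi}\int_{-\infty}^\infty e^{ix\xi}\,\frac{\widehat f(\xi)}{4\lambda^2-\xi^2}\,d\xi .$$ The nonlinear operator $S$ (depending on $\lambda$) is $$S[f](x)=\frac{(f'(x))^2}{4}-4\lambda^2\left(\frac{f(x)^2}{2!}+\frac{f(x)^3}{3!}+\frac{f(x)^4}{4!}+\cdots\right).$$ *)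

(* Defs.v *)
(* MathComp-Analysis, over an arbitrary [R : realType]; complex numbers are
   [R[i]] from mathcomp-real-closed. *)
From HB Require Import structures.
From mathcomp Require Import all_boot all_order all_algebra.
From mathcomp Require Import all_classical all_reals all_analysis.
From mathcomp Require Export complex.
Import Order.TTheory GRing.Theory Num.Theory.
Import numFieldNormedType.Exports.

Set Implicit Arguments.
Unset Strict Implicit.
Unset Printing Implicit Defensive.

Local Open Scope ring_scope.
Local Open Scope complex_scope.
Local Open Scope classical_set_scope.

(* Derivatives, integrals and limits with values in [R[i]] are componentwise,
   as MathComp-Analysis puts no real normed-module structure on [R[i]]. *)
Section complex_valued.
Context {R : realType}.
Implicit Types (f : R -> R) (g : R -> R[i]).

Definition smooth f : Prop := forall (n : nat) (x : R), derivable (f^`(n)) x 1.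

Definition csmooth g : Prop :=
  smooth (fun x => complex.Re (g x)) /\ smooth (fun x => complex.Im (g x)).

Definition cderive g : R -> R[i] := fun x =>
  (fun y => complex.Re (g y))^`() x +i* (fun y => complex.Im (g y))^`() x.

Definition cintegral g : R[i] :=
  (\int[lebesgue_measure]_(x in [set: R]) complex.Re (g x)) +i*
  (\int[lebesgue_measure]_(x in [set: R]) complex.Im (g x)).

Definition clim (u : nat -> R[i]) : R[i] :=
  limn (fun n => complex.Re (u n)) +i* limn (fun n => complex.Im (u n)).

Definition cabs (z : R[i]) : R := ComplexField.Normc.normc z.

(* The exponential of [i * theta]. *)
Definition cexpi (theta : R) : R[i] := cos theta +i* sin theta.

Definition schwartz g : Prop :=
  csmooth g /\
  forall m n : nat, exists M : R, forall x : R,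
    `|x| ^+ m * cabs (iter n cderive g x) <= M.

Definition fourier g (xi : R) : R[i] :=
  cintegral (fun x => cexpi (- (x * xi)) * g x).

Definition Linfty_norm g : \bar R :=
  Lnorm (lebesgue_measure : set (measurableTypeR R) -> \bar R) +oo%E
    (fun x => (cabs (g x))%:E).

End complex_valued.

Section liouville_green.
Context {R : realType}.
Implicit Types (f : R -> R).

(* The oriented integral of [f] from [0] to [t], for [t] of either sign. *)
Definition integral_from0 f (t : R) : R :=
  if 0 <= t then \int[lebesgue_measure]_(u in `[0, t]) f u
  else - \int[lebesgue_measure]_(u in `[t, 0]) f u.

(* [x] is a diffeomorphism of the real line onto itself with inverse [t]. *)
Definition diffeo_with_inverse (x t : R -> R) : Prop :=
  [/\ smooth x, smooth t, cancel x t & cancel t x].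

Definition schwarzian f (x : R) : R :=
  let f' := f^`() in let f'' := f^`(2) in let f''' := f^`(3) in
  f''' x / f' x - 3 / 2 * (f'' x / f' x) ^+ 2.

End liouville_green.

Section operators.
Context {R : realType}.
Variable lambda : R.
Implicit Types (f : R -> R[i]).

(* Meaningful for square-integrable [f] whose Fourier transform is supported
   in the open interval ]-2 lambda, 2 lambda[; given by the same formula for
   every [f] so as to be a total function. *)
Definition opT f (x : R) : R[i] :=
  ((2 * pi)^-1)%:C *
  cintegral (fun xi =>
    cexpi (x * xi) * (fourier f xi / (4 * lambda ^+ 2 - xi ^+ 2)%:C)).

(* The limit of the partial sums of z^2/2! + z^3/3! + z^4/4! + ... *)
Definition exp_tail2 (z : R[i]) : R[i] :=
  clim (fun n => \sum_(2 <= k < n) z ^+ k / (k`!)%:R).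

Definition opS f (x : R) : R[i] :=
  cderive f x ^+ 2 / 4 - (4 * lambda ^+ 2)%:C * exp_tail2 (f x).

End operators.

(* Main.v *)
(* Put h = S[T[sigma]] + p and let sigma be h with its spectrum multiplied by a
   smooth cutoff equal to 1 on [-lambda, lambda] and supported in
   [-6/5 lambda, 6/5 lambda].  Then T[sigma] = greenT * h, where greenT has
   transform cutoff / (4 lambda^2 - xi^2), so that h solves the fixed point
   equation h = S[greenT * h] + p, which is solved by Picard iteration.
   Since exp(-mu |eta|) exp(-mu |xi - eta|) <= exp(-mu |xi|), multiplying by a
   function band-limited to [-A, A] whose spectrum is at most D exp(-mu |xi|)
   preserves spectral bounds of the form C exp(-mu |xi|) at the price of a
   factor 2 A D; the iteration therefore stays in the ball
   C = (1 + 2 Gamma / lambda) Gamma, and is a contraction there.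
   Multiplication by x is a derivation on the spectral side which may be put on
   a single factor of a product, so the same contraction factor bounds all
   moments uniformly, and the limit is a Schwartz function.  Finally the
   spectrum of nu = sigma - h lives in |xi| >= lambda, where the exponential
   bound on the spectrum of h gives the estimate on nu.
   As p is real, all functions of x are real. *)
Require Import Defs.
From mathcomp Require Import all_boot all_order all_algebra.
From mathcomp Require Import all_classical all_reals all_analysis.
From mathcomp Require Import measurable_realfun ess_sup_inf ring lra.
Import Order.TTheory GRing.Theory Num.Theory.
Import numFieldNormedType.Exports.

Local Open Scope classical_set_scope.
Local Open Scope ring_scope.
Local Open Scope complex_scope.

Set Implicit Arguments.
Unset Strict Implicit.

(** * Lebesgue integrals over the real line *)

Section integration.
Context {R : realType}.
Implicit Types (f g k : R -> R).
Local Notation mu := (@lebesgue_measure R).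

Definition L1 f : Prop := mu.-integrable setT (EFin \o f).
Definition Rint f : R := \int[mu]_x f x.

Lemma L1_meas f : L1 f -> measurable_fun setT f.
Proof. by move=> /integrableP[/measurable_EFinP]. Qed.

Lemma L1_le f g : measurable_fun setT f -> L1 g ->
  (forall x, `|f x| <= g x) -> L1 f.
Proof.
move=> mf Lg fg; apply: (le_integrable measurableT _ _ Lg).
- exact/measurable_EFinP.
- by move=> x _ /=; rewrite lee_fin (le_trans (fg x))// ler_norm.
Qed.

Lemma eq_L1 f g : f =1 g -> L1 f -> L1 g.
Proof. by move=> /funext ->. Qed.

Lemma L1D f g : L1 f -> L1 g -> L1 (fun x => f x + g x).
Proof. by move=> Lf Lg; exact: (integrableD measurableT Lf Lg). Qed.

Lemma L1Z c f : L1 f -> L1 (fun x => c * f x).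
Proof. by move=> Lf; exact: (integrableZl measurableT c Lf). Qed.

Lemma L1B f g : L1 f -> L1 g -> L1 (fun x => f x - g x).
Proof. by move=> Lf Lg; exact: (integrableB measurableT Lf Lg). Qed.

Lemma L1_norm f : L1 f -> L1 (fun x => `|f x|).
Proof. by move=> Lf; exact: (integrable_abse Lf). Qed.

Lemma L1M f k M : L1 f -> measurable_fun setT k ->
  (forall x, `|k x| <= M) -> L1 (fun x => f x * k x).
Proof.
move=> Lf mk kM; apply: (@L1_le _ (fun x => M * `|f x|)).
- by apply: measurable_funM => //; exact: L1_meas.
- exact/L1Z/L1_norm.
- by move=> x; rewrite normrM mulrC ler_wpM2r.
Qed.

Lemma RintD f g : L1 f -> L1 g -> Rint (fun x => f x + g x) = Rint f + Rint g.
Proof. by move=> Lf Lg; exact: RintegralD. Qed.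

Lemma RintZ c f : L1 f -> Rint (fun x => c * f x) = c * Rint f.
Proof. by move=> Lf; exact: RintegralZl. Qed.

Lemma RintB f g : L1 f -> L1 g -> Rint (fun x => f x - g x) = Rint f - Rint g.
Proof. by move=> Lf Lg; exact: RintegralB. Qed.

Lemma le_Rint f g : L1 f -> L1 g -> (forall x, f x <= g x) -> Rint f <= Rint g.
Proof. by move=> Lf Lg fg; apply: le_Rintegral. Qed.

Lemma norm_Rint f : L1 f -> `|Rint f| <= Rint (fun x => `|f x|).
Proof. by move=> Lf; exact: le_normr_Rintegral. Qed.

Lemma Rint_ge0 f : (forall x, 0 <= f x) -> 0 <= Rint f.
Proof. by move=> f0; exact: Rintegral_ge0. Qed.

Lemma norm_Rint_le f g : L1 f -> L1 g -> (forall x, `|f x| <= g x) -> `|Rint f| <= Rint g.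
Proof.
move=> Lf Lg fg; apply: (le_trans (norm_Rint Lf)).
by apply: le_Rint => //; exact: L1_norm.
Qed.

Lemma eq_Rint f g : f =1 g -> Rint f = Rint g.
Proof. by move=> fg; congr Rint; apply/funext. Qed.

Lemma EFin_Rint f : L1 f -> (Rint f)%:E = (\int[mu]_x (f x)%:E)%E.
Proof. by move=> Lf; rewrite /Rint /Rintegral fineK//; exact: integrable_fin_num. Qed.

Lemma L1_sum n (F : nat -> R -> R) : (forall i, L1 (F i)) ->
  L1 (fun x => \sum_(i < n) F i x).
Proof.
move=> LF; elim: n => [|n IH].
  rewrite (_ : (fun _ => _) = (fun=> 0)); first exact: integrable0.
  by apply/funext => x; rewrite big_ord0.
rewrite (_ : (fun _ => _) = (fun x => \sum_(i < n) F i x + F n x)).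
  exact: L1D.
by apply/funext => x; rewrite big_ord_recr.
Qed.

Lemma Rint_sum n (F : nat -> R -> R) : (forall i, L1 (F i)) ->
  Rint (fun x => \sum_(i < n) F i x) = \sum_(i < n) Rint (F i).
Proof.
move=> LF; elim: n => [|n IH].
  rewrite big_ord0 (@eq_Rint _ (fun=> 0)); last by move=> x; rewrite big_ord0.
  by rewrite /Rint Rintegral_cst// mul0r.
rewrite big_ord_recr/= -IH -RintD//; last exact: L1_sum.
by apply: eq_Rint => x; rewrite big_ord_recr.
Qed.

Lemma Rint_dominated (F : nat -> R -> R) f g :
  (forall n, measurable_fun setT (F n)) ->
  (forall x, F n x @[n --> \oo] --> f x) ->
  L1 g -> (forall n x, `|F n x| <= g x) ->
  L1 f /\ Rint (F n) @[n --> \oo] --> Rint f.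
Proof.
move=> mF Ff Lg Fg.
have mf : measurable_fun setT f.
  exact: (measurable_fun_cvg mF (fun x _ => Ff x)).
have LF n : L1 (F n) by exact: (L1_le (mF n) Lg).
have [] := @dominated_convergence _ _ _ mu setT measurableT
   (fun n => EFin \o F n) (EFin \o f) (EFin \o g).
- move=> n; apply/measurable_EFinP; exact: mF.
- apply/measurable_EFinP; exact: mf.
- by apply: aeW => x _; apply: cvg_EFin; [exact: nearW|exact: Ff].
- exact: Lg.
- by apply: aeW => x n _; rewrite /= lee_fin.
move=> Lf _ h; split => //.
apply: fine_cvg; rewrite fineK; last exact: integrable_fin_num.
exact: h.
Qed.

Section fubini.
Variables (f g : R -> R) (k : R -> R -> R) (M : R).
Hypotheses (Lf : L1 f) (Lg : L1 g).
Hypothesis mk : measurable_fun setT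
  (fun z : measurableTypeR R * measurableTypeR R => k z.1 z.2 : measurableTypeR R).
Hypothesis kM : forall x y, `|k x y| <= M.

Let F (z : measurableTypeR R * measurableTypeR R) : \bar R :=
  (f z.1 * (g z.2 * k z.1 z.2))%:E.

Let Lgk x : L1 (fun y => g y * k x y).
Proof.
by apply: (@L1M g (k x) M) => //; exact: (measurableT_comp mk (pair1_measurable x)).
Qed.

Let Lfk y : L1 (fun x => f x * k x y).
Proof.
apply: (@L1M f (k ^~ y) M) => //.
exact: (measurableT_comp mk (pair2_measurable y)).
Qed.

Let iF : (mu \x mu)%E.-integrable setT F.
Proof.
have mF : measurable_fun setT F.
  apply/measurable_EFinP; apply: measurable_funM.
    exact: (measurableT_comp (L1_meas Lf) measurable_fst).
  apply: measurable_funM => //.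
  exact: (measurableT_comp (L1_meas Lg) measurable_snd).
have M0 : 0 <= M by apply: le_trans (kM 0 0).
apply/integrable12ltyP => //.
apply: (@le_lt_trans _ _ (\int[mu]_x ((M * Rint (fun y => `|g y|)) * `|f x|)%:E)%E).
  apply: ge0_le_integral => //.
  - by move=> x _; exact: integral_ge0.
  - apply: (@measurable_fun_fubini_tonelli_F _ _ _ _ _ mu (abse \o F)).
      exact: measurableT_comp.
    by move=> z; exact: abse_ge0.
  - by apply/measurable_EFinP; exact: (L1_meas (L1Z _ (L1_norm Lf))).
  move=> x _.
  rewrite [X in (X <= _)%E](_ : _ = (`|f x| * Rint (fun y => `|g y * k x y|))%:E).
    rewrite lee_fin mulrC ler_wpM2r// -RintZ; last exact: L1_norm.
    apply: le_Rint => [||y]; [exact: L1_norm|exact/L1Z/L1_norm|].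
    by rewrite normrM mulrC ler_wpM2r.
  rewrite -RintZ; last exact: L1_norm.
  rewrite EFin_Rint; last exact/L1Z/L1_norm.
  by apply: eq_integral => y _; rewrite /F /= normrM.
rewrite -EFin_Rint ?ltry//; exact: (L1Z _ (L1_norm Lf)).
Qed.

Let F1E x : (\int[mu]_y F (x, y))%E = (f x * Rint (fun y => g y * k x y))%:E.
Proof. by rewrite -RintZ// EFin_Rint//; exact: L1Z. Qed.

Lemma fubini :
  Rint (fun x => f x * Rint (fun y => g y * k x y)) =
  Rint (fun y => g y * Rint (fun x => f x * k x y)).
Proof.
have := Fubini iF; rewrite (eq_integral _ _ (fun x _ => F1E x)).
have F2E y : (\int[mu]_x F (x, y))%E = (g y * Rint (fun x => f x * k x y))%:E.
  rewrite -RintZ// EFin_Rint; last exact: L1Z.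
  by apply: eq_integral => x _; rewrite /F /= mulrCA.
by rewrite (eq_integral _ _ (fun x _ => F2E x)) /Rint /Rintegral => ->.
Qed.

End fubini.

End integration.

(** * Derivatives and changes of variables *)

Section derivation.
Context {R : realType}.
Implicit Types (f g : R -> R) (x : R).

Lemma is_deriveD_fun f g x a b : is_derive x 1 f a -> is_derive x 1 g b ->
  is_derive x 1 (fun x => f x + g x) (a + b).
Proof. by move=> df dg; exact: is_deriveD. Qed.

Lemma is_deriveM_fun f g x a b : is_derive x 1 f a -> is_derive x 1 g b ->
  is_derive x 1 (fun x => f x * g x) (a * g x + f x * b).
Proof.
move=> df dg; apply: (is_derive_eq (@is_deriveM _ _ f g x 1 a b df dg)).
by rewrite /GRing.scale/=; ring.
Qed.

Lemma is_derive_comp_fun f g x a b : is_derive (g x) 1 f a -> is_derive x 1 g b ->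
  is_derive x 1 (fun x => f (g x)) (a * b).
Proof. by move=> df dg; exact: (@is_derive1_comp _ f g x a b df dg). Qed.

Lemma is_deriveN_fun f x a : is_derive x 1 f a -> is_derive x 1 (fun x => - f x) (- a).
Proof. by move=> df; exact: is_deriveN. Qed.

Lemma is_deriveV_fun f x a : f x != 0 -> is_derive x 1 f a ->
  is_derive x 1 (fun x => (f x)^-1) (- a / f x ^+ 2).
Proof.
move=> f0 df; apply: (is_derive_eq (@is_deriveV _ f x a 1 f0 df)).
by rewrite /GRing.scale/= mulNr mulrC mulNr.
Qed.

Lemma is_derive_cst_fun (c : R) x : is_derive x 1 (fun=> c) 0.
Proof. exact: is_derive_cst. Qed.

Lemma is_derive_id_fun x : is_derive x 1 (fun x : R => x) 1.
Proof. exact: is_derive_id. Qed.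

Lemma is_derive_continuous f x a : is_derive x 1 f a -> {for x, continuous f}.
Proof. by move=> df; apply: differentiable_continuous; apply/derivable1_diffP. Qed.

Lemma derive1_val f x a : is_derive x 1 f a -> derive1 f x = a.
Proof. by move=> df; rewrite derive1E; exact: derive_val. Qed.

Lemma derivable_is_derive f x : derivable f x 1 -> is_derive x 1 f (derive1 f x).
Proof. by move=> df; rewrite derive1E; exact: derivableP. Qed.

End derivation.

Section substitution.
Context {R : realType}.
Implicit Types (f g : R -> R).
Local Notation mu := (@lebesgue_measure R).

Lemma Rint_affine_ge0 (g : R -> R) a c : 0 < a -> continuous g -> L1 g ->
  (forall x, 0 <= g x) ->
  L1 (fun x => g (a * x + c)) /\ Rint (fun x => g (a * x + c)) = a^-1 * Rint g.
Proof.
move=> a0 cg Lg g0.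
pose F (x : R) := a * x + c.
have dF x : is_derive (x : R) (1 : R) F a.
  have := is_deriveD_fun (is_deriveM_fun (is_derive_cst_fun a x) (is_derive_id_fun x)) (is_derive_cst_fun c x).
  by rewrite mul0r add0r mulr1 addr0.
have F'E : derive1 F = cst a.
  by apply/funext => x; rewrite derive1E; exact: (@derive_val _ _ _ _ _ _ _ (dF x)).
have cF : continuous F.
  by move=> x; apply: differentiable_continuous; apply/derivable1_diffP.
have h : (\int[mu]_x (g x)%:E = \int[mu]_x ((g (F x)) * a)%:E)%E.
  rewrite (@increasing_ge0_integration_by_substitutionT R F g) //.
  - by apply: eq_integral => x _; rewrite F'E.
  - by move=> x y xy; rewrite /F ltrD2r ltr_pM2l.
  - by rewrite F'E; exact: cst_continuous.
  - by rewrite F'E; exact: is_cvg_cst.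
  - by rewrite F'E; exact: is_cvg_cst.
  - apply/cvgrNyPle => A; exists ((A - c) / a); split; first exact: num_real.
    by move=> x; rewrite ltr_pdivlMr// => /ltW; rewrite lerBrDr /F mulrC.
  - apply/cvgryPge => A; exists ((A - c) / a); split; first exact: num_real.
    by move=> x; rewrite ltr_pdivrMr// => /ltW; rewrite lerBlDr /F mulrC.
have mgF : measurable_fun setT (fun x => g (F x)).
  apply: continuous_measurable_fun => x.
  by apply: (@continuous_comp _ _ _ F g); [exact: cF|exact: cg].
have LgF : L1 (fun x => g (F x) * a).
  apply/integrableP; split.
    by apply/measurable_EFinP; exact: measurable_funM.
  under eq_integral.
    move=> x _; rewrite /= ger0_norm; last by rewrite mulr_ge0// ltW.
    over.
  by rewrite -h -EFin_Rint// ltry.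
split.
  apply: eq_L1 (L1Z a^-1 LgF) => x.
  by rewrite mulrCA mulVf ?gt_eqF// mulr1.
have -> : Rint g = Rint (fun x => g (F x) * a) by rewrite /Rint /Rintegral h.
rewrite -RintZ//; apply: eq_Rint => x.
by rewrite mulrCA mulVf ?gt_eqF// mulr1.
Qed.

Lemma Rint_opp_ge0 (g : R -> R) : continuous g -> L1 g -> (forall x, 0 <= g x) ->
  L1 (fun x => g (- x)) /\ Rint (fun x => g (- x)) = Rint g.
Proof.
move=> cg Lg g0.
have cgo : continuous (fun x => g (- x)).
  by move=> x; apply: (@continuous_comp _ _ _ -%R g); [exact: oppr_continuous|exact: cg].
have split_int (h : R -> R) : continuous h -> (forall x, 0 <= h x) ->
  (\int[mu]_x (h x)%:E = \int[mu]_(x in `[0%R, +oo[) (h x)%:E +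
     \int[mu]_(x in `[0%R, +oo[) (h (- x)%R)%:E)%E.
  move=> ch h0.
  have mh : measurable_fun setT (EFin \o h).
    by apply/measurable_EFinP; exact: continuous_measurable_fun.
  rewrite -(setUv `[0%R, +oo[%classic) ge0_integral_setU//=.
  - congr (_ + _)%E; rewrite setCitvr integral_itv_bndo_bndc; last first.
      exact: measurable_funTS.
    rewrite -[X in `]-oo, X]%classic]oppr0 ge0_integration_by_substitutionNy//.
    exact: continuous_subspaceT.
  - exact: measurableC.
  - by rewrite setUv.
  - by move=> x _; rewrite lee_fin.
  - exact/disj_setPCl.
have E : (\int[mu]_x (g (- x))%:E = \int[mu]_x (g x)%:E)%E.
  rewrite split_int// addeC [RHS]split_int//; congr (_ + _)%E.
  by apply: eq_integral => x _; rewrite opprK.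
have LgN : L1 (fun x => g (- x)).
  apply/integrableP; split.
    by apply/measurable_EFinP; exact: continuous_measurable_fun.
  under eq_integral do rewrite /= ger0_norm//.
  by rewrite E -EFin_Rint// ltry.
by split => //; rewrite /Rint /Rintegral E.
Qed.

Lemma L1_norm_add f : L1 f -> L1 (fun x => `|f x| + f x).
Proof. by move=> Lf; apply/L1D => //; exact: L1_norm. Qed.

Lemma transfer_ge0 (T : (R -> R) -> R -> R) (c : R) :
  (forall f g x, T (fun x => f x - g x) x = T f x - T g x) ->
  (forall g : R -> R, continuous g -> L1 g -> (forall x, 0 <= g x) ->
    L1 (T g) /\ Rint (T g) = c * Rint g) ->
  forall f, continuous f -> L1 f -> L1 (T f) /\ Rint (T f) = c * Rint f.
Proof.
move=> TB Tge f cf Lf.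
have cn : continuous (fun x => `|f x|).
  by move=> x; apply: (@continuous_comp _ _ _ f Num.norm); [exact: cf|exact: norm_continuous].
have [] := Tge (fun x => `|f x| + f x).
- by move=> x; apply: cvgD; [exact: cn|exact: cf].
- exact: L1_norm_add.
- by move=> x; have := ler_norm (- f x); rewrite normrN; lra.
move=> L1p I1.
have [//|||L2p I2] := Tge (fun x => `|f x|); first exact: L1_norm.
  by [].
have fE : f = (fun x => (`|f x| + f x) - `|f x|).
  by apply/funext => x; rewrite addrAC subrr add0r.
have E x : T f x = T (fun x => `|f x| + f x) x - T (fun x => `|f x|) x.
  by rewrite {1}fE TB.
split; first by apply: (@eq_L1 _ (fun x => T (fun x => `|f x| + f x) x - T (fun x => `|f x|) x)) => //; exact: L1B.
rewrite (eq_Rint E) RintB// I1 I2 -mulrBr -RintB//; last 2 first.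
- exact: L1_norm_add.
- exact: L1_norm.
by rewrite -fE.
Qed.

Lemma Rint_affine f a c : 0 < a -> continuous f -> L1 f ->
  L1 (fun x => f (a * x + c)) /\ Rint (fun x => f (a * x + c)) = a^-1 * Rint f.
Proof.
move=> a0; move: f; apply: (@transfer_ge0 (fun f x => f (a * x + c))) => // g cg Lg g0.
exact: Rint_affine_ge0.
Qed.

Lemma Rint_opp f : continuous f -> L1 f ->
  L1 (fun x => f (- x)) /\ Rint (fun x => f (- x)) = Rint f.
Proof.
move=> cf Lf; rewrite -[Rint f]mul1r; move: f cf Lf.
apply: (@transfer_ge0 (fun f x => f (- x))) => // g cg Lg g0.
by rewrite mul1r; exact: Rint_opp_ge0.
Qed.

Lemma Rint_shift f c : continuous f -> L1 f ->
  L1 (fun x => f (x + c)) /\ Rint (fun x => f (x + c)) = Rint f.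
Proof.
move=> cf Lf; have [L E] := Rint_affine c ltr01 cf Lf; split.
  by apply: eq_L1 L => x; rewrite mul1r.
by rewrite -[RHS]mul1r -[X in X * _]invr1 -E; apply: eq_Rint => x; rewrite mul1r.
Qed.

Lemma Rint_odd f : continuous f -> L1 f -> (forall x, f (- x) = - f x) -> Rint f = 0.
Proof.
move=> cf Lf fo; have [_ E] := Rint_opp cf Lf.
have := RintZ (-1) Lf; rewrite (@eq_Rint _ _ (fun x => f (- x))); last first.
  by move=> x; rewrite fo mulN1r.
by rewrite E; lra.
Qed.

End substitution.

(** * Cosine and sine transforms *)

Section amplitude.
Context {R : realType}.
Implicit Types a b c s : R.

(* The amplitude of [a cos + b sin], i.e. the modulus of [a - i b]. *)
Definition amp a b : R := Num.sqrt (a ^+ 2 + b ^+ 2).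

Lemma amp_ge0 a b : 0 <= amp a b. Proof. exact: sqrtr_ge0. Qed.

Lemma amp_sqr a b : amp a b ^+ 2 = a ^+ 2 + b ^+ 2.
Proof. by rewrite sqr_sqrtr// addr_ge0// sqr_ge0. Qed.

Lemma amp_le a b M : 0 <= M -> a ^+ 2 + b ^+ 2 <= M ^+ 2 -> amp a b <= M.
Proof. by move=> M0 h; rewrite -(ler_pXn2r (n := 2))// ?nnegrE ?amp_ge0// amp_sqr. Qed.

Lemma amp_dot a b c s : `|c * a + s * b| <= amp c s * amp a b.
Proof.
rewrite -(ler_pXn2r (n := 2))// ?nnegrE ?mulr_ge0 ?amp_ge0//.
rewrite real_normK ?num_real// exprMn !amp_sqr -subr_ge0.
rewrite (_ : _ - _ = (c * b - s * a) ^+ 2); last by ring.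
exact: sqr_ge0.
Qed.

Lemma amp_max a b M : (forall c s, amp c s = 1 -> c * a + s * b <= M) ->
  amp a b <= M.
Proof.
move=> h; have [a0|a0] := eqVneq (amp a b) 0.
  have /h : amp 1 0 = 1 by rewrite /amp expr1n expr0n/= addr0 sqrtr1.
  have : a ^+ 2 + b ^+ 2 = 0 by rewrite -amp_sqr a0 expr0n.
  rewrite a0; move/eqP; rewrite paddr_eq0 ?sqr_ge0// !sqrf_eq0 => /andP[/eqP-> /eqP->].
  by rewrite !mulr0 addr0.
have E : a ^+ 2 + b ^+ 2 = amp a b ^+ 2 by rewrite amp_sqr.
move: (amp a b) a0 E => r r0 E.
have /h : amp (a / r) (b / r) = 1.
  by rewrite /amp !exprMn -mulrDl E -exprMn divff// expr1n sqrtr1.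
by rewrite mulrAC [b / _ * b]mulrAC -mulrDl -!expr2 E expr2 mulfK.
Qed.

Lemma amp_cos_sin c s t : `|c * cos t + s * sin t| <= amp c s.
Proof.
by rewrite (le_trans (amp_dot _ _ _ _))// /amp cos2Dsin2 sqrtr1 mulr1.
Qed.

Lemma ampD a b c s : amp (a + c) (b + s) <= amp a b + amp c s.
Proof.
apply: amp_max => x y xy1; rewrite (_ : _ + _ = (x * a + y * b) + (x * c + y * s)).
  apply: lerD; rewrite (le_trans (ler_norm _))// (le_trans (amp_dot _ _ _ _))//;
    by rewrite xy1 mul1r.
by ring.
Qed.

Lemma ampZ c a b : amp (c * a) (c * b) = `|c| * amp a b.
Proof. by rewrite /amp !exprMn -mulrDr sqrtrM ?sqr_ge0// sqrtr_sqr. Qed.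

Lemma le_amp_l a b : `|a| <= amp a b.
Proof. by rewrite -sqrtr_sqr ler_wsqrtr// lerDl sqr_ge0. Qed.

Lemma le_amp_r a b : `|b| <= amp a b.
Proof. by rewrite -sqrtr_sqr ler_wsqrtr// lerDr sqr_ge0. Qed.

End amplitude.

Section trig.
Context {R : realType}.
Implicit Types f : R -> R.
Local Notation mu := (@lebesgue_measure R).

Lemma continuous_cosM (c : R) : continuous (fun x : R => cos (x * c)).
Proof. 
move=> x; apply: (@continuous_comp _ _ _ (fun x : R => x * c) cos); last exact: continuous_cos.
exact: mulrr_continuous.
Qed.

Lemma continuous_sinM (c : R) : continuous (fun x : R => sin (x * c)).
Proof. 
move=> x; apply: (@continuous_comp _ _ _ (fun x : R => x * c) sin); last exact: continuous_sin.
exact: mulrr_continuous.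
Qed.

Lemma continuous_Mcos (c : R) : continuous (fun x : R => cos (c * x)).
Proof. by under eq_fun do rewrite mulrC; exact: continuous_cosM. Qed.

Lemma continuous_Msin (c : R) : continuous (fun x : R => sin (c * x)).
Proof. by under eq_fun do rewrite mulrC; exact: continuous_sinM. Qed.

Lemma measurable_cosM (c : R) : measurable_fun setT (fun x : R => cos (x * c)).
Proof. apply: continuous_measurable_fun; exact: continuous_cosM. Qed.

Lemma measurable_sinM (c : R) : measurable_fun setT (fun x : R => sin (x * c)).
Proof. apply: continuous_measurable_fun; exact: continuous_sinM. Qed.

(* For real [f] the Fourier transform of the statement is [fcos f - i fsin f],
   see [fourier_real], and [Fabs f] is its modulus. *)
Definition fcos f xi : R := Rint (fun x => f x * cos (x * xi)).
Definition fsin f xi : R := Rint (fun x => f x * sin (x * xi)).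
Definition Fabs f xi : R := amp (fcos f xi) (fsin f xi).

Lemma L1_cos f xi : L1 f -> L1 (fun x => f x * cos (x * xi)).
Proof. by move=> Lf; apply: (L1M (M := 1) Lf (measurable_cosM xi)) => x; exact: cos_max. Qed.

Lemma L1_sin f xi : L1 f -> L1 (fun x => f x * sin (x * xi)).
Proof. by move=> Lf; apply: (L1M (M := 1) Lf (measurable_sinM xi)) => x; exact: sin_max. Qed.

Lemma fcosD f g xi : L1 f -> L1 g -> fcos (fun x => f x + g x) xi = fcos f xi + fcos g xi.
Proof.
move=> Lf Lg; rewrite /fcos -RintD; [|exact: L1_cos..].
by apply: eq_Rint => x; rewrite mulrDl.
Qed.

Lemma fsinD f g xi : L1 f -> L1 g -> fsin (fun x => f x + g x) xi = fsin f xi + fsin g xi.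
Proof.
move=> Lf Lg; rewrite /fsin -RintD; [|exact: L1_sin..].
by apply: eq_Rint => x; rewrite mulrDl.
Qed.

Lemma fcosZ c f xi : L1 f -> fcos (fun x => c * f x) xi = c * fcos f xi.
Proof.
move=> Lf; rewrite /fcos -RintZ; last exact: L1_cos.
by apply: eq_Rint => x; rewrite mulrA.
Qed.

Lemma fsinZ c f xi : L1 f -> fsin (fun x => c * f x) xi = c * fsin f xi.
Proof.
move=> Lf; rewrite /fsin -RintZ; last exact: L1_sin.
by apply: eq_Rint => x; rewrite mulrA.
Qed.

Lemma FabsD f g xi : L1 f -> L1 g ->
  Fabs (fun x => f x + g x) xi <= Fabs f xi + Fabs g xi.
Proof. by move=> Lf Lg; rewrite /Fabs fcosD// fsinD//; exact: ampD. Qed.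

Lemma FabsZ c f xi : L1 f -> Fabs (fun x => c * f x) xi = `|c| * Fabs f xi.
Proof. by move=> Lf; rewrite /Fabs fcosZ// fsinZ// ampZ. Qed.

Lemma Fabs_ge0 f xi : 0 <= Fabs f xi. Proof. exact: amp_ge0. Qed.

Lemma Fabs_pair c s f xi : L1 f ->
  Rint (fun x => f x * (c * cos (x * xi) + s * sin (x * xi))) = c * fcos f xi + s * fsin f xi.
Proof.
move=> Lf; rewrite /fcos /fsin -!RintZ; [|exact: L1_sin|exact: L1_cos].
rewrite -RintD; [|exact/L1Z/L1_cos|exact/L1Z/L1_sin].
by apply: eq_Rint => x; ring.
Qed.

Lemma Fabs_le_Rint f xi : L1 f -> Fabs f xi <= Rint (fun x => `|f x|).
Proof.
move=> Lf; apply: amp_max => c s cs1; rewrite -Fabs_pair//.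
rewrite (le_trans (ler_norm _))//; apply: norm_Rint_le.
- apply: (L1M (M := 1)) => //.
    by apply: measurable_funD; apply: measurable_funM => //; [exact: measurable_cosM|exact: measurable_sinM].
  by move=> x; rewrite -cs1 amp_cos_sin.
- exact: L1_norm.
- by move=> x; rewrite normrM ler_piMr// -cs1 amp_cos_sin.
Qed.

Lemma eq_Fabs f g xi : f =1 g -> Fabs f xi = Fabs g xi.
Proof. by move=> /funext ->. Qed.

Lemma Fabs_cvg_le (F : nat -> R -> R) f g xi M :
  (forall n, measurable_fun setT (F n)) ->
  (forall x, F n x @[n --> \oo] --> f x) ->
  L1 g -> (forall n x, `|F n x| <= g x) ->
  (forall n, Fabs (F n) xi <= M) -> Fabs f xi <= M.
Proof.
move=> mF Ff Lg Fg FM.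
have LF n : L1 (F n) by exact: (L1_le (mF n) Lg).
have [Lf _] := Rint_dominated mF Ff Lg Fg.
apply: amp_max => c s cs1; rewrite -Fabs_pair//.
pose K x := c * cos (x * xi) + s * sin (x * xi).
have mK : measurable_fun setT K.
  by apply: measurable_funD; apply: measurable_funM => //; [exact: measurable_cosM|exact: measurable_sinM].
have K1 x : `|K x| <= 1 by rewrite -cs1 amp_cos_sin.
have [_ cv] : L1 (fun x => f x * K x) /\
    Rint (fun x => F n x * K x) @[n --> \oo] --> Rint (fun x => f x * K x).
  apply: (@Rint_dominated _ (fun n x => F n x * K x) _ g) => //.
  - by move=> n; exact: measurable_funM.
  - by move=> x; apply: cvgM; [exact: Ff|exact: cvg_cst].
  - move=> n x; rewrite normrM (le_trans _ (Fg n x))//; exact: ler_piMr.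
apply: (cvgr_to_le cv).
  apply: nearW => n; rewrite Fabs_pair//.
  rewrite (le_trans (ler_norm _))// (le_trans (amp_dot _ _ _ _))// cs1 mul1r.
  exact: FM.
Qed.

Lemma continuous_fpair c s f : L1 f -> continuous (fun xi => c * fcos f xi + s * fsin f xi).
Proof.
move=> Lf.
rewrite (_ : (fun xi => _) = (fun xi => Rint (fun x => f x * (c * cos (x * xi) + s * sin (x * xi))))); last first.
  by apply/funext => xi; rewrite Fabs_pair.
move=> xi.
have mK (z : R) : measurable_fun setT (fun x : R => c * cos (x * z) + s * sin (x * z)).
  by apply: measurable_funD; apply: measurable_funM => //; [exact: measurable_cosM|exact: measurable_sinM].
have K1 (z x : R) : `|c * cos (x * z) + s * sin (x * z)| <= amp c s by exact: amp_cos_sin.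
apply: (@continuity_under_integral R _ _ mu (fun (z x : R) => f x * (c * cos (x * z) + s * sin (x * z)))
  setT measurableT (xi - 1) (xi + 1) _ _ (fun x => amp c s * `|f x|)).
- move=> z _; exact: (L1M Lf (mK z) (K1 z)).
- apply: aeW => x _ z _ /=.
  apply: cvgM; first exact: cvg_cst.
  apply: cvgD; apply: cvgM; try exact: cvg_cst.
    exact: continuous_Mcos.
  exact: continuous_Msin.
- exact: (L1Z _ (L1_norm Lf)).
- by move=> z _; apply: aeW => x _; rewrite normrM mulrC ler_wpM2r.
- by rewrite inE /= in_itv/=; apply/andP; split; lra.
Qed.

Lemma continuous_fcos f : L1 f -> continuous (fcos f).
Proof.
move=> Lf; have := @continuous_fpair 1 0 f Lf.
by under eq_fun => xi do rewrite mul1r mul0r addr0.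
Qed.

Lemma continuous_fsin f : L1 f -> continuous (fsin f).
Proof.
move=> Lf; have := @continuous_fpair 0 1 f Lf.
by under eq_fun => xi do rewrite mul1r mul0r add0r.
Qed.

End trig.

Section rapid.
Context {R : realType}.
Implicit Types (f g k : R -> R).
Local Notation mu := (@lebesgue_measure R).

Lemma L1_oneDsqrV : L1 (fun x : R => (oneDsqr x)^-1) /\
  Rint (fun x : R => (oneDsqr x)^-1) = pi.
Proof.
have p0 (x : R) : 0 <= (oneDsqr x)^-1 by rewrite invr_ge0 (le_trans _ (oneDsqr_ge1 x)).
have E : (\int[mu]_x ((oneDsqr x)^-1)%:E = (pi : R)%:E)%E.
  rewrite ge0_symfun_integralT//.
  - rewrite -set_itvcy integral0y_oneDsqr -EFinM; congr EFin.
    by rewrite mulrC divfK.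
  - exact: continuous_oneDsqrV.
  - by move=> x; rewrite /= /oneDsqr sqrrN.
split; last by rewrite /Rint /Rintegral E.
apply/integrableP; split.
  apply/measurable_EFinP; apply: continuous_measurable_fun.
  exact: continuous_oneDsqrV.
under eq_integral do rewrite /= ger0_norm//.
by rewrite E ltry.
Qed.

Definition rapid f := continuous f /\
  forall m : nat, exists M, forall x, `|x| ^+ m * `|f x| <= M.

Lemma rapid_cont f : rapid f -> continuous f. Proof. by case. Qed.

Lemma rapid_meas f : rapid f -> measurable_fun setT f.
Proof. by case=> + _; exact: continuous_measurable_fun. Qed.

Lemma rapid_bd f : rapid f -> exists2 M, 0 <= M & forall x, `|f x| <= M.
Proof.
move=> [_ /(_ 0%N)[M fM]]; exists M => [|x]; last by have := fM x; rewrite mul1r.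
by have := fM 0; rewrite mul1r; exact: le_trans.
Qed.

Lemma rapid_w f : rapid f -> exists2 M, 0 <= M & forall x, `|f x| <= M * (oneDsqr x)^-1.
Proof.
move=> fr; have [M M0 fM] := rapid_bd fr; have [_ /(_ 2)[N fN]] := fr.
exists (M + N).
  by rewrite addr_ge0// (le_trans _ (fN 0))// mulr_ge0.
move=> x; rewrite ler_pdivlMr ?(lt_le_trans _ (oneDsqr_ge1 x))// /oneDsqr mulrDr mulr1 lerD//.
by have := fN x; rewrite real_normK ?num_real// mulrC.
Qed.

Lemma rapid_L1 f : rapid f -> L1 f.
Proof.
move=> fr; have [M M0 fM] := rapid_w fr.
apply: L1_le (L1Z M L1_oneDsqrV.1) fM; exact: rapid_meas.
Qed.

Lemma rapidMb f k M : rapid f -> continuous k -> (forall x, `|k x| <= M) ->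
  rapid (fun x => f x * k x).
Proof.
move=> [cf fM] ck kM; split=> [x|m].
  by apply: cvgM; [exact: cf|exact: ck].
have [N fN] := fM m; exists (N * M) => x.
by rewrite normrM mulrA ler_pM// mulr_ge0.
Qed.

Lemma rapidD f g : rapid f -> rapid g -> rapid (fun x => f x + g x).
Proof.
move=> [cf fM] [cg gM]; split=> [x|m].
  by apply: cvgD; [exact: cf|exact: cg].
have [N fN] := fM m; have [N' gN] := gM m; exists (N + N') => x.
by rewrite (le_trans _ (lerD (fN x) (gN x)))// -mulrDr ler_wpM2l// ler_normD.
Qed.

Lemma rapidZ c f : rapid f -> rapid (fun x => c * f x).
Proof.
move=> fr; have := @rapidMb f (fun=> c) `|c| fr (@cst_continuous _ _ c) (fun=> lexx _).
by under eq_fun do rewrite mulrC.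
Qed.

Lemma rapidB f g : rapid f -> rapid g -> rapid (fun x => f x - g x).
Proof.
move=> fr gr; have := rapidD fr (rapidZ (-1) gr).
by under eq_fun do rewrite mulN1r.
Qed.

Lemma rapidM f g : rapid f -> rapid g -> rapid (fun x => f x * g x).
Proof.
move=> fr gr; have [M _ gM] := rapid_bd gr.
by apply: (rapidMb fr _ gM); case: gr.
Qed.

Lemma rapid_pow m f : rapid f -> rapid (fun x => x ^+ m * f x).
Proof.
move=> [cf fM]; split=> [x|n].
  by apply: cvgM; [exact: exprn_continuous|exact: cf].
have [M fN] := fM (n + m)%N; exists M => x.
by rewrite normrM normrX mulrA -exprD.
Qed.

Lemma rapid_sum n (F : nat -> R -> R) : (forall i, rapid (F i)) ->
  rapid (fun x => \sum_(i < n) F i x).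
Proof.
move=> LF; elim: n => [|n IH].
  have := rapidZ 0 (LF 0%N).
  by under eq_fun do rewrite mul0r; under [in X in _ -> X]eq_fun do rewrite big_ord0.
by under eq_fun do rewrite big_ord_recr; exact: rapidD.
Qed.

End rapid.

Section poisson.
Context {R : realType}.
Implicit Types (f g k : R -> R).
Local Notation mu := (@lebesgue_measure R).

Lemma int_exp_cos_tail (e z c : R) : 0 < e -> `|c| <= 1 ->
  (\int[mu]_(x in `[0%R, +oo[) (expR (- e * x) * (1 + c * cos (x * z)))%:E =
   (e^-1 + c * (e / (e ^+ 2 + z ^+ 2)))%:E)%E.
Proof.
move=> e0 c1.
have ez0 : 0 < e ^+ 2 + z ^+ 2 by rewrite ltr_wpDr ?sqr_ge0// exprn_gt0.
pose F x := expR (- e * x) *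
  (- e^-1 + c * (e ^+ 2 + z ^+ 2)^-1 * (z * sin (x * z) + (- e) * cos (x * z))).
have dF (x : R) : is_derive x 1 F (expR (- e * x) * (1 + c * cos (x * z))).
  have dxz := is_deriveM_fun (is_derive_id_fun x) (is_derive_cst_fun z x).
  have dex := is_derive_comp_fun (is_derive_expR _) (is_deriveM_fun (is_derive_cst_fun (- e) x) (is_derive_id_fun x)).
  have dc := is_derive_comp_fun (is_derive_cos _) dxz.
  have ds := is_derive_comp_fun (is_derive_sin _) dxz.
  apply: (is_derive_eq (is_deriveM_fun dex (is_deriveD_fun (is_derive_cst_fun (- e^-1) x)
    (is_deriveM_fun (is_derive_cst_fun (c * (e ^+ 2 + z ^+ 2)^-1) x)
       (is_deriveD_fun (is_deriveM_fun (is_derive_cst_fun z x) ds) (is_deriveM_fun (is_derive_cst_fun (- e) x) dc)))))).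
  by field; rewrite (gt_eqF e0) gt_eqF.
have cF x : {for x, continuous F} by exact: is_derive_continuous (dF x).
rewrite (@ge0_continuous_FTC2y R _ F 0 0).
- rewrite -EFinB; congr EFin; rewrite /F !mulr0 mul0r expR0 sin0 cos0; field.
  by rewrite (gt_eqF e0) gt_eqF.
- move=> x _; rewrite mulr_ge0 ?expR_ge0// -lerBlDl sub0r lerNl.
  rewrite (le_trans (ler_norm _))// normrN normrM.
  by rewrite mulr_ile1 ?cos_max.
- apply: continuous_subspaceT => x; apply: cvgM.
    exact: (is_derive_continuous (is_derive_comp_fun (is_derive_expR _) (is_deriveM_fun (is_derive_cst_fun (- e) x) (is_derive_id_fun x)))).
  apply: cvgD; first exact: cvg_cst.
  by apply: cvgM; [exact: cvg_cst|exact: continuous_cosM].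
- have h : expR (- e * x) @[x --> +oo] --> (0 : R).
    under eq_fun do rewrite mulNr; apply: (cvg_comp (fun x => e * x) (fun x => expR (- x))); last exact: cvgr_expR.
    apply/cvgryPge => A; exists (A / e); split; first exact: num_real.
    by move=> x; rewrite ltr_pdivrMr// => /ltW; rewrite mulrC.
  pose K := `|- e^-1| + `|c * (e ^+ 2 + z ^+ 2)^-1| * amp (- e) z.
  apply: norm_cvg0; apply: (@squeeze_cvgr _ _ _ _ (fun=> 0) (fun x => expR (- e * x) * K)).
  + apply: nearW => x; rewrite normr_ge0/= /F normrM ger0_norm ?expR_ge0//.
    rewrite ler_wpM2l ?expR_ge0// (le_trans (ler_normD _ _))// lerD2l normrM.
    by rewrite ler_wpM2l// addrC amp_cos_sin.
  + exact: cvg_cst.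
  + by rewrite -[X in _ --> X](mul0r K); apply: cvgM => //; exact: cvg_cst.
- by move=> x _; exact: ex_derive.
- by apply: cvg_at_right_filter; exact: cF.
- by move=> x _; exact: derive1_val.
Qed.

Lemma continuous_expRN (e : R) : continuous (fun x : R => expR (- e * `|x|)).
Proof.
move=> x; apply: (@continuous_comp _ _ _ (fun x : R => - e * `|x|) expR);
  last exact: continuous_expR.
by apply: cvgM; [exact: cvg_cst|exact: norm_continuous].
Qed.

Lemma poisson_cos_aux (e z c : R) : 0 < e -> `|c| <= 1 ->
  L1 (fun x => expR (- e * `|x|) * (1 + c * cos (x * z))) /\
  Rint (fun x => expR (- e * `|x|) * (1 + c * cos (x * z))) =
  2 * (e^-1 + c * (e / (e ^+ 2 + z ^+ 2))).
Proof.
move=> e0 c1; set g := fun x => _.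
have cg : continuous g.
  move=> x; apply: cvgM; first exact: continuous_expRN.
  apply: cvgD; first exact: cvg_cst.
  by apply: cvgM; [exact: cvg_cst|exact: continuous_cosM].
have g0 x : 0 <= g x.
  rewrite /g mulr_ge0 ?expR_ge0// -lerBlDl sub0r lerNl.
  rewrite (le_trans (ler_norm _))// normrN normrM.
  by rewrite mulr_ile1 ?cos_max.
have E : (\int[mu]_x (g x)%:E = (2 * (e^-1 + c * (e / (e ^+ 2 + z ^+ 2))))%:E)%E.
  rewrite ge0_symfun_integralT//; last first.
    by move=> x; rewrite /g/= normrN [- x * z]mulNr cosN.
  rewrite EFinM -(int_exp_cos_tail _ e0 c1); congr (_ * _)%E.
  rewrite -set_itvcy; apply: eq_integral => x.
  by rewrite inE/= in_itv/= andbT /g => x0; rewrite ger0_norm.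
split; last by rewrite /Rint /Rintegral E.
apply/integrableP; split.
  by apply/measurable_EFinP; exact: continuous_measurable_fun.
under eq_integral do rewrite /= ger0_norm//.
by rewrite E ltry.
Qed.

Lemma L1_expRN (e : R) : 0 < e -> L1 (fun x : R => expR (- e * `|x|)).
Proof.
move=> e0; have [|L _] := @poisson_cos_aux e 0 0 e0; first by rewrite normr0.
by apply: eq_L1 L => x; rewrite mul0r addr0 mulr1.
Qed.

Lemma poisson_cos (e z : R) : 0 < e ->
  Rint (fun x => expR (- e * `|x|) * cos (x * z)) = 2 * e / (e ^+ 2 + z ^+ 2).
Proof.
move=> e0.
have [|L1' E1] := @poisson_cos_aux e z 1 e0; first by rewrite normr1.
have [|L0 E0] := @poisson_cos_aux e z 0 e0; first by rewrite normr0.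
rewrite (@eq_Rint _ _ (fun x => expR (- e * `|x|) * (1 + 1 * cos (x * z)) -
   expR (- e * `|x|) * (1 + 0 * cos (x * z)))).
  by rewrite RintB// E1 E0; field; rewrite !gt_eqF// ltr_wpDr ?sqr_ge0// exprn_gt0.
by move=> x; ring.
Qed.

(* Abel summation: inserting [exp (- e |xi|)] turns the inversion integral into
   a convolution with the Poisson kernel, which is an approximate identity. *)
Theorem inversion f M (x : R) : continuous f -> (forall y, `|f y| <= M) -> L1 f ->
  L1 (Fabs f) ->
  f x = (2 * pi)^-1 * Rint (fun xi => fcos f xi * cos (x * xi) + fsin f xi * sin (x * xi)).
Proof.
move=> cf fM Lf LF.
have M0 : 0 <= M by exact: le_trans (fM 0).
pose ep (n : nat) : R := n.+1%:R^-1.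
have ep0 n : 0 < ep n by rewrite invr_gt0.
have cvep : ep n @[n --> \oo] --> (0 : R) by exact: cvg_harmonic.
pose G xi := fcos f xi * cos (x * xi) + fsin f xi * sin (x * xi).
have mG : measurable_fun setT G.
  apply: continuous_measurable_fun => xi; apply: cvgD; apply: cvgM.
  - exact: continuous_fcos.
  - exact: continuous_Mcos.
  - exact: continuous_fsin.
  - exact: continuous_Msin.
have GF xi : `|G xi| <= Fabs f xi by exact: amp_cos_sin.
have [_ A] : L1 G /\ Rint (fun xi => expR (- ep n * `|xi|) * G xi) @[n --> \oo] --> Rint G.
  apply: (Rint_dominated _ _ LF).
  - move=> n; apply: measurable_funM => //.
    by apply: continuous_measurable_fun; exact: continuous_expRN.
  - move=> xi; rewrite -[X in _ --> X]mul1r; apply: cvgM; last exact: cvg_cst.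
    have h : - ep n * `|xi| @[n --> \oo] --> (0 : R).
      have := cvgM (cvgN cvep) (cvg_cst `|xi|).
      by rewrite oppr0 mul0r; exact.
    by have := cvg_comp _ _ h (@continuous_expR R 0); rewrite expR0.
  - move=> n xi; rewrite (le_trans _ (GF xi))// normrM ler_piMl//.
    by rewrite ger0_norm ?expR_ge0// -expR0 ler_expR mulNr oppr_le0 mulr_ge0// ltW.
have B n : Rint (fun xi => expR (- ep n * `|xi|) * G xi) =
    Rint (fun u => f (ep n * u + x) * (2 * (oneDsqr u)^-1)).
  pose k (xi y : R) := cos (xi * (y - x)).
  have mk : measurable_fun setT
    (fun z : measurableTypeR R * measurableTypeR R => k z.1 z.2 : measurableTypeR R).
    apply: (@measurableT_comp _ _ _ _ _ _ (@cos R)).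
      by apply: continuous_measurable_fun; exact: continuous_cos.
    by apply: measurable_funM => //; apply: measurable_funB.
  have k1 xi y : `|k xi y| <= 1 by exact: cos_max.
  have Le := L1_expRN (ep0 n).
  transitivity (Rint (fun xi => expR (- ep n * `|xi|) * Rint (fun y => f y * k xi y))).
    apply: eq_Rint => xi; congr (_ * _).
    rewrite /G mulrC [fsin _ _ * _]mulrC -Fabs_pair//; apply: eq_Rint => y.
    rewrite /k mulrBr cosB; congr (_ * _).
    by rewrite [y * xi]mulrC [x * xi]mulrC; ring.
  rewrite (fubini Le Lf mk k1).
  have den0 y : 0 < ep n ^+ 2 + (y - x) ^+ 2.
    by rewrite ltr_wpDr ?sqr_ge0// exprn_gt0.
  pose P y := 2 * ep n / (ep n ^+ 2 + (y - x) ^+ 2).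
  have cP : continuous P.
    move=> y; apply: cvgM; first exact: cvg_cst.
    apply: cvgV; first by rewrite gt_eqF.
    apply: cvgD; first exact: cvg_cst.
    apply: (@continuous_comp _ _ _ (fun y => y - x) (fun y => y ^+ 2)).
      by apply: cvgB; [exact: cvg_id|exact: cvg_cst].
    exact: exprn_continuous.
  pose g y := f y * (2 * ep n / (ep n ^+ 2 + (y - x) ^+ 2)).
  transitivity (Rint g).
    by apply: eq_Rint => y; rewrite /k poisson_cos.
  have [L <-] : L1 (fun u => g (ep n * u + x)) /\ ep n * Rint (fun u => g (ep n * u + x)) = Rint g.
    have [] := @Rint_affine _ g (ep n) x (ep0 n) _ _.
    - by move=> y; apply: cvgM; [exact: cf|exact: cP].
    - apply: (@L1M _ f P (2 * ep n / ep n ^+ 2)) => //.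
        exact: continuous_measurable_fun.
      move=> y; rewrite /P ger0_norm; last by rewrite divr_ge0 ?mulr_ge0// ltW.
      rewrite ler_wpM2l ?mulr_ge0 ?(ltW (ep0 n))// lef_pV2 ?posrE//; last exact: exprn_gt0.
      by rewrite lerDl sqr_ge0.
    - by move=> L ->; split => //; rewrite mulrA divff ?gt_eqF// mul1r.
  rewrite -RintZ//; apply: eq_Rint => u.
  rewrite /g addrK /oneDsqr; field.
  by rewrite !gt_eqF// ?ltr_wpDr ?sqr_ge0 ?exprn_gt0//.
have [_ C] : L1 (fun u => f x * (2 * (oneDsqr u)^-1)) /\
    Rint (fun u => f (ep n * u + x) * (2 * (oneDsqr u)^-1)) @[n --> \oo] -->
    Rint (fun u => f x * (2 * (oneDsqr u)^-1)).
  apply: (@Rint_dominated _ _ _ (fun u => 2 * M * (oneDsqr u)^-1)).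
  - move=> n; apply: continuous_measurable_fun => u; apply: cvgM.
      apply: (@continuous_comp _ _ _ (fun u => ep n * u + x) f); last exact: cf.
      apply: cvgD; last exact: cvg_cst.
      by apply: cvgM; [exact: cvg_cst|exact: cvg_id].
    by apply: cvgM; [exact: cvg_cst|exact: continuous_oneDsqrV].
  - move=> u; apply: cvgM; last exact: cvg_cst.
    have h : ep n * u + x @[n --> \oo] --> x.
      have := cvgD (cvgM cvep (cvg_cst u)) (cvg_cst x).
      by rewrite mul0r add0r; exact.
    exact: (cvg_comp _ _ h (cf x)).
  - exact: (L1Z _ L1_oneDsqrV.1).
  - move=> n u; have w0 : 0 <= (oneDsqr u)^-1 by rewrite invr_ge0 (le_trans _ (oneDsqr_ge1 u)).
    by rewrite normrM [`|2 * _|]ger0_norm ?mulr_ge0// mulrA ler_wpM2r// mulrC ler_wpM2l.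
rewrite (funext B) in A; rewrite (cvg_unique _ A C).
2: exact: norm_hausdorff.
rewrite RintZ; last exact: (L1Z _ L1_oneDsqrV.1).
rewrite RintZ; last exact: L1_oneDsqrV.1.
rewrite L1_oneDsqrV.2; move: (@pi R) (pi_gt0 R) => P P0.
by field; rewrite gt_eqF.
Qed.

End poisson.

(** * Smooth functions *)

Section smoothness.
Context {R : realType}.
Implicit Types (f g : R -> R).

Lemma smooth_coind (P : (R -> R) -> Prop) :
  (forall f, P f -> exists f', (forall x : R, is_derive x 1 f (f' x)) /\ P f') ->
  forall f, P f -> smooth f.
Proof.
move=> step f Pf n; have {Pf} : P (derive1n n f).
  elim: n => [//|n IH]; have [f' [df Pf']] := step _ IH.
  by rewrite derive1nS (_ : derive1 _ = f')//; apply/funext => x; exact: derive1_val.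
by move=> /step[f' [df _]] x; exact: ex_derive.
Qed.

Lemma smoothD f : smooth f -> forall x : R, is_derive x 1 f (derive1 f x).
Proof. by move=> sf x; apply: derivable_is_derive; exact: (sf 0%N). Qed.

Lemma smooth_derive1 f : smooth f -> smooth (derive1 f).
Proof. by move=> sf n x; have := sf n.+1 x; rewrite derive1Sn. Qed.

Lemma smooth_cont f : smooth f -> continuous f.
Proof. by move=> sf x; exact: is_derive_continuous (smoothD sf x). Qed.

Inductive smooth_alg : (R -> R) -> Prop :=
| smooth_alg_base f : smooth f -> smooth_alg f
| smooth_alg_add f g : smooth_alg f -> smooth_alg g -> smooth_alg (fun x => f x + g x)
| smooth_alg_mul f g : smooth_alg f -> smooth_alg g -> smooth_alg (fun x => f x * g x)
| smooth_alg_inv f : (forall x, f x != 0) -> smooth_alg f -> smooth_alg (fun x => (f x)^-1)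
| smooth_alg_comp f g : smooth f -> smooth_alg g -> smooth_alg (fun x => f (g x)).

Lemma smooth_cst (c : R) : smooth (fun=> c).
Proof.
apply: (@smooth_coind (fun f => exists c, f = fun=> c)); last by exists c.
by move=> f [d ->]; exists (fun=> 0); split; [move=> x; exact: is_derive_cst_fun|exists 0].
Qed.

Lemma smooth_id : smooth (fun x : R => x).
Proof.
apply: (@smooth_coind (fun f => f = id \/ exists c, f = fun=> c)); last by left.
move=> f [->|[d ->]].
  by exists (fun=> 1); split; [exact: is_derive_id_fun|right; exists 1].
by exists (fun=> 0); split; [move=> x; exact: is_derive_cst_fun|right; exists 0].
Qed.

Lemma smooth_alg_derive f : smooth_alg f -> exists f', (forall x : R, is_derive x 1 f (f' x)) /\ smooth_alg f'.
Proof.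
elim=> {f}.
- move=> f sf; exists (derive1 f); split; first exact: smoothD.
  exact/smooth_alg_base/smooth_derive1.
- move=> f g _ [f' [df sf']] _ [g' [dg sg']].
  exists (fun x => f' x + g' x); split; first by move=> x; exact: is_deriveD_fun.
  exact: smooth_alg_add.
- move=> f g sf [f' [df sf']] sg [g' [dg sg']].
  exists (fun x => f' x * g x + f x * g' x); split; first by move=> x; exact: is_deriveM_fun.
  by apply: smooth_alg_add; exact: smooth_alg_mul.
- move=> f f0 sf [f' [df sf']].
  exists (fun x => (-1) * f' x * ((f x)^-1 * (f x)^-1)); split.
    move=> x; apply: (is_derive_eq (is_deriveV_fun (f0 x) (df x))).
    by rewrite mulN1r expr2 invfM.
  apply: smooth_alg_mul; last by apply: smooth_alg_mul; exact: smooth_alg_inv.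
  by apply: smooth_alg_mul => //; apply: smooth_alg_base; exact: smooth_cst.
- move=> f g sf sg [g' [dg sg']].
  exists (fun x => derive1 f (g x) * g' x); split.
    by move=> x; exact: (is_derive_comp_fun (smoothD sf (g x)) (dg x)).
  by apply: smooth_alg_mul => //; apply: smooth_alg_comp => //; exact: smooth_derive1.
Qed.

Lemma smooth_alg_smooth f : smooth_alg f -> smooth f.
Proof. by apply: smooth_coind; exact: smooth_alg_derive. Qed.

Lemma smooth_add f g : smooth f -> smooth g -> smooth (fun x => f x + g x).
Proof. by move=> sf sg; apply: smooth_alg_smooth; apply: smooth_alg_add; exact: smooth_alg_base. Qed.

Lemma smooth_mul f g : smooth f -> smooth g -> smooth (fun x => f x * g x).
Proof. by move=> sf sg; apply: smooth_alg_smooth; apply: smooth_alg_mul; exact: smooth_alg_base. Qed.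

Lemma smooth_inv f : (forall x, f x != 0) -> smooth f -> smooth (fun x => (f x)^-1).
Proof. by move=> f0 sf; apply: smooth_alg_smooth; apply: smooth_alg_inv => //; exact: smooth_alg_base. Qed.

Lemma smooth_comp f g : smooth f -> smooth g -> smooth (fun x => f (g x)).
Proof. by move=> sf sg; apply: smooth_alg_smooth; apply: smooth_alg_comp => //; exact: smooth_alg_base. Qed.

End smoothness.

Section derive_misc.
Context {R : realType}.
Implicit Types (f g : R -> R).

Lemma is_deriveXV_fun f (x a : R) n : f x != 0 -> is_derive x 1 f a ->
  is_derive x 1 (fun x => (f x)^-1 ^+ n) (- n%:R * (f x)^-1 ^+ n.+1 * a).
Proof.
move=> f0 df; elim: n => [|n IH].
  by rewrite oppr0 !mul0r; exact: is_derive_cst_fun.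
under eq_fun do rewrite exprS.
apply: (is_derive_eq (is_deriveM_fun (is_deriveV_fun f0 df) IH)).
rewrite -[(f x ^+ 2)^-1]exprVn; move: (f x)^-1 => v.
by rewrite -natr1 !exprS; ring.
Qed.

Lemma is_derive0_quadratic f (K : R) : (forall x, `|f x| <= K * x ^+ 2) -> is_derive (0 : R) (1 : R) f 0.
Proof.
move=> fK.
have f0 : f 0 = 0.
  by apply/eqP; rewrite -normr_le0 (le_trans (fK 0))// expr0n mulr0.
have cv : (h^-1 *: ((f \o shift 0) (h *: (1 : R)) - f 0)) @[h --> 0^'] --> (0 : R).
  rewrite f0; apply: norm_cvg0.
  apply: (@squeeze_cvgr _ _ _ _ (fun=> 0) (fun h => K * `|h|)).
  - near=> h; rewrite normr_ge0/= addr0 subr0 /GRing.scale/= mulr1.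
    have h0 : h != 0 by near: h; exact: nbhs_dnbhs_neq.
    rewrite normrM normfV ler_pdivrMl ?normr_gt0// (le_trans (fK h))//.
    by rewrite -[h ^+ 2]real_normK ?num_real// expr2 mulrCA.
  - exact: cvg_cst.
  - rewrite -[X in _ --> X](mulr0 K) -[X in _ * X](@normr0 _ R).
    apply: cvgM; first exact: cvg_cst.
    by apply: cvg_within_filter; exact: norm_continuous.
apply: DeriveDef; first by apply/cvg_ex; exists 0.
exact: (cvg_lim _ cv).
Unshelve. all: by end_near. Qed.

End derive_misc.

Section flat.
Context {R : realType}.
Variable c : R.
Hypothesis c0 : 0 < c.

(* Up to linear combinations this family is closed under differentiation; the
   index [l] is there so that [cutoff / (4 lambda^2 - xi^2)] is visibly smooth. *)
Definition flat (k l : nat) (y : R) : R :=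
  if 0 < y then y^-1 ^+ k * (y + c)^-1 ^+ l * expR (- y^-1) else 0.

Lemma flat_pos k l y : 0 < y -> 0 < flat k l y.
Proof.
move=> y0; rewrite /flat y0 !mulr_gt0 ?expR_gt0// exprn_gt0// invr_gt0// addr_gt0//.
Qed.

Lemma flat_npos k l y : y <= 0 -> flat k l y = 0.
Proof. by rewrite leNgt /flat => /negbTE ->. Qed.

Lemma flat_le k l y : `|flat k l y| <= (c^-1 ^+ l * (k.+2)`!%:R) * y ^+ 2.
Proof.
have [y0|y0] := leP y 0.
  rewrite flat_npos// normr0 mulr_ge0 ?sqr_ge0// mulr_ge0// exprn_ge0//.
  by rewrite invr_ge0 ltW.
rewrite ger0_norm; last by rewrite ltW// flat_pos.
rewrite /flat y0 mulrAC [c^-1 ^+ l * _]mulrC [leRHS]mulrAC.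
have t0 : 0 < y^-1 by rewrite invr_gt0.
rewrite ler_pM//.
- by rewrite mulr_ge0 ?expR_ge0// exprn_ge0// ltW.
- by rewrite exprn_ge0// invr_ge0 addr_ge0// ltW.
- rewrite expRN ler_pdivrMr ?expR_gt0//.
  have := @expR_ge1Dxn R y^-1 k.+1 (ltW t0).
  move=> h; have {}h : y^-1 ^+ k.+2 <= (k.+2)`!%:R * expR y^-1.
    rewrite mulrC -ler_pdivrMr ?ltr0n ?fact_gt0//.
    by apply: le_trans h; rewrite lerDr.
  rewrite mulrAC -ler_pdivrMr ?exprn_gt0//.
  by apply: le_trans h; rewrite -exprVn -exprD addn2.
- rewrite lerXn2r ?nnegrE ?invr_ge0 ?addr_ge0 ?(ltW c0) ?(ltW y0)//.
  by rewrite lef_pV2 ?posrE// ?addr_gt0// lerDr ltW.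
Qed.

Let base k l (y : R) := (y^-1 ^+ k * (y + c)^-1 ^+ l) * expR (- y^-1).

Lemma flat_derive k l (y : R) : is_derive y 1 (flat k l)
  (- k%:R * flat k.+1 l y + - l%:R * flat k l.+1 y + flat k.+2 l y).
Proof.
have [y0|y0|->] := ltgtP y 0.
- rewrite !flat_npos ?ltW// !mulr0 !addr0.
  apply: (near_eq_is_derive _ (is_derive_cst_fun 0 y)).
  near=> z; rewrite flat_npos// ltW//; near: z; exact: lt_nbhsl.
- apply: (@near_eq_is_derive _ _ _ (base k l)).
    near=> z; rewrite /flat ifT//; near: z; exact: lt_nbhsr.
  have yn0 : y != 0 by rewrite gt_eqF.
  have ycn0 : y + c != 0 by rewrite gt_eqF// addr_gt0.
  have D1 := is_deriveXV_fun k yn0 (is_derive_id_fun y).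
  have D2 := is_deriveXV_fun l (f := fun y => y + c) ycn0 (is_deriveD_fun (is_derive_id_fun y) (is_derive_cst_fun c y)).
  have D3 := is_derive_comp_fun (is_derive_expR _) (is_deriveN_fun (is_deriveV_fun (f := id) yn0 (is_derive_id_fun y))).
  apply: (is_derive_eq (is_deriveM_fun (is_deriveM_fun D1 D2) D3)).
  rewrite /flat y0 -[(y ^+ 2)^-1]exprVn; move: (expR _) (y + c)^-1 => E w.
by move: y^-1 => v; rewrite !exprS; ring.
- rewrite !flat_npos// !mulr0 !addr0.
  exact: (is_derive0_quadratic (flat_le k l)).
Unshelve. all: by end_near. Qed.

Inductive flat_span : (R -> R) -> Prop :=
| flat_span_base k l a : flat_span (fun y => a * flat k l y)
| flat_span_add f g : flat_span f -> flat_span g -> flat_span (fun y => f y + g y).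

Lemma smooth_flat k l : smooth (flat k l).
Proof.
apply: (@smooth_coind _ flat_span); last first.
  rewrite (_ : flat k l = (fun y => 1 * flat k l y)); first exact: flat_span_base.
  by apply/funext => y; rewrite mul1r.
move=> f; elim=> {f} [i j a|f g _ [f' [df sf]] _ [g' [dg sg]]].
- exists (fun y => ((a * (- i%:R)) * flat i.+1 j y + (a * (- j%:R)) * flat i j.+1 y) +
    a * flat i.+2 j y); split.
    move=> y; apply: (is_derive_eq (is_deriveM_fun (is_derive_cst_fun a y) (flat_derive i j y))).
    by ring.
  by do ![exact: flat_span_base | apply: flat_span_add].
- by exists (fun y => f' y + g' y); split; [move=> y; exact: is_deriveD_fun|exact: flat_span_add].
Qed.

End flat.

Section under_integral.
Context {R : realType}.
Implicit Types (f g : R -> R).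
Local Notation mu := (@lebesgue_measure R).

Lemma is_derive_under_integral (f f' : R -> R -> R) g (x : R) : L1 g -> (forall y, 0 <= g y) ->
  (forall x, L1 (f x)) ->
  (forall x y : R, is_derive x 1 (f ^~ y) (f' x y)) ->
  (forall x y, `|f' x y| <= g y) ->
  is_derive x 1 (fun x => Rint (f x)) (Rint (f' x)).
Proof.
move=> Lg g0 Lf df f'g.
have E z y : partial1of2 f z y = f' z y by rewrite /partial1of2; exact: derive1_val.
have Ix : `](x - 1), (x + 1)[%classic x by rewrite /= in_itv/=; apply/andP; split; lra.
have H1 : forall z, `](x - 1), (x + 1)[%classic z -> mu.-integrable setT (EFin \o f z) by move=> z _; exact: Lf.
have H2 : forall z y, `](x - 1), (x + 1)[%classic z -> [set: R] y -> derivable (f ^~ y) z 1.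
  by move=> z y _ _; case: (df z y).
have H3 : forall z y, `](x - 1), (x + 1)[%classic z -> [set: R] y -> `|partial1of2 f z y| <= g y.
  by move=> z y _ _; rewrite E.
have dF := derivable_under_integral measurableT Ix H1 H2 g0 Lg H3.
have FE := differentiation_under_integral measurableT Ix H1 H2 g0 Lg H3.
apply: DeriveDef; first exact: dF.
by rewrite -derive1E FE; apply: eq_Rint => y; rewrite E.
Qed.

Lemma fcos_derive f (xi : R) : L1 f -> L1 (fun x => x * f x) ->
  is_derive xi 1 (fcos f) (- fsin (fun x => x * f x) xi).
Proof.
move=> Lf Lxf.
have -> : - fsin (fun x => x * f x) xi = Rint (fun x => f x * (- sin (x * xi) * x)).
  rewrite /fsin -[LHS]mulN1r -RintZ; last exact: L1_sin.
  by apply: eq_Rint => x; ring.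
apply: (@is_derive_under_integral (fun xi x => f x * cos (x * xi)) (fun xi x => f x * (- sin (x * xi) * x))
  (fun x => `|x * f x|)) => //.
- exact: L1_norm.
- by move=> z; exact: L1_cos.
- move=> z x; apply: (is_derive_eq (is_deriveM_fun (is_derive_cst_fun (f x) z) (is_derive_comp_fun (is_derive_cos _) (is_deriveM_fun (is_derive_cst_fun x z) (is_derive_id_fun z))))).
  by ring.
- move=> z x; rewrite !normrM normrN [leRHS]mulrC ler_wpM2l//.
  by rewrite ler_piMl// sin_max.
Qed.

Lemma fsin_derive f (xi : R) : L1 f -> L1 (fun x => x * f x) ->
  is_derive xi 1 (fsin f) (fcos (fun x => x * f x) xi).
Proof.
move=> Lf Lxf.
have -> : fcos (fun x => x * f x) xi = Rint (fun x => f x * (cos (x * xi) * x)).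
  by apply: eq_Rint => x; ring.
apply: (@is_derive_under_integral (fun xi x => f x * sin (x * xi)) (fun xi x => f x * (cos (x * xi) * x))
  (fun x => `|x * f x|)) => //.
- exact: L1_norm.
- by move=> z; exact: L1_sin.
- move=> z x; apply: (is_derive_eq (is_deriveM_fun (is_derive_cst_fun (f x) z) (is_derive_comp_fun (is_derive_sin _) (is_deriveM_fun (is_derive_cst_fun x z) (is_derive_id_fun z))))).
  by ring.
- move=> z x; rewrite !normrM [leRHS]mulrC ler_wpM2l//.
  by rewrite ler_piMl// cos_max.
Qed.

End under_integral.

Section compact_support.
Context {R : realType}.
Variable A : R.
Hypothesis A0 : 0 < A.
Implicit Types (a b f g : R -> R).
Local Notation mu := (@lebesgue_measure R).

(* Smooth functions supported in [[-A, A]]. *)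
Definition Cc a := smooth a /\ forall x, A < `|x| -> a x = 0.

Lemma Cc_derive a : Cc a -> Cc (derive1 a).
Proof.
move=> [sa a0]; split=> [|x Ax]; first exact: smooth_derive1.
apply: derive1_val; apply: (near_eq_is_derive _ (is_derive_cst_fun 0 x)).
near=> y; rewrite a0//; near: y.
by apply: (@cvgr_gt _ _ _ _ _ `|x|) => //; exact: norm_continuous.
Unshelve. all: by end_near. Qed.

Lemma Cc_mul a f : Cc a -> smooth f -> Cc (fun x => f x * a x).
Proof.
move=> [sa a0] sf; split=> [|x Ax]; first exact: smooth_mul.
by rewrite a0// mulr0.
Qed.

Lemma Cc_scale a c : Cc a -> Cc (fun x => c * a x).
Proof. by move=> ca; apply: (@Cc_mul a (fun=> c)) => //; exact: smooth_cst. Qed.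

Lemma Cc_idM a : Cc a -> Cc (fun x => x * a x).
Proof. by move=> ca; apply: (@Cc_mul a id) => //; exact: smooth_id. Qed.

Lemma Cc_Rap a : Cc a -> rapid a.
Proof.
move=> [sa a0]; split; first exact: smooth_cont.
move=> m.
have cb : {within `[- A, A], continuous (fun x => `|x| ^+ m * `|a x|)}.
  apply: continuous_subspaceT => x; apply: cvgM.
    apply: (@continuous_comp _ _ _ (fun x : R => `|x|) (fun x : R => x ^+ m)).
      exact: norm_continuous.
    exact: exprn_continuous.
  apply: (@continuous_comp _ _ _ a (fun x : R => `|x|)); last exact: norm_continuous.
  exact: smooth_cont.
have AA : - A <= A by move: A0; lra.
have [c _ cM] := EVT_max AA cb.
exists (`|c| ^+ m * `|a c|) => x.
have [xA|xA] := leP `|x| A.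
  by apply: cM; rewrite in_itv/= -ler_norml.
by rewrite a0// normr0 mulr0 mulr_ge0// exprn_ge0.
Qed.

Lemma Cc_L1 a : Cc a -> L1 a. Proof. by move=> /Cc_Rap/rapid_L1. Qed.

Lemma Rint_derive_compact g g' : (forall x : R, is_derive x 1 g (g' x)) -> continuous g' ->
  (forall x, A < `|x| -> g x = 0) -> (forall x, A < `|x| -> g' x = 0) -> Rint g' = 0.
Proof.
move=> dg cg' g0 g'0; pose B := A + 1; have A00 := A0.
have B0 : - B < B by rewrite /B; lra.
have gB : g B = 0 by apply: g0; rewrite /B ger0_norm; lra.
have gNB : g (- B) = 0 by apply: g0; rewrite /B normrN ger0_norm; lra.
have cg x : {for x, continuous g} by exact: is_derive_continuous (dg x).
have : (\int[mu]_(x in `[(- B)%R, B]) (g' x)%:E = (g B)%:E - (g (- B))%:E)%E.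
  apply: continuous_FTC2 => //.
  - by apply: continuous_subspaceT.
  - split; first by move=> x _; exact: ex_derive.
      by apply: cvg_at_right_filter; exact: cg.
    by apply: cvg_at_left_filter; exact: cg.
  - by move=> x _; exact: derive1_val.
rewrite gB gNB sube0 => E.
rewrite /Rint /Rintegral.
suff -> : (\int[mu]_x (g' x)%:E = \int[mu]_(x in `[(- B)%R, B]) (g' x)%:E)%E by rewrite E.
rewrite [RHS]integral_mkcond; apply: eq_integral => x _.
rewrite patchE; case: ifPn => //; rewrite notin_setE/= in_itv/= => xB.
rewrite g'0//; move/negP: xB; rewrite -ler_norml -ltNge /B; lra.
Qed.

Lemma fcos_parts a x : Cc a -> x * fcos a x = - fsin (derive1 a) x.
Proof.
move=> ca; have [sa a0] := ca; have ca' := Cc_derive ca.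
have La := Cc_L1 ca; have La' := Cc_L1 ca'.
have h : Rint (fun y => derive1 a y * sin (y * x) + x * (a y * cos (y * x))) = 0.
  apply: (@Rint_derive_compact (fun y => a y * sin (y * x))).
  - move=> y; apply: (is_derive_eq (is_deriveM_fun (smoothD sa y)
      (is_derive_comp_fun (is_derive_sin _) (is_deriveM_fun (is_derive_id_fun y) (is_derive_cst_fun x y))))).
    by ring.
  - move=> y; apply: cvgD; first apply: cvgM.
    + by apply: smooth_cont; exact: smooth_derive1.
    + exact: continuous_sinM.
    + apply: cvgM; first exact: cvg_cst.
      by apply: cvgM; [exact: smooth_cont|exact: continuous_cosM].
  - by move=> y Ay; rewrite a0// mul0r.
  - by move=> y Ay; rewrite a0// ca'.2// !mul0r mulr0 addr0.
have := h; rewrite RintD; [|exact: L1_sin|exact/L1Z/L1_cos].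
rewrite RintZ; last exact: L1_cos.
by rewrite -/(fcos a x) -/(fsin (derive1 a) x) => /eqP; rewrite addr_eq0 => /eqP ->; rewrite opprK.
Qed.

Lemma fsin_parts a x : Cc a -> x * fsin a x = fcos (derive1 a) x.
Proof.
move=> ca; have [sa a0] := ca; have ca' := Cc_derive ca.
have La := Cc_L1 ca; have La' := Cc_L1 ca'.
have h : Rint (fun y => derive1 a y * cos (y * x) - x * (a y * sin (y * x))) = 0.
  apply: (@Rint_derive_compact (fun y => a y * cos (y * x))).
  - move=> y; apply: (is_derive_eq (is_deriveM_fun (smoothD sa y)
      (is_derive_comp_fun (is_derive_cos _) (is_deriveM_fun (is_derive_id_fun y) (is_derive_cst_fun x y))))).
    by ring.
  - move=> y; apply: cvgB; first apply: cvgM.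
    + by apply: smooth_cont; exact: smooth_derive1.
    + exact: continuous_cosM.
    + apply: cvgM; first exact: cvg_cst.
      by apply: cvgM; [exact: smooth_cont|exact: continuous_sinM].
  - by move=> y Ay; rewrite a0// mul0r.
  - by move=> y Ay; rewrite a0// ca'.2// !mul0r mulr0 subr0.
have := h; rewrite RintB; [|exact: L1_cos|exact/L1Z/L1_sin].
rewrite RintZ; last exact: L1_sin.
by rewrite -/(fsin a x) -/(fcos (derive1 a) x) => /eqP; rewrite subr_eq0 => /eqP ->.
Qed.

(* Stable under differentiation and under multiplication by [x], hence made of
   Schwartz functions. *)
Definition bl_kernel k := exists a b, [/\ Cc a, Cc b & k = (fun x => fcos a x + fsin b x)].

Lemma bl_kernel_derive k : bl_kernel k -> exists k', (forall x : R, is_derive x 1 k (k' x)) /\ bl_kernel k'.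
Proof.
move=> [a [b [ca cb ->]]].
have ca1 := Cc_scale (-1) (Cc_idM ca); have cb1 := Cc_idM cb.
exists (fun x => fcos (fun y => y * b y) x + fsin (fun y => -1 * (y * a y)) x); split; last first.
  by exists (fun y => y * b y), (fun y => -1 * (y * a y)).
move=> x; rewrite fsinZ; last exact: Cc_L1 (Cc_idM ca).
rewrite mulN1r addrC.
by apply: is_deriveD_fun; [apply: fcos_derive|apply: fsin_derive]; apply: Cc_L1 => //; exact: Cc_idM.
Qed.

Lemma bl_kernel_idM k : bl_kernel k -> bl_kernel (fun x => x * k x).
Proof.
move=> [a [b [ca cb ->]]].
exists (derive1 b), (fun y => -1 * derive1 a y); split.
- exact: Cc_derive.
- exact/Cc_scale/Cc_derive.
apply/funext => x; rewrite mulrDr fcos_parts// fsin_parts// fsinZ.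
  by rewrite mulN1r addrC.
exact/Cc_L1/Cc_derive.
Qed.

Lemma bl_kernel_bd k : bl_kernel k -> exists M, forall x, `|k x| <= M.
Proof.
move=> [a [b [ca cb ->]]].
exists (Rint (fun x => `|a x|) + Rint (fun x => `|b x|)) => x.
rewrite (le_trans (ler_normD _ _))// lerD//.
  by rewrite (le_trans (le_amp_l _ (fsin a x)))// Fabs_le_Rint//; exact: Cc_L1.
by rewrite (le_trans (le_amp_r (fcos b x) _))// Fabs_le_Rint//; exact: Cc_L1.
Qed.

Lemma bl_kernel_pow m k : bl_kernel k -> bl_kernel (fun x => x ^+ m * k x).
Proof.
move=> kk; elim: m => [|m IH].
  by rewrite (_ : (fun x => _) = k)//; apply/funext => x; rewrite mul1r.
rewrite (_ : (fun x => _) = (fun x => x * (x ^+ m * k x))); first exact: bl_kernel_idM.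
by apply/funext => x; rewrite mulrA exprS.
Qed.

Lemma bl_kernel_Rap k : bl_kernel k -> rapid k.
Proof.
move=> kk; split.
  by have [k' [dk _]] := bl_kernel_derive kk => x; exact: is_derive_continuous (dk x).
move=> m; have [M kM] := bl_kernel_bd (bl_kernel_pow m kk); exists M => x.
by have := kM x; rewrite normrM normrX.
Qed.

End compact_support.

(** * Convolution and band-limited functions *)

Section convolution.
Context {R : realType}.
Implicit Types (f g h G : R -> R).
Local Notation mu := (@lebesgue_measure R).

Definition conv G h x := Rint (fun y => h y * G (x - y)).

Lemma continuous_reflect G x : continuous G -> continuous (fun y => G (x - y)).
Proof.
move=> cG y; apply: (@continuous_comp _ _ _ (fun y => x - y) G); last exact: cG.
by apply: cvgB; [exact: cvg_cst|exact: cvg_id].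
Qed.

Lemma conv_L1 G h x : rapid G -> L1 h -> L1 (fun y => h y * G (x - y)).
Proof.
move=> rG Lh; have [M _ GM] := rapid_bd rG.
apply: (@L1M _ h (fun y => G (x - y)) M) => //.
by apply: continuous_measurable_fun; apply: continuous_reflect; exact: rapid_cont.
Qed.

Lemma conv_bd G h M x : L1 h -> rapid G -> (forall y, `|G y| <= M) ->
  `|conv G h x| <= M * Rint (fun y => `|h y|).
Proof.
move=> Lh rG GM; rewrite -RintZ; last exact: L1_norm.
apply: norm_Rint_le; first exact: conv_L1.
  exact/L1Z/L1_norm.
by move=> y; rewrite normrM mulrC ler_wpM2r.
Qed.

Lemma conv_derive G G' h (x : R) : rapid G -> rapid G' -> L1 h ->
  (forall x : R, is_derive x 1 G (G' x)) -> is_derive x 1 (conv G h) (conv G' h x).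
Proof.
move=> rG rG' Lh dG; have [M M0 GM] := rapid_bd rG'.
apply: (@is_derive_under_integral _ (fun x y => h y * G (x - y)) (fun x y => h y * G' (x - y))
  (fun y => M * `|h y|)).
- exact/L1Z/L1_norm.
- by move=> y; rewrite mulr_ge0.
- by move=> z; exact: conv_L1.
- move=> z y.
  have D1 := is_derive_comp_fun (f := G) (g := fun z => z - y) (dG (z - y)) (is_deriveD_fun (is_derive_id_fun z) (is_derive_cst_fun (- y) z)).
  apply: (is_derive_eq (is_deriveM_fun (is_derive_cst_fun (h y) z) D1)).
  by ring.
- by move=> z y; rewrite normrM mulrC ler_wpM2r.
Qed.

Lemma conv_moment m G h x : rapid G -> rapid h ->
  x ^+ m * conv G h x =
  \sum_(i < m.+1) 'C(m, i)%:R * conv (fun z => z ^+ (m - i) * G z) (fun y => y ^+ i * h y) x.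
Proof.
move=> rG rh; have Lh := rapid_L1 rh.
have L i : L1 (fun y => 'C(m, i)%:R * (y ^+ i * h y * ((x - y) ^+ (m - i) * G (x - y)))).
  apply: L1Z; apply: (@conv_L1 (fun z => z ^+ (m - i) * G z) (fun y => y ^+ i * h y)).
    exact: rapid_pow.
  exact/rapid_L1/rapid_pow.
transitivity (\sum_(i < m.+1) Rint (fun y => 'C(m, i)%:R * (y ^+ i * h y * ((x - y) ^+ (m - i) * G (x - y))))).
  rewrite -(Rint_sum m.+1 L) /conv -RintZ; last exact: conv_L1.
  apply: eq_Rint => y; rewrite -{1}[x](subrK y) exprDn mulr_suml; apply: eq_bigr => i _.
  by rewrite -mulr_natl; ring.
apply: eq_bigr => i _; rewrite RintZ//.
apply: (@conv_L1 (fun z => z ^+ (m - i) * G z) (fun y => y ^+ i * h y)).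
  exact: rapid_pow.
exact/rapid_L1/rapid_pow.
Qed.

Lemma conv_Rap G G' h : rapid G -> rapid G' -> rapid h ->
  (forall x : R, is_derive x 1 G (G' x)) -> rapid (conv G h).
Proof.
move=> rG rG' rh dG; split=> [x|m].
  by apply: is_derive_continuous; apply: (@conv_derive G G' h x) => //; exact: rapid_L1.
have E (i : 'I_m.+1) : exists M, forall x, `|'C(m, i)%:R * conv (fun z => z ^+ (m - i) * G z) (fun y => y ^+ i * h y) x| <= M.
  have [M _ GM] := rapid_bd (rapid_pow (m - i) rG).
  exists ('C(m, i)%:R * (M * Rint (fun y => `|y ^+ i * h y|))) => x.
  rewrite normrM normr_nat ler_wpM2l// conv_bd//; last exact: rapid_pow.
  exact/rapid_L1/rapid_pow.
pose N i := projT1 (cid (E i)).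
exists (\sum_i N i) => x; rewrite -normrX -normrM conv_moment//.
rewrite (le_trans (ler_norm_sum _ _ _))//; apply: ler_sum => i _.
exact: (projT2 (cid (E i))).
Qed.

Lemma conv_fubini G h (phi : R -> R) K : rapid G -> rapid h -> continuous phi ->
  (forall x, `|phi x| <= K) ->
  Rint (fun x => conv G h x * phi x) = Rint (fun y => h y * Rint (fun z => G z * phi (z + y))).
Proof.
move=> rG rh cphi phiK; have [M M0 GM] := rapid_w rG.
have K0 : 0 <= K by exact: le_trans (phiK 0).
have w0 (x : R) : 0 < oneDsqr x by exact: lt_le_trans (oneDsqr_ge1 x).
pose k x y := oneDsqr x * phi x * (G (x - y) * (oneDsqr y)^-1).
pose g y := h y * oneDsqr y.
have Lg : L1 g.
  apply: (@eq_L1 _ (fun y => h y + y ^+ 2 * h y)).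
    by move=> y; rewrite /g /oneDsqr; ring.
  by apply: L1D; apply: rapid_L1 => //; exact: rapid_pow.
have mk : measurable_fun setT
    (fun z : measurableTypeR R * measurableTypeR R => k z.1 z.2 : measurableTypeR R).
  apply: measurable_funM; apply: measurable_funM.
  - apply: (@measurableT_comp _ _ _ _ _ _ (@oneDsqr R)) => //.
    by apply: continuous_measurable_fun; exact: continuous_oneDsqr.
  - apply: (@measurableT_comp _ _ _ _ _ _ phi) => //.
    exact: continuous_measurable_fun.
  - apply: (@measurableT_comp _ _ _ _ _ _ G).
      exact: rapid_meas.
    exact: measurable_funB.
  - apply: (@measurableT_comp _ _ _ _ _ _ (fun x : R => (oneDsqr x)^-1)) => //.
    by apply: continuous_measurable_fun; exact: continuous_oneDsqrV.
have kM x y : `|k x y| <= 2 * M * K.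
  rewrite /k !normrM (gtr0_norm (w0 x)) [`|(oneDsqr y)^-1|]gtr0_norm ?invr_gt0//.
  rewrite mulrA ler_pdivrMr//.
  have h1 : `|G (x - y)| * oneDsqr (x - y) <= M by rewrite -ler_pdivlMr// GM.
  have h2 : oneDsqr x <= 2 * oneDsqr (x - y) * oneDsqr y.
    rewrite /oneDsqr -subr_ge0.
    rewrite (_ : _ - _ = 1 + (x - y *+ 2) ^+ 2 + 2 * ((x - y) * y) ^+ 2); last by ring.
    by apply: addr_ge0; [apply: addr_ge0 => //; exact: sqr_ge0|apply: mulr_ge0 => //; exact: sqr_ge0].
  rewrite [leLHS](_ : _ = (oneDsqr x * `|G (x - y)|) * `|phi x|); last by ring.
  rewrite [leRHS](_ : _ = (2 * M * oneDsqr y) * K); last by ring.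
  rewrite ler_pM ?mulr_ge0 ?(ltW (w0 _))//.
  apply: (le_trans (ler_wpM2r (normr_ge0 _) h2)).
  rewrite (_ : _ * _ = 2 * (`|G (x - y)| * oneDsqr (x - y)) * oneDsqr y); last by ring.
  by rewrite ler_wpM2r ?(ltW (w0 _))// ler_wpM2l.
have := fubini L1_oneDsqrV.1 Lg mk kM.
rewrite (@eq_Rint _ _ (fun x => conv G h x * phi x)); last first.
  move=> x; rewrite -RintZ; last first.
    apply: (@eq_L1 _ (fun y => (oneDsqr x * phi x) * (h y * G (x - y)))).
      by move=> y; rewrite /g /k; field; rewrite gt_eqF.
    apply/L1Z/conv_L1 => //; exact: rapid_L1.
  rewrite /conv mulrC -RintZ; last by apply: conv_L1 => //; exact: rapid_L1.
  by apply: eq_Rint => y; rewrite /g /k; field; rewrite !gt_eqF.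
move=> ->; apply: eq_Rint => y; rewrite /g -mulrA; congr (_ * _).
have cGs : continuous (fun z => G z * phi (z + y)).
  move=> z; apply: cvgM; first exact: rapid_cont.
  apply: (@continuous_comp _ _ _ (fun z => z + y) phi); last exact: cphi.
  by apply: cvgD; [exact: cvg_id|exact: cvg_cst].
have LGs : L1 (fun z => G z * phi (z + y)).
  apply: (L1M (M := K) (rapid_L1 rG)) => //.
  apply: continuous_measurable_fun => z.
  apply: (@continuous_comp _ _ _ (fun z => z + y) phi); last exact: cphi.
  by apply: cvgD; [exact: cvg_id|exact: cvg_cst].
have [L <-] := Rint_shift (- y) cGs LGs.
rewrite -RintZ.
  by apply: eq_Rint => x; rewrite /k subrK; field; rewrite !gt_eqF.
apply: (@eq_L1 _ (fun x => (oneDsqr y)^-1 * (G (x - y) * phi (x - y + y)))).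
  by move=> x; rewrite /k subrK; field; rewrite !gt_eqF.
exact: L1Z.
Qed.

Lemma fcos_conv G h xi : rapid G -> rapid h ->
  fcos (conv G h) xi = fcos G xi * fcos h xi - fsin G xi * fsin h xi.
Proof.
move=> rG rh.
rewrite {1}/fcos (conv_fubini (K := 1) rG rh (@continuous_cosM _ xi))//; last first.
  by move=> x; exact: cos_max.
rewrite [RHS](_ : _ = fcos G xi * fcos h xi + (- fsin G xi) * fsin h xi); last by ring.
rewrite -Fabs_pair; last exact: rapid_L1.
apply: eq_Rint => y; congr (_ * _).
rewrite [RHS](_ : _ = cos (y * xi) * fcos G xi + (- sin (y * xi)) * fsin G xi); last by ring.
rewrite -Fabs_pair; last exact: rapid_L1.
by apply: eq_Rint => z; rewrite mulrDl cosD; ring.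
Qed.

Lemma fsin_conv G h xi : rapid G -> rapid h ->
  fsin (conv G h) xi = fsin G xi * fcos h xi + fcos G xi * fsin h xi.
Proof.
move=> rG rh.
rewrite {1}/fsin (conv_fubini (K := 1) rG rh (@continuous_sinM _ xi))//; last first.
  by move=> x; exact: sin_max.
rewrite -Fabs_pair; last exact: rapid_L1.
apply: eq_Rint => y; congr (_ * _).
rewrite [RHS](_ : _ = sin (y * xi) * fcos G xi + cos (y * xi) * fsin G xi); last by ring.
rewrite -Fabs_pair; last exact: rapid_L1.
by apply: eq_Rint => z; rewrite mulrDl sinD; ring.
Qed.

Lemma amp_mul (a b c s : R) : amp (a * c - b * s) (a * s + b * c) = amp a b * amp c s.
Proof.
rewrite /amp -sqrtrM ?addr_ge0 ?sqr_ge0//; congr Num.sqrt; ring.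
Qed.

Lemma Fabs_conv G h xi : rapid G -> rapid h -> Fabs (conv G h) xi = Fabs G xi * Fabs h xi.
Proof.
by move=> rG rh; rewrite /Fabs fcos_conv// fsin_conv// -amp_mul; congr amp; ring.
Qed.

End convolution.

Section bandlimited.
Context {R : realType}.
Variables (A m : R).
Hypotheses (A0 : 0 < A) (m0 : 0 <= m).
Implicit Types (a b f g h phi psi u w : R -> R).
Local Notation mu := (@lebesgue_measure R).

Definition box (x : R) : R := \1_`[(- A), A] x.
Definition wt (x : R) : R := expR (- m * `|x|).

Lemma boxE x : box x = (`|x|%R <= A)%R%:R.
Proof.
by rewrite /box indicE; congr (nat_of_bool _)%:R; apply/idP/idP;
  rewrite inE/= in_itv/= ler_norml.
Qed.

Lemma box_ge0 x : 0 <= box x. Proof. by rewrite boxE. Qed.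

Lemma L1_box : L1 box /\ Rint box = 2 * A.
Proof.
have E : (\int[mu]_x (box x)%:E = (2 * A)%:E)%E.
  have /= mE := lebesgue_measure_itv `[(- A), A]; rewrite lte_fin in mE.
  rewrite /box integral_indic// setIT; apply: etrans mE _.
  by rewrite ifT ?(lt_trans _ A0) ?oppr_lt0// -EFinD opprK; congr EFin; ring.
split; last by rewrite /Rint /Rintegral E.
apply/integrableP; split.
  by apply/measurable_EFinP; exact: measurable_indic.
under eq_integral do rewrite /= ger0_norm ?box_ge0//.
by rewrite E ltry.
Qed.

Lemma wt_gt0 x : 0 < wt x. Proof. exact: expR_gt0. Qed.

Lemma wt_le1 x : wt x <= 1.
Proof. by rewrite /wt -expR0 ler_expR mulNr oppr_le0 mulr_ge0. Qed.

Lemma wtM x y : wt x * wt y <= wt (x + y).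
Proof.
rewrite /wt -expRD ler_expR -mulrDr !mulNr lerN2 ler_wpM2l//; exact: ler_normD.
Qed.

Lemma wtN x : wt (- x) = wt x. Proof. by rewrite /wt normrN. Qed.

(* [psi] is band-limited to [[-A, A]] with spectral density at most [D wt]. *)
Definition band D psi := exists a b, [/\ measurable_fun setT a, measurable_fun setT b,
  forall x, amp (a x) (b x) <= D * wt x * box x & psi = (fun x => fcos a x + fsin b x)].

Lemma band_L1 D a b : 0 <= D -> measurable_fun setT a -> measurable_fun setT b ->
  (forall x, amp (a x) (b x) <= D * wt x * box x) -> L1 a /\ L1 b.
Proof.
move=> D0 ma mb ab.
have h x : amp (a x) (b x) <= D * box x.
  by rewrite (le_trans (ab x))// ler_wpM2r ?box_ge0// ler_piMr// wt_le1.
split; apply: (L1_le _ (L1Z D L1_box.1)) => // x;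
  rewrite (le_trans _ (h x))//; [exact: le_amp_l|exact: le_amp_r].
Qed.

Lemma band_bounded D psi : 0 <= D -> band D psi -> forall x, `|psi x| <= 2 * A * D.
Proof.
move=> D0 [a [b [ma mb ab ->]]] x; have [La Lb] := band_L1 D0 ma mb ab.
rewrite /fcos /fsin -RintD; [|exact: L1_cos|exact: L1_sin].
apply: (@le_trans _ _ (Rint (fun y => D * box y))); last first.
  by rewrite RintZ ?L1_box.2 1?mulrC//; exact: L1_box.1.
apply: norm_Rint_le; first by apply: L1D; [exact: L1_cos|exact: L1_sin].
  exact/L1Z/L1_box.1.
move=> y; rewrite (le_trans (amp_cos_sin _ _ _))// (le_trans (ab y))//.
by rewrite ler_wpM2r ?box_ge0// ler_piMr// wt_le1.
Qed.

Lemma band_continuous D psi : 0 <= D -> band D psi -> continuous psi.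
Proof.
move=> D0 [a [b [ma mb ab ->]]] x; have [La Lb] := band_L1 D0 ma mb ab.
by apply: cvgD; [exact: continuous_fcos|exact: continuous_fsin].
Qed.

Lemma rapid_band D phi psi : 0 <= D -> rapid phi -> band D psi -> rapid (fun x => phi x * psi x).
Proof.
by move=> D0 rphi rpsi; apply: (rapidMb rphi); [exact: band_continuous rpsi|exact: band_bounded rpsi].
Qed.

Lemma fcos_bd f : L1 f -> forall x, `|fcos f x| <= Rint (fun x => `|f x|).
Proof. by move=> Lf x; exact: (le_trans (le_amp_l _ (fsin f x)) (Fabs_le_Rint x Lf)). Qed.

Lemma fsin_bd f : L1 f -> forall x, `|fsin f x| <= Rint (fun x => `|f x|).
Proof. by move=> Lf x; exact: (le_trans (le_amp_r (fcos f x) _) (Fabs_le_Rint x Lf)). Qed.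

Lemma modulation_bd c s p q phi xi eta : amp c s = 1 -> L1 phi ->
  `|Rint (fun x => phi x * (c * cos (x * xi) + s * sin (x * xi)) *
                 (p * cos (x * eta) + q * sin (x * eta)))| <=
  amp p q * (2^-1 * (Fabs phi (xi - eta) + Fabs phi (xi + eta))).
Proof.
move=> cs1 Lphi.
pose p1 := c * p - s * (- q); pose q1 := c * (- q) + s * p.
pose p2 := c * p - s * q; pose q2 := c * q + s * p.
have L (k l z : R) : L1 (fun x => phi x * (k * cos (x * z) + l * sin (x * z))).
  apply: (L1M (M := amp k l) Lphi); last by move=> x; exact: amp_cos_sin.
  by apply: measurable_funD; apply: measurable_funM => //; [exact: measurable_cosM|exact: measurable_sinM].
have -> : Rint (fun x => phi x * (c * cos (x * xi) + s * sin (x * xi)) *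
                 (p * cos (x * eta) + q * sin (x * eta))) =
    2^-1 * ((p1 * fcos phi (xi - eta) + q1 * fsin phi (xi - eta)) +
            (p2 * fcos phi (xi + eta) + q2 * fsin phi (xi + eta))).
  rewrite -(Fabs_pair p1 q1 (xi - eta) Lphi) -(Fabs_pair p2 q2 (xi + eta) Lphi).
  rewrite -RintD; [|exact: L|exact: L].
  rewrite -RintZ; last by apply: L1D; exact: L.
  apply: eq_Rint => x; rewrite /p1 /q1 /p2 /q2 [x * (xi - eta)]mulrBr
    [x * (xi + eta)]mulrDr cosB sinB cosD sinD.
  move: (cos _) (sin _) (cos _) (sin _) (phi x) => c1 s1 c2 s2 ph.
  by field.
have ampN : amp p (- q) = amp p q by rewrite /amp sqrrN.
rewrite normrM ger0_norm ?invr_ge0// mulrCA ler_wpM2l ?invr_ge0//.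
rewrite (le_trans (ler_normD _ _))// mulrDr lerD// (le_trans (amp_dot _ _ _ _))//.
  by rewrite /p1 /q1 amp_mul cs1 mul1r ampN.
by rewrite /p2 /q2 amp_mul cs1 mul1r.
Qed.

Lemma Fabs_prod D M phi psi : 0 <= D -> 0 <= M -> rapid phi -> band D psi ->
  (forall xi, Fabs phi xi <= M * wt xi) ->
  forall xi, Fabs (fun x => phi x * psi x) xi <= M * (2 * A * D) * wt xi.
Proof.
move=> D0 M0 rphi rpsi phiM xi.
have rpp := rapid_band D0 rphi rpsi.
have Lphi := rapid_L1 rphi.
have [a [b [ma mb ab psiE]]] := rpsi.
have [La Lb] := band_L1 D0 ma mb ab.
apply: amp_max => c s cs1; rewrite -Fabs_pair; last exact: rapid_L1.
pose T x := c * cos (x * xi) + s * sin (x * xi).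
have mT : measurable_fun setT T.
  by apply: measurable_funD; apply: measurable_funM => //; [exact: measurable_cosM|exact: measurable_sinM].
have T1 x : `|T x| <= 1 by rewrite -cs1; exact: amp_cos_sin.
have LT : L1 (fun x => phi x * T x) by exact: (L1M Lphi mT T1).
have mc (F : R -> R) : continuous F -> measurable_fun setT
    (fun z : measurableTypeR R * measurableTypeR R => F (z.2 * z.1) : measurableTypeR R).
  move=> cF; apply: (@measurableT_comp _ _ _ _ _ _ F).
    exact: continuous_measurable_fun.
  by apply: measurable_funM.
pose P eta := fcos (fun x => phi x * T x) eta.
pose Q eta := fsin (fun x => phi x * T x) eta.
have cP : continuous P by exact: continuous_fcos.
have cQ : continuous Q by exact: continuous_fsin.
have PQ eta : `|a eta * P eta + b eta * Q eta| <= D * M * wt xi * box eta.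
  rewrite -(Fabs_pair (a eta) (b eta) eta LT).
  apply: (le_trans (modulation_bd (a eta) (b eta) xi eta cs1 Lphi)).
  apply: (@le_trans _ _ (D * wt eta * box eta * (2^-1 * (M * wt (xi - eta) + M * wt (xi + eta))))).
    apply: ler_pM; [exact: amp_ge0| |exact: ab|].
      by rewrite mulr_ge0 ?invr_ge0 ?addr_ge0 ?Fabs_ge0.
    by rewrite ler_wpM2l ?invr_ge0// lerD ?phiM.
  have h1 : wt eta * wt (xi - eta) <= wt xi.
    by rewrite (le_trans (wtM _ _))// addrC subrK.
  have h2 : wt eta * wt (xi + eta) <= wt xi.
    by rewrite -[wt eta]wtN (le_trans (wtM _ _))// addrC addrK.
  rewrite (_ : _ * _ = D * M * (2^-1 * (wt eta * wt (xi - eta) + wt eta * wt (xi + eta))) * box eta); last by ring.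
  rewrite ler_wpM2r ?box_ge0// ler_wpM2l ?mulr_ge0//.
  by rewrite ler_pdivrMl// mulr_natl mulr2n lerD.
have -> : Rint (fun x => phi x * psi x * (c * cos (x * xi) + s * sin (x * xi))) =
    Rint (fun eta => a eta * P eta + b eta * Q eta).
  have LP k (F : R -> R) (aa : R -> R) : L1 aa -> continuous F -> (forall y, `|F y| <= k) -> L1 (fun y => aa y * F y).
    by move=> Laa cF Fk; apply: (L1M Laa _ Fk); exact: continuous_measurable_fun.
  have F1 := fubini LT La (mc cos (@continuous_cos R)) (fun x y => cos_max (y * x)).
  have F2 := fubini LT Lb (mc sin (@continuous_sin R)) (fun x y => sin_max (y * x)).
  have E1 : Rint (fun y => a y * P y) = Rint (fun x => phi x * T x * fcos a x).
    apply: etrans (esym F1); apply: eq_Rint => y; congr (_ * _); apply: eq_Rint => x.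
    by rewrite [y * x]mulrC.
  have E2 : Rint (fun y => b y * Q y) = Rint (fun x => phi x * T x * fsin b x).
    apply: etrans (esym F2); apply: eq_Rint => y; congr (_ * _); apply: eq_Rint => x.
    by rewrite [y * x]mulrC.
  clear F1 F2.
  rewrite RintD; [|exact: LP (fcos_bd LT)|exact: LP (fsin_bd LT)].
  rewrite E1 E2 -RintD; first by apply: eq_Rint => x; rewrite psiE /T; ring.
    by apply: LP (fcos_bd La); [exact: LT|exact: continuous_fcos].
  by apply: LP (fsin_bd Lb); [exact: LT|exact: continuous_fsin].
rewrite (le_trans (ler_norm _))//.
apply: (@le_trans _ _ (Rint (fun eta => D * M * wt xi * box eta))); last first.
  by rewrite RintZ ?L1_box.2; [rewrite le_eqVlt; apply/orP; left; apply/eqP; ring|exact: L1_box.1].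
apply: norm_Rint_le => //; last exact/L1Z/L1_box.1.
apply: L1_le (L1Z (D * M * wt xi) L1_box.1) PQ.
by apply: measurable_funD; apply: measurable_funM => //; exact: continuous_measurable_fun.
Qed.

Lemma Fabs_pow D M phi u n : 0 <= D -> 0 <= M -> rapid phi -> band D u ->
  (forall xi, Fabs phi xi <= M * wt xi) ->
  rapid (fun x => phi x * u x ^+ n) /\
  forall xi, Fabs (fun x => phi x * u x ^+ n) xi <= M * (2 * A * D) ^+ n * wt xi.
Proof.
move=> D0 M0 rphi ru phiM; elim: n => [|n [IHr IHF]].
  rewrite (_ : (fun x => _) = phi); last by apply/funext => x; rewrite mulr1.
  by rewrite mulr1.
rewrite (_ : (fun x => _) = (fun x => (phi x * u x ^+ n) * u x)); last first.
  by apply/funext => x; rewrite exprSr mulrA.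
split; first exact: rapid_band ru.
move=> xi; rewrite (exprSr (2 * A * D)) [M * _]mulrA.
have MD0 : 0 <= M * (2 * A * D) ^+ n by rewrite mulr_ge0// exprn_ge0// !mulr_ge0// ltW.
exact: (Fabs_prod D0 MD0 IHr ru IHF).
Qed.

End bandlimited.

Section exponential_tail.
Context {R : realType}.
Implicit Types (f g h phi psi u w : R -> R).

Definition eps (t : R) : R := expR t - 1 - t.

Lemma cvg_eps (t : R) : \sum_(i < N) t ^+ i.+2 / (i.+2)`!%:R @[N --> \oo] --> eps t.
Proof.
have h : series (exp_coeff t) @ \oo --> expR t.
  exact: (is_cvg_series_exp_coeff t).
have E N : \sum_(i < N) t ^+ i.+2 / (i.+2)`!%:R = series (exp_coeff t) (N + 2)%N - 1 - t.
  rewrite /series/= addn2 !big_nat_recl//= big_mkord /exp_coeff/= expr0 expr1 fact0.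
  by rewrite !divr1 addrA; ring.
rewrite (funext E); apply: cvgB; last exact: cvg_cst.
apply: cvgB; last exact: cvg_cst.
by rewrite (cvg_shiftn 2).
Qed.

Lemma geom_bound (b : R) N : 0 <= b < 1 -> \sum_(i < N) b ^+ i.+1 <= b / (1 - b).
Proof.
move=> /andP[b0 b1]; rewrite ler_pdivlMr ?subr_gt0//.
suff -> : (\sum_(i < N) b ^+ i.+1) * (1 - b) = b - b ^+ N.+1.
  by rewrite gerBl exprn_ge0.
elim: N => [|N IH]; first by rewrite big_ord0 mul0r expr1 subrr.
by rewrite big_ord_recr/= mulrDl IH (exprS _ N.+1); ring.
Qed.

Lemma exp2_le_fact n : (2 ^ n <= n.+1`!)%N.
Proof.
elim: n => [//|n IH]; rewrite expnS factS; exact: leq_mul.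
Qed.

Lemma coef_half (b : R) i : 0 <= b -> b ^+ i.+1 / (i.+2)`!%:R <= (b / 2) ^+ i.+1.
Proof.
move=> b0; rewrite exprMn exprVn ler_wpM2l ?exprn_ge0// lef_pV2 ?posrE ?exprn_gt0// ?ltr0n ?fact_gt0//.
by rewrite -natrX ler_nat exp2_le_fact.
Qed.

Lemma Fabs_series (phi : nat -> R -> R) psi g c r B xi :
  (forall i, rapid (phi i)) -> L1 g -> (forall x, 0 <= g x) -> 0 <= B ->
  (forall i, Fabs (phi i) xi <= c i * B) -> (forall i x, `|phi i x| <= c i * g x) ->
  (forall N, \sum_(i < N) c i <= r) ->
  (forall x, \sum_(i < N) phi i x @[N --> \oo] --> psi x) ->
  Fabs psi xi <= r * B.
Proof.
move=> rphi Lg g0 B0 FB pg cr cv.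
have Fs N : Fabs (fun x => \sum_(i < N) phi i x) xi <= \sum_(i < N) c i * B.
  elim: N => [|N IH].
    rewrite big_ord0 (_ : (fun x => _) = (fun x => 0 * g x)).
      by rewrite FabsZ// normr0 mul0r.
    by apply/funext => x; rewrite big_ord0 mul0r.
  rewrite (_ : (fun x => _) = (fun x => \sum_(i < N) phi i x + phi N x)); last first.
    by apply/funext => x; rewrite big_ord_recr.
  rewrite big_ord_recr/= (le_trans (FabsD _ _ _))//; last exact: lerD.
    exact: (rapid_L1 (rapid_sum N rphi)).
  exact: rapid_L1.
apply: (@Fabs_cvg_le _ (fun N x => \sum_(i < N) phi i x) psi (fun x => r * g x)) => //.
- by move=> N; exact: (rapid_meas (rapid_sum N rphi)).
- exact: L1Z.
- move=> N x; rewrite (le_trans (ler_norm_sum _ _ _))//.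
  apply: (@le_trans _ _ (\sum_(i < N) c i * g x)); first by apply: ler_sum => i _.
  by rewrite -mulr_suml ler_wpM2r.
- by move=> N; rewrite (le_trans (Fs N))// -mulr_suml ler_wpM2r.
Qed.

End exponential_tail.

Section exponential_tail_bounds.
Context {R : realType}.
Variables (A m D : R).
Hypotheses (A0 : 0 < A) (m0 : 0 <= m) (D0 : 0 <= D).
Let al := 2 * A * D.
Hypothesis al1 : al < 1.
Implicit Types (f g h phi psi u w k : R -> R).

Let al0 : 0 <= al. Proof. by rewrite /al !mulr_ge0// ltW. Qed.

Lemma Fabs_eps M u k : 0 <= M -> band A m D u -> rapid (fun x => k x * u x) ->
  (forall xi, Fabs (fun x => k x * u x) xi <= M * wt m xi) ->
  forall xi, Fabs (fun x => k x * eps (u x)) xi <= al / 2 / (1 - al / 2) * (M * wt m xi).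
Proof.
move=> M0 ru rku kuM xi.
have ul := band_bounded A0 m0 D0 ru.
apply: (@Fabs_series _ (fun i x => (i.+2)`!%:R^-1 * (k x * u x * u x ^+ i.+1)) _
  (fun x => `|k x * u x|) (fun i => al ^+ i.+1 / (i.+2)`!%:R)).
- by move=> i; apply: rapidZ; exact: (Fabs_pow A0 m0 i.+1 D0 M0 rku ru kuM).1.
- exact/L1_norm/rapid_L1.
- by [].
- by rewrite mulr_ge0// ltW// wt_gt0.
- move=> i; have [rp Fp] := Fabs_pow A0 m0 i.+1 D0 M0 rku ru kuM.
  rewrite FabsZ; last exact: rapid_L1.
  rewrite ger0_norm ?invr_ge0// mulrC [leRHS]mulrAC ler_wpM2r ?invr_ge0//.
  by rewrite (le_trans (Fp xi))// /al mulrCA mulrA.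
- move=> i x; rewrite !normrM normfV normr_nat normrX.
  rewrite [leRHS]mulrAC mulrC ler_wpM2r ?invr_ge0// [leRHS]mulrC ler_wpM2l// lerXn2r ?nnegrE//.
- move=> N; apply: (le_trans _ (@geom_bound _ (al / 2) N _)).
    by apply: ler_sum => i _; exact: coef_half.
  by rewrite divr_ge0//= ltr_pdivrMr//; move: al1; lra.
- move=> x; rewrite (_ : (fun N : nat => _) = (fun N : nat => k x * \sum_(i < N) u x ^+ i.+2 / (i.+2)`!%:R)).
    by apply: cvgM; [exact: cvg_cst|exact: cvg_eps].
  apply/funext => N; rewrite mulr_sumr; apply: eq_bigr => i _.
  by rewrite (exprS _ i.+1); ring.
Qed.

Fixpoint divdiff u w n : R -> R :=
  if n is n'.+1 then (fun x => u x ^+ n' + w x * divdiff u w n' x) else (fun=> 0).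

Lemma divdiffE u w n x : u x ^+ n - w x ^+ n = (u x - w x) * divdiff u w n x.
Proof.
elim: n => [|n IH]; first by rewrite !expr0 subrr mulr0.
by rewrite /= mulrDr mulrCA -IH !exprS; ring.
Qed.

Lemma Fabs_divdiff M u w d n : 0 <= M -> band A m D u -> band A m D w -> rapid d ->
  (forall xi, Fabs d xi <= M * wt m xi) ->
  [/\ rapid (fun x => d x * divdiff u w n x),
     forall xi, Fabs (fun x => d x * divdiff u w n x) xi <= n%:R * al ^+ n.-1 * (M * wt m xi) &
     forall x, `|d x * divdiff u w n x| <= n%:R * al ^+ n.-1 * `|d x| ].
Proof.
move=> M0 ru rw rd dM; elim: n => [|n [IH1 IH2 IH3]] /=.
  split.
  - rewrite (_ : (fun x => _) = (fun x => 0 * d x)); first exact: rapidZ.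
    by apply/funext => x; rewrite mulr0 mul0r.
  - move=> xi; rewrite (_ : (fun x => _) = (fun x => 0 * d x)).
      by rewrite FabsZ ?normr0 ?mul0r//; exact: rapid_L1.
    by apply/funext => x; rewrite mulr0 mul0r.
  - by move=> x; rewrite mulr0 normr0 mul0r mul0r.
have [rp Fp] := Fabs_pow A0 m0 n D0 M0 rd ru dM.
have nM0 : 0 <= n%:R * al ^+ n.-1 * M by rewrite !mulr_ge0// exprn_ge0.
have IH2' xi : Fabs (fun x => d x * divdiff u w n x) xi <= n%:R * al ^+ n.-1 * M * wt m xi.
  by rewrite -mulrA.
have rdw := rapid_band A0 m0 D0 IH1 rw.
have Fdw := Fabs_prod A0 m0 D0 nM0 IH1 rw IH2'.
have E : (fun x => d x * (u x ^+ n + w x * divdiff u w n x)) =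
    (fun x => d x * u x ^+ n + d x * divdiff u w n x * w x).
  by apply/funext => x; ring.
have alE : n%:R * al ^+ n.-1 * al = n%:R * al ^+ n.
  by case: n {IH1 IH2 IH3 rp Fp nM0 IH2' rdw Fdw E} => [|n]/=; [rewrite !mul0r|rewrite exprSr mulrA].
split.
- by rewrite E; exact: rapidD.
- move=> xi; rewrite E (le_trans (FabsD _ _ _))//; [exact: rapid_L1|exact: rapid_L1|].
  rewrite (le_trans (lerD (Fp xi) (Fdw xi)))// -/al.
  rewrite [n%:R * _ * M * al]mulrAC alE -natr1 le_eqVlt; apply/orP; left; apply/eqP; ring.
- move=> x; have := congr1 (fun f => f x) E => /= ->.
  have h1 : `|d x * u x ^+ n| <= al ^+ n * `|d x|.
    rewrite normrM mulrC ler_wpM2r// normrX lerXn2r ?nnegrE//.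
    exact: (band_bounded A0 m0 D0 ru x).
  have h2 : `|d x * divdiff u w n x * w x| <= n%:R * al ^+ n * `|d x|.
    rewrite normrM -alE mulrAC; apply: ler_pM => //.
    exact: (band_bounded A0 m0 D0 rw x).
  rewrite (le_trans (ler_normD _ _))// (le_trans (lerD h1 h2))//.
  by rewrite -natr1 le_eqVlt; apply/orP; left; apply/eqP; ring.
Qed.

Lemma Fabs_eps_diff M u w : 0 <= M -> band A m D u -> band A m D w -> rapid (fun x => u x - w x) ->
  (forall xi, Fabs (fun x => u x - w x) xi <= M * wt m xi) ->
  forall xi, Fabs (fun x => eps (u x) - eps (w x)) xi <= al / (1 - al) * (M * wt m xi).
Proof.
move=> M0 ru rw rd dM xi.
apply: (@Fabs_series _ (fun i x => (i.+2)`!%:R^-1 * ((u x - w x) * divdiff u w i.+2 x)) _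
  (fun x => `|u x - w x|) (fun i => al ^+ i.+1)).
- by move=> i; apply: rapidZ; have [] := Fabs_divdiff i.+2 M0 ru rw rd dM.
- exact/L1_norm/rapid_L1.
- by [].
- by rewrite mulr_ge0// ltW// wt_gt0.
- move=> i; have [rp Fp _] := Fabs_divdiff i.+2 M0 ru rw rd dM.
  rewrite FabsZ; last exact: rapid_L1.
  rewrite ger0_norm ?invr_ge0// ler_pdivrMl ?ltr0n ?fact_gt0// (le_trans (Fp xi))//=.
  rewrite [leRHS]mulrA ler_wpM2r ?mulr_ge0 ?(ltW (wt_gt0 _ _))// ler_wpM2r ?exprn_ge0//.
  by rewrite ler_nat factS leq_pmulr// fact_gt0.
- move=> i x; have [_ _ Fp] := Fabs_divdiff i.+2 M0 ru rw rd dM.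
  rewrite normrM normfV normr_nat ler_pdivrMl ?ltr0n ?fact_gt0// (le_trans (Fp x))//=.
  rewrite [leRHS]mulrA ler_wpM2r// ler_wpM2r ?exprn_ge0//.
  by rewrite ler_nat factS leq_pmulr// fact_gt0.
- by move=> N; apply: geom_bound; rewrite al0.
- move=> x; rewrite (_ : (fun N : nat => _) = (fun N : nat => \sum_(i < N) u x ^+ i.+2 / (i.+2)`!%:R -
      \sum_(i < N) w x ^+ i.+2 / (i.+2)`!%:R)).
    by apply: cvgB; exact: cvg_eps.
  apply/funext => N; rewrite -sumrB; apply: eq_bigr => i _.
  by rewrite -mulrBl divdiffE mulrC.
Qed.

End exponential_tail_bounds.

Section kernels.
Context {R : realType}.
Variables (A : R).
Hypotheses (A0 : 0 < A).
Implicit Types (a b f g h phi psi u w k : R -> R).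

Lemma fcos_opp f x : fcos f (- x) = fcos f x.
Proof. by apply: eq_Rint => y; rewrite mulrN cosN. Qed.

Lemma fsin_even f xi : rapid f -> (forall x, f (- x) = f x) -> fsin f xi = 0.
Proof.
move=> rf fe; apply: Rint_odd.
- move=> x; apply: cvgM; [exact: rapid_cont|exact: continuous_sinM].
- exact/L1_sin/rapid_L1.
- by move=> x; rewrite fe mulNr sinN mulrN.
Qed.

Lemma fcos_odd f xi : rapid f -> (forall x, f (- x) = - f x) -> fcos f xi = 0.
Proof.
move=> rf fe; apply: Rint_odd.
- move=> x; apply: cvgM; [exact: rapid_cont|exact: continuous_cosM].
- exact/L1_cos/rapid_L1.
- by move=> x; rewrite fe [- x * xi]mulNr cosN mulNr.
Qed.

Lemma Cc0 : Cc A (fun=> 0).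
Proof. by split=> //; exact: smooth_cst. Qed.

Lemma bl_kernel_fcos a : Cc A a -> bl_kernel A (fcos a).
Proof.
move=> ca; exists a, (fun=> 0); split => //; first exact: Cc0.
apply/funext => x; rewrite /fsin (_ : (fun y => _) = (fun=> 0)).
  by rewrite /Rint Rintegral_cst// mul0r addr0.
by apply/funext => y; rewrite mul0r.
Qed.

Lemma bl_kernel_fsin a : Cc A a -> bl_kernel A (fsin a).
Proof.
move=> ca; exists (fun=> 0), a; split => //; first exact: Cc0.
apply/funext => x; rewrite /fcos (_ : (fun y => _) = (fun=> 0)).
  by rewrite /Rint Rintegral_cst// mul0r add0r.
by apply/funext => y; rewrite mul0r.
Qed.

Lemma even_kernel a xi : Cc A a -> (forall x, a (- x) = a x) ->
  fcos (fun x => (2 * pi)^-1 * fcos a x) xi = a xi /\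
  fsin (fun x => (2 * pi)^-1 * fcos a x) xi = 0.
Proof.
move=> ca ae; have ra := Cc_Rap A0 ca; have rk := bl_kernel_Rap A0 (bl_kernel_fcos ca).
split; last first.
  by apply: fsin_even; [exact: rapidZ|move=> x; rewrite fcos_opp].
rewrite fcosZ; last exact: rapid_L1.
have [M _ aM] := rapid_bd ra.
rewrite [RHS](@inversion _ a M xi); [|exact: rapid_cont|exact: aM|exact: rapid_L1|].
  congr (_ * _); apply: eq_Rint => x.
  by rewrite (fsin_even x ra ae) mul0r addr0 mulrC [x * xi]mulrC mulrC.
apply: (@eq_L1 _ (fun x => `|fcos a x|)); last exact/L1_norm/rapid_L1.
by move=> x; rewrite /Fabs (fsin_even x ra ae) /amp expr0n addr0 sqrtr_sqr.
Qed.

Lemma odd_kernel a xi : Cc A a -> (forall x, a (- x) = - a x) ->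
  fcos (fun x => (2 * pi)^-1 * fsin a x) xi = 0 /\
  fsin (fun x => (2 * pi)^-1 * fsin a x) xi = a xi.
Proof.
move=> ca ao; have ra := Cc_Rap A0 ca; have rk := bl_kernel_Rap A0 (bl_kernel_fsin ca).
split.
  apply: fcos_odd; first exact: rapidZ.
  move=> x; rewrite -mulrN; congr (_ * _); rewrite /fsin -mulN1r -RintZ; last exact/L1_sin/rapid_L1.
  by apply: eq_Rint => y; rewrite mulrN sinN; ring.
rewrite fsinZ; last exact: rapid_L1.
have [M _ aM] := rapid_bd ra.
rewrite [RHS](@inversion _ a M xi); [|exact: rapid_cont|exact: aM|exact: rapid_L1|].
  congr (_ * _); apply: eq_Rint => x.
  by rewrite (fcos_odd x ra ao) mul0r add0r [xi * x]mulrC.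
apply: (@eq_L1 _ (fun x => `|fsin a x|)); last exact/L1_norm/rapid_L1.
by move=> x; rewrite /Fabs (fcos_odd x ra ao) /amp expr0n add0r sqrtr_sqr.
Qed.

Lemma band_conv m a b h (q H : R) : Cc A a -> Cc A b -> rapid h ->
  (forall x, amp (a x) (b x) <= q) -> 0 <= H -> (forall x, Fabs h x <= H * wt m x) ->
  band A m (q * H) (conv (fun x => fcos a x + fsin b x) h).
Proof.
move=> ca cb rh abg H0 hH.
have Lh := rapid_L1 rh; have La := Cc_L1 A0 ca; have Lb := Cc_L1 A0 cb.
have ch := continuous_fcos Lh; have sh := continuous_fsin Lh.
have cca : continuous a by case: ca => /smooth_cont.
have ccb : continuous b by case: cb => /smooth_cont.
exists (fun x => a x * fcos h x - b x * fsin h x), (fun x => a x * fsin h x + b x * fcos h x).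
split.
- apply: continuous_measurable_fun => x; apply: cvgB; apply: cvgM;
    [exact: cca|exact: ch|exact: ccb|exact: sh].
- apply: continuous_measurable_fun => x; apply: cvgD; apply: cvgM;
    [exact: cca|exact: sh|exact: ccb|exact: ch].
- move=> x; rewrite amp_mul boxE; have [xA|xA] := boolP (`|x| <= A).
    by rewrite mulr1 -mulrA; apply: ler_pM;
      [exact: amp_ge0|exact: Fabs_ge0|exact: abg|exact: hH].
  move: xA; rewrite -ltNge => xA; rewrite ca.2// cb.2//.
  by rewrite /amp expr0n addr0 sqrtr0 mul0r mulr0.
apply/funext => x.
have mk (F : R -> R) : continuous F -> measurable_fun setT
    (fun z : measurableTypeR R * measurableTypeR R => F (z.2 * (x - z.1)) : measurableTypeR R).
  move=> cF; apply: (@measurableT_comp _ _ _ _ _ _ F).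
    exact: continuous_measurable_fun.
  by apply: measurable_funM => //; exact: measurable_funB.
have F1 := fubini Lh La (mk cos (@continuous_cos R)) (fun y e => cos_max (e * (x - y))).
have F2 := fubini Lh Lb (mk sin (@continuous_sin R)) (fun y e => sin_max (e * (x - y))).
have bL1 M (F : R -> R) : continuous F -> (forall y, `|F y| <= M) -> forall f, L1 f -> L1 (fun y => f y * F y).
  by move=> cF FM f Lf; apply: (L1M Lf _ FM); exact: continuous_measurable_fun.
have T1 : L1 (fun y => h y * fcos a (x - y)).
  exact: (bL1 _ (fun y => fcos a (x - y)) (continuous_reflect (x := x) (continuous_fcos La)) (fun y => fcos_bd La (x - y)) h Lh).
have T2 : L1 (fun y => h y * fsin b (x - y)).
  exact: (bL1 _ (fun y => fsin b (x - y)) (continuous_reflect (x := x) (continuous_fsin Lb)) (fun y => fsin_bd Lb (x - y)) h Lh).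
rewrite /conv.
have -> : Rint (fun y => h y * (fcos a (x - y) + fsin b (x - y))) =
  Rint (fun y => h y * fcos a (x - y)) + Rint (fun y => h y * fsin b (x - y)).
  rewrite -RintD; first by apply: eq_Rint => y; rewrite mulrDr.
    exact: T1.
  exact: T2.
rewrite [X in X + _]F1 [X in _ + X]F2 {F1 F2 T1 T2}.
have L1p (F1 F2 : R -> R) M1 M2 f : continuous F1 -> continuous F2 ->
  (forall y, `|F1 y| <= M1) -> (forall y, `|F2 y| <= M2) -> L1 f -> L1 (fun y => f y * F1 y * F2 y).
  by move=> cF1 cF2 FM1 FM2 Lf; apply: (bL1 _ _ cF2 FM2); exact: (bL1 _ _ cF1 FM1).
pose cx e := cos (e * x); pose sx e := sin (e * x).
have ccx : continuous cx by exact: continuous_cosM.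
have csx : continuous sx by exact: continuous_sinM.
have bcx y : `|cx y| <= 1 by exact: cos_max.
have bsx y : `|sx y| <= 1 by exact: sin_max.
have E1 : Rint (fun e => a e * Rint (fun y => h y * cos (e * (x - y)))) =
    Rint (fun e => a e * fcos h e * cx e + a e * fsin h e * sx e).
  apply: eq_Rint => e; rewrite -!mulrA -mulrDr [X in _ = _ * X](_ : _ = cx e * fcos h e + sx e * fsin h e); last by ring.
  rewrite -Fabs_pair//; congr (_ * _); apply: eq_Rint => y.
  by rewrite mulrBr cosB [y * e]mulrC.
have E2 : Rint (fun e => b e * Rint (fun y => h y * sin (e * (x - y)))) =
    Rint (fun e => b e * fcos h e * sx e - b e * fsin h e * cx e).
  apply: eq_Rint => e; rewrite -!mulrA -mulrBr [X in _ = _ * X](_ : _ = sx e * fcos h e + (- cx e) * fsin h e); last by ring.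
  rewrite -Fabs_pair//; congr (_ * _); apply: eq_Rint => y.
  by rewrite mulrBr sinB [y * e]mulrC mulNr.
have bch := fcos_bd Lh; have bsh := fsin_bd Lh.
have T1 := L1p _ _ _ _ _ ch ccx bch bcx La.
have T2 := L1p _ _ _ _ _ sh csx bsh bsx La.
have T3 := L1p _ _ _ _ _ ch csx bch bsx Lb.
have T4 := L1p _ _ _ _ _ sh ccx bsh bcx Lb.
rewrite [X in X + _]E1 [X in _ + X]E2 -RintD; [|exact: L1D|exact: L1B].
rewrite /fcos /fsin -RintD -/(fcos h) -/(fsin h).
- by apply: eq_Rint => e; rewrite /cx /sx /fcos /fsin; ring.
- by apply: eq_L1 (L1B T1 T4) => e; rewrite /cx /fcos /fsin; ring.
- by apply: eq_L1 (L1D T2 T3) => e; rewrite /sx /fcos /fsin; ring.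
Qed.

End kernels.

Section cutoff.
Context {R : realType}.
Variable lam : R.
Hypothesis lam0 : 0 < lam.

(* Any radius in [(lam, sqrt 2 lam]] would do; with [6/5] all the estimates go
   through using only [2 <= pi]. *)
Definition cutA : R := 6 / 5 * lam.
Let c : R := 64 / 25 * lam ^+ 2.
Let al (x : R) := cutA ^+ 2 - x ^+ 2.
Let be (x : R) := x ^+ 2 - lam ^+ 2.
Let den x := flat c 0 0 (al x) + flat c 0 0 (be x).

Definition cut x : R := flat c 0 0 (al x) * (den x)^-1.
Definition gam x : R := flat c 0 1 (al x) * (den x)^-1.

Let c0 : 0 < c. Proof. by rewrite /c mulr_gt0// exprn_gt0. Qed.

Lemma cutA_gt0 : 0 < cutA. Proof. by rewrite /cutA mulr_gt0. Qed.

Let flat_ge0 k l y : 0 <= flat c k l y.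
Proof.
have [y0|y0] := leP y 0; first by rewrite flat_npos.
by rewrite ltW// flat_pos.
Qed.

Let albe x : (0 < al x) || (0 < be x).
Proof.
rewrite -[_ || _]negbK negb_or -!leNgt; apply/negP => /andP[h1 h2].
have l2 : 0 < lam ^+ 2 by rewrite exprn_gt0.
by move: h1 h2; rewrite /al /be /cutA exprMn; lra.
Qed.

Let den_gt0 x : 0 < den x.
Proof.
case/orP: (albe x) => h; rewrite /den.
  by rewrite ltr_wpDr// flat_pos.
by rewrite ltr_wpDl// flat_pos.
Qed.

Let smooth_sqr : smooth (fun x : R => x ^+ 2).
Proof. by apply: (smooth_mul (@smooth_id R) (@smooth_id R)). Qed.

Let smooth_al : smooth al.
Proof.
apply: (@smooth_add _ (fun=> cutA ^+ 2) (fun x => - x ^+ 2)); first exact: smooth_cst.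
rewrite (_ : (fun x => _) = (fun x => (-1) * x ^+ 2)).
  exact: (@smooth_mul R (fun=> -1) _ (@smooth_cst R (-1)) smooth_sqr).
by apply/funext => x; rewrite mulN1r.
Qed.

Let smooth_be : smooth be.
Proof. exact: (@smooth_add R _ (fun=> - lam ^+ 2) smooth_sqr (@smooth_cst R _)). Qed.

Let smooth_flat_comp k l (f : R -> R) : smooth f -> smooth (fun x => flat c k l (f x)).
Proof. by move=> sf; exact: (smooth_comp (@smooth_flat R c c0 k l) sf). Qed.

Let smooth_denV : smooth (fun x => (den x)^-1).
Proof.
apply: smooth_inv => [x|]; first by rewrite gt_eqF.
exact: (smooth_add (@smooth_flat_comp 0%N 0%N _ smooth_al) (@smooth_flat_comp 0%N 0%N _ smooth_be)).
Qed.

Let al_le0 x : cutA <= `|x| -> al x <= 0.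
Proof.
move=> h; rewrite /al subr_le0 -[x ^+ 2]real_normK ?num_real//.
by rewrite lerXn2r// nnegrE// ltW// cutA_gt0.
Qed.

Lemma Cc_cut : Cc cutA cut.
Proof.
split=> [|x Ax].
  exact: (smooth_mul (@smooth_flat_comp 0%N 0%N _ smooth_al) smooth_denV).
by rewrite /cut flat_npos ?mul0r// al_le0// ltW.
Qed.

Lemma Cc_gam : Cc cutA gam.
Proof.
split=> [|x Ax].
  exact: (smooth_mul (@smooth_flat_comp 0%N 1%N _ smooth_al) smooth_denV).
by rewrite /gam flat_npos ?mul0r// al_le0// ltW.
Qed.

Lemma cut_ge0 x : 0 <= cut x.
Proof. by rewrite /cut mulr_ge0// invr_ge0 ltW. Qed.

Lemma cut_le1 x : cut x <= 1.
Proof. by rewrite /cut ler_pdivrMr// mul1r /den lerDl. Qed.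

Lemma cut_one x : `|x| <= lam -> cut x = 1.
Proof.
move=> h; have h2 : be x <= 0.
  by rewrite /be subr_le0 -[x ^+ 2]real_normK ?num_real// lerXn2r// nnegrE// ltW.
have := den_gt0 x; rewrite /cut /den (flat_npos c 0 0 h2) addr0 => d0.
by rewrite divff// gt_eqF.
Qed.

Lemma cut_even x : cut (- x) = cut x. Proof. by rewrite /cut /den /al /be sqrrN. Qed.

Lemma gam_even x : gam (- x) = gam x. Proof. by rewrite /gam /den /al /be sqrrN. Qed.

(* At [x = +- 2 lam] both sides vanish, as [_ / 0 = 0]. *)
Lemma gamE x : gam x = cut x / (4 * lam ^+ 2 - x ^+ 2).
Proof.
rewrite /gam /cut mulrAC; congr (_ * _).
have [h|h] := leP (al x) 0; first by rewrite !flat_npos// mul0r.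
rewrite /flat h !expr0 expr1 !mul1r mulrC; congr (_ * _^-1).
by rewrite /al /c /cutA exprMn; field.
Qed.

Let gam_den x : `|x| <= cutA -> 64 / 25 * lam ^+ 2 <= 4 * lam ^+ 2 - x ^+ 2.
Proof.
move=> h.
have : x ^+ 2 <= cutA ^+ 2.
  by rewrite -[x ^+ 2]real_normK ?num_real// lerXn2r// nnegrE// ltW// cutA_gt0.
by rewrite /cutA exprMn; lra.
Qed.

Lemma gam_ge0 x : 0 <= gam x.
Proof. by rewrite /gam mulr_ge0// invr_ge0 ltW. Qed.

Lemma gam_le x : gam x <= 2 / 5 / lam ^+ 2.
Proof.
have l2 : 0 < lam ^+ 2 by rewrite exprn_gt0.
have [h|h] := leP `|x| cutA; last first.
  by rewrite (Cc_gam.2 _ h) divr_ge0// ltW.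
have d := gam_den h; have d0 : 0 < 4 * lam ^+ 2 - x ^+ 2 by apply: lt_le_trans d; lra.
rewrite gamE ler_pdivrMr// (le_trans (cut_le1 x))//.
apply: (@le_trans _ _ (2 / 5 / lam ^+ 2 * (64 / 25 * lam ^+ 2))); last first.
  by rewrite ler_wpM2l// divr_ge0// ltW.
rewrite [leRHS](_ : _ = 128 / 125); first by lra.
by field; rewrite gt_eqF.
Qed.

Lemma id_gam_le x : `|x * gam x| <= 12 / 25 / lam.
Proof.
have [h|h] := leP `|x| cutA; last first.
  by rewrite (Cc_gam.2 _ h) mulr0 normr0 divr_ge0// ltW.
rewrite normrM (ger0_norm (gam_ge0 x)).
rewrite (le_trans (ler_pM _ _ h (gam_le x)))//; first exact: gam_ge0.
by rewrite /cutA le_eqVlt; apply/orP; left; apply/eqP; field; rewrite gt_eqF.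
Qed.

End cutoff.

(** * The fixed point *)

Section eps_bounds.
Context {R : realType}.
Implicit Types t : R.

Lemma eps_ge0 t : 0 <= eps t.
Proof. by rewrite /eps; have := expR_ge1Dx t; lra. Qed.

Lemma eps_le t : `|t| <= 1 / 2 -> eps t <= 2 * t ^+ 2.
Proof.
rewrite ler_norml => /andP[t1 t2].
have h : expR t <= (1 - t)^-1.
  rewrite -[t in expR t]opprK expRN lef_pV2 ?posrE ?expR_gt0//; last by lra.
  exact: expR_ge1Dx.
rewrite /eps (@le_trans _ _ ((1 - t)^-1 - 1 - t))//; first by lra.
have t0 : 0 < 1 - t by lra.
rewrite (_ : _ - 1 - t = t ^+ 2 / (1 - t)); last by field; rewrite gt_eqF.
rewrite ler_pdivrMr//.
by have := sqr_ge0 t; nra.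
Qed.

Lemma is_derive_eps t : is_derive t 1 eps (expR t - 1).
Proof.
apply: (is_derive_eq (is_deriveD_fun (is_deriveD_fun (is_derive_expR t) (is_deriveN_fun (is_derive_cst_fun 1 t))) (is_deriveN_fun (is_derive_id_fun t)))).
by rewrite oppr0 addr0.
Qed.

Lemma continuous_eps : continuous (@eps R).
Proof. by move=> t; exact: is_derive_continuous (is_derive_eps t). Qed.

End eps_bounds.

Section liouville_kernels.
Context {R : realType}.
Variable lam : R.
Hypothesis lam0 : 0 < lam.
Local Notation A := (cutA lam).
Let A0 : 0 < A. Proof. exact: cutA_gt0. Qed.
Let P0 : 0 < (2 * pi)^-1 :> R. Proof. by rewrite invr_gt0 mulr_gt0// pi_gt0. Qed.
Let P4 : (2 * pi)^-1 <= 4^-1 :> R.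
Proof.
rewrite lef_pV2 ?posrE// ?mulr_gt0 ?pi_gt0//.
by have := pi_ge2 R; lra.
Qed.

Lemma fcos_0 (x : R) : fcos (fun=> 0) x = 0.
Proof.
rewrite /fcos (@eq_Rint _ _ (fun=> 0)); last by move=> y; rewrite mul0r.
by rewrite /Rint Rintegral_cst// mul0r.
Qed.

Lemma fsin_0 (x : R) : fsin (fun=> 0) x = 0.
Proof.
rewrite /fsin (@eq_Rint _ _ (fun=> 0)); last by move=> y; rewrite mul0r.
by rewrite /Rint Rintegral_cst// mul0r.
Qed.

(* [greenT * h] is [T] applied to the spectral truncation of [h], and [greenT']
   is the derivative of [greenT]. *)
Definition gam1 (x : R) : R := -1 * (x * gam lam x).
Definition greenT (x : R) : R := (2 * pi)^-1 * fcos (gam lam) x.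
Definition greenT' (x : R) : R := (2 * pi)^-1 * fsin gam1 x.

Lemma Cc_gam1 : Cc A gam1.
Proof. apply: Cc_scale; apply: Cc_idM; exact: Cc_gam. Qed.

Lemma greenTE : greenT = (fun x => fcos (fun y => (2 * pi)^-1 * gam lam y) x + fsin (fun=> 0) x).
Proof.
apply/funext => x; rewrite fcosZ; last exact: (Cc_L1 A0 (Cc_gam lam0)).
by rewrite fsin_0 addr0.
Qed.

Lemma greenT'E : greenT' = (fun x => fcos (fun=> 0) x + fsin (fun y => (2 * pi)^-1 * gam1 y) x).
Proof.
apply/funext => x; rewrite fsinZ; last exact: (Cc_L1 A0 Cc_gam1).
by rewrite fcos_0 add0r.
Qed.

Lemma bl_greenT : bl_kernel A greenT.
Proof.
exists (fun y => (2 * pi)^-1 * gam lam y), (fun=> 0); split; last exact: greenTE.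
  exact: Cc_scale (Cc_gam lam0).
exact: Cc0.
Qed.

Lemma bl_greenT' : bl_kernel A greenT'.
Proof.
exists (fun=> 0), (fun y => (2 * pi)^-1 * gam1 y); split; last exact: greenT'E.
  exact: Cc0.
exact: Cc_scale Cc_gam1.
Qed.

Lemma greenT_derive (x : R) : is_derive x 1 greenT (greenT' x).
Proof.
have Lg := Cc_L1 A0 (Cc_gam lam0).
have Lxg := Cc_L1 A0 (Cc_idM (Cc_gam lam0)).
apply: (is_derive_eq (is_deriveM_fun (is_derive_cst_fun (2 * pi)^-1 x) (fcos_derive x Lg Lxg))).
by rewrite mul0r add0r /greenT' /gam1 fsinZ// mulN1r.
Qed.

Lemma rapid_greenT : rapid greenT. Proof. exact: bl_kernel_Rap bl_greenT. Qed.
Lemma rapid_greenT' : rapid greenT'. Proof. exact: bl_kernel_Rap bl_greenT'. Qed.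

Lemma fcos_greenT xi : fcos greenT xi = gam lam xi.
Proof. by have [] := even_kernel A0 xi (Cc_gam lam0) (@gam_even _ lam). Qed.

Lemma fsin_greenT xi : fsin greenT xi = 0.
Proof. by have [] := even_kernel A0 xi (Cc_gam lam0) (@gam_even _ lam). Qed.

Lemma Fabs_greenT xi : Fabs greenT xi <= 2 / 5 / lam ^+ 2.
Proof.
by rewrite /Fabs fcos_greenT fsin_greenT /amp expr0n addr0 sqrtr_sqr ger0_norm ?gam_le// gam_ge0.
Qed.

Lemma Fabs_greenT' xi : Fabs greenT' xi <= 12 / 25 / lam.
Proof.
have [|E1 E2] := odd_kernel A0 xi Cc_gam1.
  by move=> x; rewrite /gam1 gam_even; ring.
by rewrite /Fabs E1 E2 /amp expr0n add0r sqrtr_sqr /gam1 mulN1r normrN id_gam_le.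
Qed.

Lemma band_greenT m h (H : R) : rapid h -> 0 <= H -> (forall x, Fabs h x <= H * wt m x) ->
  band A m (H / (10 * lam ^+ 2)) (conv greenT h).
Proof.
move=> rh H0 hH; rewrite mulrC greenTE; apply: band_conv => //.
- exact: Cc_scale (Cc_gam lam0).
- exact: Cc0.
- move=> x; rewrite /amp expr0n addr0 sqrtr_sqr ger0_norm; last first.
    by rewrite mulr_ge0 ?gam_ge0// ltW.
  rewrite (le_trans (ler_pM _ _ P4 (gam_le lam0 x)))//; [exact: ltW|exact: gam_ge0|].
  by rewrite le_eqVlt; apply/orP; left; apply/eqP; field; rewrite gt_eqF.
Qed.

Lemma band_greenT' m h (H : R) : rapid h -> 0 <= H -> (forall x, Fabs h x <= H * wt m x) ->
  band A m (3 / 25 / lam * H) (conv greenT' h).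
Proof.
move=> rh H0 hH; rewrite greenT'E; apply: band_conv => //.
- exact: Cc0.
- exact: Cc_scale Cc_gam1.
- move=> x; rewrite /amp expr0n add0r sqrtr_sqr normrM (ger0_norm (ltW P0)).
  rewrite /gam1 mulN1r normrN.
  rewrite (le_trans (ler_pM _ _ P4 (id_gam_le lam0 x)))//; first exact: ltW.
  by rewrite le_eqVlt; apply/orP; left; apply/eqP; field; rewrite gt_eqF.
Qed.

Lemma bl_kernel_conv_bd k : bl_kernel A k -> exists2 M, 0 <= M & forall h H, rapid h -> 0 <= H ->
  (forall xi, Fabs h xi <= H) -> forall x, `|conv k h x| <= M * H.
Proof.
move=> [a [b [ca cb ->]]].
have [M M0 aM] := rapid_bd (Cc_Rap A0 ca); have [N N0 bN] := rapid_bd (Cc_Rap A0 cb).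
have ab x : amp (a x) (b x) <= M + N.
  rewrite amp_le ?addr_ge0// sqrrD -addrA lerD//.
    by rewrite -[a x ^+ 2]real_normK ?num_real// lerXn2r ?nnegrE.
  rewrite -[leLHS]add0r lerD// ?mulrn_wge0 ?mulr_ge0//.
  by rewrite -[b x ^+ 2]real_normK ?num_real// lerXn2r ?nnegrE.
exists (2 * A * (M + N)) => [|h H rh H0 hH x].
  by rewrite !mulr_ge0 ?addr_ge0// ltW.
have hH' xi : Fabs h xi <= H * wt 0 xi.
  by rewrite /wt oppr0 mul0r expR0 mulr1.
have MN0 : 0 <= (M + N) * H by rewrite mulr_ge0// addr_ge0.
have := band_bounded A0 (lexx 0) MN0 (band_conv A0 ca cb rh ab H0 hH') x.
by rewrite mulrA.
Qed.

End liouville_kernels.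

Section convolution_more.
Context {R : realType}.
Implicit Types (f g h G : R -> R).

Lemma wt0 (x : R) : wt 0 x = 1.
Proof. by rewrite /wt oppr0 mul0r expR0. Qed.

Lemma is_deriveX_fun n (z : R) : is_derive z 1 (fun z : R => z ^+ n) (n%:R * z ^+ n.-1).
Proof.
elim: n => [|n IH]; first by rewrite mul0r; exact: is_derive_cst_fun.
rewrite (_ : (fun z => _) = (fun z => z * z ^+ n)); last first.
  by apply/funext => y; rewrite exprS.
apply: (is_derive_eq (is_deriveM_fun (is_derive_id_fun z) IH)); rewrite /= -natr1.
by case: n {IH} => [|n]/=; [ring|rewrite exprS; ring].
Qed.

Lemma conv_sub G h h' x : rapid G -> rapid h -> rapid h' ->
  conv G (fun y => h y - h' y) x = conv G h x - conv G h' x.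
Proof.
move=> rG rh rh'; rewrite /conv -RintB; [|exact: conv_L1 (rapid_L1 _)..].
by apply: eq_Rint => y; rewrite mulrBl.
Qed.

Lemma Fabs_sum n (F : nat -> R -> R) xi : (forall i, rapid (F i)) ->
  Fabs (fun x => \sum_(i < n) F i x) xi <= \sum_(i < n) Fabs (F i) xi.
Proof.
move=> rF; elim: n => [|n IH].
  rewrite big_ord0 (_ : (fun x => _) = (fun x => 0 * F 0%N x)); last first.
    by apply/funext => x; rewrite big_ord0 mul0r.
  by rewrite FabsZ ?normr0 ?mul0r//; exact: rapid_L1.
rewrite (_ : (fun x => _) = (fun x => \sum_(i < n) F i x + F n x)); last first.
  by apply/funext => x; rewrite big_ord_recr.
rewrite big_ord_recr/= (le_trans (FabsD _ _ _))//; last by rewrite lerD2r.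
  exact: (rapid_L1 (rapid_sum n rF)).
exact: rapid_L1.
Qed.

Lemma Fabs_conv_moment J G G' (q : R) : rapid G -> rapid G' ->
  (forall x : R, is_derive x 1 G (G' x)) -> (forall xi, Fabs G xi <= q) ->
  exists2 L, 0 <= L & forall h N, rapid h -> 0 <= N ->
    (forall i xi, (i < J)%N -> Fabs (fun x => x ^+ i * h x) xi <= N) ->
    forall xi, Fabs (fun x => x ^+ J * conv G h x) xi <=
      q * Fabs (fun x => x ^+ J * h x) xi + L * N.
Proof.
move=> rG rG' dG Gq.
pose c i : R := 'C(J, i)%:R * Rint (fun x => `|x ^+ (J - i) * G x|).
have c0 i : 0 <= c i by rewrite mulr_ge0// Rint_ge0.
exists (\sum_(i < J) c i) => [|h N rh N0 hN xi]; first exact: sumr_ge0.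
rewrite (_ : (fun x => _) = (fun x => \sum_(i < J.+1) 'C(J, i)%:R *
    conv (fun z => z ^+ (J - i) * G z) (fun y => y ^+ i * h y) x)); last first.
  by apply/funext => x; exact: conv_moment.
have rGi i : rapid (fun z => z ^+ i * G z) by exact: rapid_pow.
have rhi i : rapid (fun z => z ^+ i * h z) by exact: rapid_pow.
have rci i : rapid (conv (fun z => z ^+ (J - i) * G z) (fun y => y ^+ i * h y)).
  pose G1 z := (J - i)%:R * z ^+ (J - i).-1 * G z + z ^+ (J - i) * G' z.
  apply: (@conv_Rap _ _ G1) => //.
    apply: rapidD; last exact: rapid_pow.
    rewrite (_ : (fun z => _) = (fun z => (J - i)%:R * (z ^+ (J - i).-1 * G z))).
      exact: rapidZ.
    by apply/funext => z; rewrite mulrA.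
  move=> z.
  exact: (is_deriveM_fun (is_deriveX_fun _ z) (dG z)).
pose F i x := 'C(J, i)%:R *
  conv (fun z => z ^+ (J - i) * G z) (fun y => y ^+ i * h y) x.
have rF i : rapid (F i) by exact: rapidZ.
apply: (le_trans (@Fabs_sum J.+1 F xi rF)).
have E i : Fabs (F i) xi =
    'C(J, i)%:R * (Fabs (fun z => z ^+ (J - i) * G z) xi * Fabs (fun y => y ^+ i * h y) xi).
  by rewrite /F FabsZ ?normr_nat ?Fabs_conv//; exact: rapid_L1.
rewrite big_ord_recr/= addrC lerD//.
  rewrite E binn mul1r ler_wpM2r ?Fabs_ge0// subnn.
  by rewrite (_ : (fun z => _) = G)//; apply/funext => z; rewrite mul1r.
rewrite mulr_suml; apply: ler_sum => i _; rewrite E /c -mulrA ler_wpM2l//.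
apply: ler_pM; [exact: Fabs_ge0|exact: Fabs_ge0|apply: Fabs_le_Rint; exact: rapid_L1|exact: hN].
Qed.

End convolution_more.

Section iteration.
Context {R : realType}.
Variables (lam : R) (p : R -> R).
Hypotheses (lam0 : 0 < lam) (rp : rapid p).
Local Notation A := (cutA lam).
Implicit Types (u v h : R -> R).

Let A0 : 0 < A. Proof. exact: cutA_gt0. Qed.

(* [S[u] + p] for [u = greenT * h]. *)
Definition source h x : R :=
  4^-1 * (conv (greenT' lam) h x * conv (greenT' lam) h x) +
  (- (4 * lam ^+ 2)) * eps (conv (greenT lam) h x) + p x.

Lemma rapid_u h : rapid h -> rapid (conv (greenT lam) h).
Proof.
move=> rh; apply: (@conv_Rap _ _ (greenT' lam)) => //; [exact: rapid_greenT|exact: rapid_greenT'|exact: greenT_derive].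
Qed.

Lemma rapid_v h : rapid h -> rapid (conv (greenT' lam) h).
Proof.
move=> rh; have [k [dk kk]] := bl_kernel_derive A0 (bl_greenT' lam0).
by apply: (@conv_Rap _ _ k) => //; [exact: rapid_greenT'|exact: bl_kernel_Rap kk].
Qed.

Section one_step.
Variables (m H : R) (h : R -> R).
Hypotheses (m0 : 0 <= m) (rh : rapid h) (H0 : 0 <= H) (Hlam : H <= lam).
Hypothesis hH : forall x, Fabs h x <= H * wt m x.

Let Du0 : 0 <= H / (10 * lam ^+ 2).
Proof. by rewrite divr_ge0// mulr_ge0// exprn_ge0// ltW. Qed.

Let Dv0 : 0 <= 3 / 25 / lam * H.
Proof. by rewrite mulr_ge0// divr_ge0// ltW. Qed.

Let alu : 2 * A * (H / (10 * lam ^+ 2)) = 6 / 25 * (H / lam).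
Proof. by rewrite /cutA; field; rewrite gt_eqF. Qed.

Let alv : 2 * A * (3 / 25 / lam * H) = 36 / 125 * H.
Proof. by rewrite /cutA; field; rewrite gt_eqF. Qed.

Let Hl : H / lam <= 1. Proof. by rewrite ler_pdivrMr// mul1r. Qed.
Let Hl0 : 0 <= H / lam. Proof. by rewrite divr_ge0// ltW. Qed.

Lemma u_le x : `|conv (greenT lam) h x| <= 6 / 25.
Proof.
rewrite (le_trans (band_bounded A0 m0 Du0 (band_greenT lam0 rh H0 hH) x))// alu.
by move: Hl; lra.
Qed.

Lemma rapid_eps : rapid (fun x => eps (conv (greenT lam) h x)).
Proof.
have ru := rapid_u rh; have [cu _] := ru; split.
  by move=> x; apply: (@continuous_comp _ _ _ (conv (greenT lam) h) eps); [exact: cu|exact: continuous_eps].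
have [_ uu] := rapidM ru ru.
move=> n; have [M uM] := uu n; exists (2 * M) => x.
apply: le_trans (ler_wpM2l (ler0n R 2) (uM x)).
rewrite mulrCA ler_wpM2l ?exprn_ge0// ger0_norm ?eps_ge0//.
rewrite (le_trans (eps_le _))//; first by rewrite (le_trans (u_le x))//; lra.
by rewrite normrM -expr2 real_normK ?num_real.
Qed.

Lemma rapid_source : rapid (source h).
Proof.
have rv := rapid_v rh.
by apply: rapidD => //; apply: rapidD; apply: rapidZ; [exact: rapidM|exact: rapid_eps].
Qed.

Lemma Fabs_source J Mu Mv : 0 <= Mu -> 0 <= Mv ->
  (forall xi, Fabs (fun x => x ^+ J * conv (greenT lam) h x) xi <= Mu * wt m xi) ->
  (forall xi, Fabs (fun x => x ^+ J * conv (greenT' lam) h x) xi <= Mv * wt m xi) ->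
  forall xi, Fabs (fun x => x ^+ J * source h x) xi <=
    (9 / 125 * H * Mv + 6 / 11 * lam * H * Mu) * wt m xi + Fabs (fun x => x ^+ J * p x) xi.
Proof.
move=> Mu0 Mv0 hu hv xi.
set u := conv (greenT lam) h; set v := conv (greenT' lam) h.
have ru : rapid u by exact: rapid_u.
have rv : rapid v by exact: rapid_v.
have rku := rapid_pow J ru; have rkv := rapid_pow J rv; have rkp := rapid_pow J rp.
have Ru := band_greenT lam0 rh H0 hH; have Rv := band_greenT' lam0 rh H0 hH.
have rkvv : rapid (fun x => x ^+ J * v x * v x) by exact: rapidM.
have rke : rapid (fun x => x ^+ J * eps (u x)) by exact: (rapid_pow J rapid_eps).
have Evv : Fabs (fun x => x ^+ J * v x * v x) xi <= Mv * (36 / 125 * H) * wt m xi.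
  by have := Fabs_prod A0 m0 Dv0 Mv0 rkv Rv hv xi; rewrite alv.
have alu1 : 2 * A * (H / (10 * lam ^+ 2)) < 1 by rewrite alu; move: Hl; lra.
have Ee : Fabs (fun x => x ^+ J * eps (u x)) xi <= 3 / 22 * (H / lam) * (Mu * wt m xi).
  have := Fabs_eps A0 m0 Du0 alu1 Mu0 Ru rku hu xi; rewrite alu => /le_trans; apply.
  rewrite ler_wpM2r ?mulr_ge0// ?(ltW (wt_gt0 _ _))//.
  rewrite ler_pdivrMr; last by move: Hl; lra.
  by move: Hl Hl0; move: (H / lam) => y; nra.
rewrite (_ : (fun x => _) = (fun x => 4^-1 * (x ^+ J * v x * v x) +
   (- (4 * lam ^+ 2)) * (x ^+ J * eps (u x)) + x ^+ J * p x)); last first.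
  by apply/funext => x; rewrite /source -/u -/v; ring.
have r1 := rapidZ 4^-1 rkvv; have r2 := rapidZ (- (4 * lam ^+ 2)) rke.
rewrite (le_trans (FabsD xi (rapid_L1 (rapidD r1 r2)) (rapid_L1 rkp)))// lerD2r.
rewrite (le_trans (FabsD xi (rapid_L1 r1) (rapid_L1 r2)))//.
rewrite !FabsZ; [|exact: rapid_L1..].
rewrite normrN !ger0_norm ?mulr_ge0 ?exprn_ge0 ?(ltW lam0) ?invr_ge0//.
rewrite [leRHS]mulrDl; apply: lerD.
  rewrite (le_trans (ler_wpM2l _ Evv)) ?invr_ge0// le_eqVlt; apply/orP; left; apply/eqP.
  by field.
rewrite (le_trans (ler_wpM2l _ Ee)) ?mulr_ge0 ?exprn_ge0 ?(ltW lam0)//.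
rewrite le_eqVlt; apply/orP; left; apply/eqP.
by field; rewrite gt_eqF.
Qed.

End one_step.

Lemma source_contract h h' (d : R) : rapid h -> rapid h' -> 0 <= d ->
  (forall xi, Fabs h xi <= lam) -> (forall xi, Fabs h' xi <= lam) ->
  (forall xi, Fabs (fun x => h x - h' x) xi <= d) ->
  forall xi, Fabs (fun x => source h x - source h' x) xi <= 3 / 5 * d.
Proof.
have al1' : 6 / 25 < 1 :> R by lra.
have num : 216 / 3125 + 48 / 95 <= 3 / 5 :> R by lra.
move=> rh rh' d0 hl hl' hd xi.
have l0 : 0 <= lam by exact: ltW.
have hw x : Fabs h x <= lam * wt 0 x by rewrite wt0 mulr1.
have hw' x : Fabs h' x <= lam * wt 0 x by rewrite wt0 mulr1.
have Ru := band_greenT lam0 rh l0 hw; have Rv := band_greenT' lam0 rh l0 hw.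
have Ru' := band_greenT lam0 rh' l0 hw'; have Rv' := band_greenT' lam0 rh' l0 hw'.
have rG := rapid_greenT lam0; have rG' := rapid_greenT' lam0.
set u := conv (greenT lam) h in Ru; set v := conv (greenT' lam) h in Rv.
set u' := conv (greenT lam) h' in Ru'; set v' := conv (greenT' lam) h' in Rv'.
have ru : rapid u by exact: rapid_u.
have rv : rapid v by exact: rapid_v.
have ru' : rapid u' by exact: rapid_u.
have rv' : rapid v' by exact: rapid_v.
have Du0 : 0 <= lam / (10 * lam ^+ 2) by rewrite divr_ge0// mulr_ge0// exprn_ge0.
have Dv0 : 0 <= 3 / 25 / lam * lam by rewrite mulr_ge0// divr_ge0.
have alu : 2 * A * (lam / (10 * lam ^+ 2)) = 6 / 25.
  by rewrite /cutA; field; rewrite gt_eqF.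
have alv : 2 * A * (3 / 25 / lam * lam) = 36 / 125 * lam.
  by rewrite /cutA; field; rewrite gt_eqF.
have Eu z : Fabs (fun x => u x - u' x) z <= (2 / 5 / lam ^+ 2 * d) * wt 0 z.
  rewrite wt0 mulr1 (@eq_Fabs _ _ (conv (greenT lam) (fun y => h y - h' y))); last first.
    by move=> x; rewrite conv_sub.
  rewrite Fabs_conv//; last exact: rapidB.
  by apply: ler_pM; [exact: Fabs_ge0|exact: Fabs_ge0|exact: Fabs_greenT|exact: hd].
have Ev z : Fabs (fun x => v x - v' x) z <= (12 / 25 / lam * d) * wt 0 z.
  rewrite wt0 mulr1 (@eq_Fabs _ _ (conv (greenT' lam) (fun y => h y - h' y))); last first.
    by move=> x; rewrite conv_sub.
  rewrite Fabs_conv//; last exact: rapidB.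
  by apply: ler_pM; [exact: Fabs_ge0|exact: Fabs_ge0|exact: Fabs_greenT'|exact: hd].
have Mu0 : 0 <= 2 / 5 / lam ^+ 2 * d by rewrite mulr_ge0// divr_ge0// exprn_ge0.
have Mv0 : 0 <= 12 / 25 / lam * d by rewrite mulr_ge0// divr_ge0.
have ruu := rapidB ru ru'; have rvv := rapidB rv rv'.
have P1 := Fabs_prod A0 (lexx 0) Dv0 Mv0 rvv Rv Ev xi.
have P2 := Fabs_prod A0 (lexx 0) Dv0 Mv0 rvv Rv' Ev xi.
have al1 : 2 * A * (lam / (10 * lam ^+ 2)) < 1 by rewrite alu.
have P3 := Fabs_eps_diff A0 (lexx 0) Du0 al1 Mu0 Ru Ru' ruu Eu xi.
rewrite alu alv wt0 !mulr1 in P1 P2 P3.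
have re : rapid (fun x => eps (u x)) by exact: (rapid_eps (lexx 0) rh l0 (lexx lam) hw).
have re' : rapid (fun x => eps (u' x)) by exact: (rapid_eps (lexx 0) rh' l0 (lexx lam) hw').
have r1 := rapidM rvv rv; have r2 := rapidM rvv rv'; have r3 := rapidB re re'.
rewrite (@eq_Fabs _ _ (fun x => 4^-1 * ((v x - v' x) * v x + (v x - v' x) * v' x) +
   (- (4 * lam ^+ 2)) * (eps (u x) - eps (u' x)))); last first.
  by move=> x; rewrite /source -/u -/v -/u' -/v'; ring.
have r12 := rapidD r1 r2.
rewrite (le_trans (FabsD xi (rapid_L1 (rapidZ 4^-1 r12)) (rapid_L1 (rapidZ (- (4 * lam ^+ 2)) r3))))//.
rewrite !FabsZ; [|exact: rapid_L1..].
rewrite normrN !ger0_norm ?mulr_ge0 ?exprn_ge0 ?(ltW lam0) ?invr_ge0//.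
have Q1 := le_trans (FabsD xi (rapid_L1 r1) (rapid_L1 r2)) (lerD P1 P2).
apply: (le_trans (lerD (ler_wpM2l _ Q1) (ler_wpM2l _ P3))).
- by rewrite invr_ge0.
- by rewrite mulr_ge0// exprn_ge0.
rewrite [leLHS](_ : _ = (216 / 3125 + 48 / 95) * d); last by field; rewrite gt_eqF.
by rewrite ler_wpM2r.
Qed.

End iteration.

Section geometric_limit.
Context {R : realType}.

Lemma cvg_geometric_steps (s : nat -> R) (M : R) : (forall n, `|s n.+1 - s n| <= M * (3 / 5) ^+ n) ->
  cvg (s @ \oo).
Proof.
move=> h.
have E n : s n = s 0%N + series (fun k => s k.+1 - s k) n.
  by rewrite /series/= telescope_sumr// addrC subrK.
rewrite (funext E); apply: is_cvgD; first exact: is_cvg_cst.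
apply: normed_cvg.
apply: (@series_le_cvg _ _ (geometric M (3 / 5))) => [n|n|n|].
- exact: normr_ge0.
- by rewrite /= (le_trans _ (h n)).
- exact: h.
- by apply: is_cvg_geometric_series; rewrite ger0_norm; lra.
Qed.

End geometric_limit.

Section fixed_point.
Context {R : realType}.
Variables (lam Gam mu : R) (p : R -> R).
Hypotheses (lam0 : 0 < lam) (Gam0 : 0 < Gam) (mu0 : 0 <= mu) (Gl : 2 * Gam <= lam).
Hypothesis (rp : rapid p).
Hypothesis p_hat : forall xi, Fabs p xi <= Gam * wt mu xi.
Local Notation A := (cutA lam).
Local Notation source := (source lam p).

Let A0 : 0 < A. Proof. exact: cutA_gt0. Qed.

Fixpoint picard n : R -> R := if n is n'.+1 then source (picard n') else p.

Definition spectral_bound : R := (1 + 2 * Gam / lam) * Gam.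

Let x_le : Gam / lam <= 1 / 2.
Proof. by rewrite ler_pdivrMr//; move: Gl; lra. Qed.

Let x_ge0 : 0 <= Gam / lam. Proof. by rewrite divr_ge0// ltW. Qed.

Lemma bound_ge0 : 0 <= spectral_bound.
Proof. by rewrite /spectral_bound mulr_ge0 ?(ltW Gam0)// -mulrA; move: x_ge0; lra. Qed.

Lemma bound_le2 : spectral_bound <= 2 * Gam.
Proof. by rewrite /spectral_bound ler_wpM2r ?(ltW Gam0)// -mulrA; move: x_le; lra. Qed.

Lemma bound_le : spectral_bound <= lam.
Proof. exact: le_trans bound_le2 Gl. Qed.

Lemma picard_bound n : rapid (picard n) /\ forall xi, Fabs (picard n) xi <= spectral_bound * wt mu xi.
Proof.
elim: n => [|n [rh hH]] /=.
  split=> // xi; rewrite (le_trans (p_hat xi))// ler_wpM2r ?(ltW (wt_gt0 _ _))//.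
  by rewrite /spectral_bound ler_peMl ?(ltW Gam0)// lerDl -mulrA mulr_ge0.
split; first exact: (rapid_source lam0 rp mu0 rh bound_ge0 bound_le hH).
move=> xi.
have hu z : Fabs (fun x => x ^+ 0 * conv (greenT lam) (picard n) x) z <= (2 / 5 / lam ^+ 2 * spectral_bound) * wt mu z.
  rewrite (@eq_Fabs _ _ (conv (greenT lam) (picard n))); last by move=> x; rewrite mul1r.
  rewrite (Fabs_conv z (rapid_greenT lam0) rh) -mulrA.
  by apply: ler_pM; [exact: Fabs_ge0|exact: Fabs_ge0|exact: Fabs_greenT|exact: hH].
have hv z : Fabs (fun x => x ^+ 0 * conv (greenT' lam) (picard n) x) z <= (12 / 25 / lam * spectral_bound) * wt mu z.
  rewrite (@eq_Fabs _ _ (conv (greenT' lam) (picard n))); last by move=> x; rewrite mul1r.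
  rewrite (Fabs_conv z (rapid_greenT' lam0) rh) -mulrA.
  by apply: ler_pM; [exact: Fabs_ge0|exact: Fabs_ge0|exact: Fabs_greenT'|exact: hH].
have Mu0 : 0 <= 2 / 5 / lam ^+ 2 * spectral_bound.
  by rewrite mulr_ge0 ?bound_ge0// divr_ge0// exprn_ge0// ltW.
have Mv0 : 0 <= 12 / 25 / lam * spectral_bound by rewrite mulr_ge0 ?bound_ge0// divr_ge0// ltW.
have := Fabs_source lam0 rp mu0 rh bound_ge0 bound_le hH Mu0 Mv0 hu hv xi.
rewrite (@eq_Fabs _ (fun x => x ^+ 0 * source (picard n) x) (source (picard n))); last by move=> x; rewrite mul1r.
rewrite (@eq_Fabs _ (fun x => x ^+ 0 * p x) p); last by move=> x; rewrite mul1r.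
move=> /le_trans; apply.
apply: (le_trans (lerD (lexx _) (p_hat xi))).
rewrite -mulrDl ler_wpM2r ?(ltW (wt_gt0 _ _))//.
rewrite [leLHS](_ : _ = (108 / 3125 + 12 / 55) * (spectral_bound ^+ 2 / lam) + Gam); last by field; rewrite gt_eqF.
have b2 : spectral_bound ^+ 2 / lam <= 4 * (Gam ^+ 2 / lam).
  rewrite mulrA ler_wpM2r ?invr_ge0 ?(ltW lam0)// (_ : 4 * Gam ^+ 2 = (2 * Gam) ^+ 2); last by ring.
  by rewrite lerXn2r ?nnegrE ?bound_ge0 ?bound_le2// mulr_ge0// ltW.
rewrite [leRHS](_ : _ = Gam + 2 * (Gam ^+ 2 / lam)); last by rewrite /spectral_bound; ring.
have g2 : 0 <= Gam ^+ 2 / lam by rewrite divr_ge0 ?sqr_ge0// ltW.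
by move: (spectral_bound ^+ 2 / lam) (Gam ^+ 2 / lam) b2 g2 => X Y; lra.
Qed.

Lemma picard_rapid n : rapid (picard n). Proof. by have [] := picard_bound n. Qed.

Lemma picard_bound0 n xi : Fabs (picard n) xi <= spectral_bound.
Proof.
have [_ h] := picard_bound n; rewrite (le_trans (h xi))// ler_piMr ?bound_ge0//.
exact: wt_le1.
Qed.

(* The moment of order [j] of [picard n.+1] is at most half that of [picard n],
   plus a constant depending on the moments of lower order only. *)
Lemma picard_moments J : exists2 N, 0 <= N & forall i n xi, (i <= J)%N ->
  Fabs (fun x => x ^+ i * picard n x) xi <= N.
Proof.
suff step j : (exists2 N, 0 <= N & forall i n xi, (i < j)%N -> Fabs (fun x => x ^+ i * picard n x) xi <= N) ->
    exists2 N, 0 <= N & forall n xi, Fabs (fun x => x ^+ j * picard n x) xi <= N.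
  elim: J => [|J [N N0 hN]].
    have [|N N0 hN] := step 0%N; first by exists 0.
    by exists N => // i n xi; rewrite leqn0 => /eqP ->.
  have [|N' N'0 hN'] := step J.+1; first by exists N => // i n xi; rewrite ltnS; exact: hN.
  exists (N + N') => [|i n xi]; first exact: addr_ge0.
  rewrite leq_eqVlt => /orP[/eqP ->|]; first by rewrite (le_trans (hN' n xi))// lerDr.
  by rewrite ltnS => /(hN i n xi)/le_trans; apply; rewrite lerDl.
move=> [N N0 hN].
have [k [dk kk]] := bl_kernel_derive A0 (bl_greenT' lam0).
have [L1 L10 hL1] := Fabs_conv_moment j (rapid_greenT lam0) (rapid_greenT' lam0) (greenT_derive lam0) (Fabs_greenT lam0).
have [L2 L20 hL2] := Fabs_conv_moment j (rapid_greenT' lam0) (bl_kernel_Rap A0 kk) dk (Fabs_greenT' lam0).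
pose P := Rint (fun x => `|x ^+ j * p x|).
have P0 : 0 <= P by exact: Rint_ge0.
have hP xi : Fabs (fun x => x ^+ j * p x) xi <= P by apply: Fabs_le_Rint; exact/rapid_L1/rapid_pow.
pose L := 9 / 125 * spectral_bound * (L2 * N) + 6 / 11 * lam * spectral_bound * (L1 * N) + P.
have b0 := bound_ge0.
have l0 : 0 <= lam by exact: ltW.
have L9 : 0 <= 9 / 125 * spectral_bound * (L2 * N) + 6 / 11 * lam * spectral_bound * (L1 * N).
  have c9 : 0 <= 9 / 125 :> R by rewrite divr_ge0.
  have c6 : 0 <= 6 / 11 :> R by rewrite divr_ge0.
  apply: addr_ge0; apply: mulr_ge0; [exact: mulr_ge0 c9 b0|exact: mulr_ge0| |exact: mulr_ge0].
  exact: mulr_ge0 (mulr_ge0 c6 l0) b0.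
have L0 : 0 <= L by exact: addr_ge0.
exists (2 * L) => [|n]; first by rewrite mulr_ge0.
elim: n => [|n IH] xi /=.
  rewrite (le_trans (hP xi))// /L.
  by move: P0 L9; move: (_ * _ * _ + _) => X; lra.
have rh := picard_rapid n.
have hw z : Fabs (picard n) z <= spectral_bound * wt 0 z by rewrite wt0 mulr1 picard_bound0.
have hu z : Fabs (fun x => x ^+ j * conv (greenT lam) (picard n) x) z <=
    (2 / 5 / lam ^+ 2 * (2 * L) + L1 * N) * wt 0 z.
  rewrite wt0 mulr1 (le_trans (hL1 (picard n) N rh N0 (fun i z => hN i n z) z))// lerD2r.
  by rewrite ler_wpM2l// divr_ge0// exprn_ge0// ltW.
have hv z : Fabs (fun x => x ^+ j * conv (greenT' lam) (picard n) x) z <=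
    (12 / 25 / lam * (2 * L) + L2 * N) * wt 0 z.
  rewrite wt0 mulr1 (le_trans (hL2 (picard n) N rh N0 (fun i z => hN i n z) z))// lerD2r.
  by rewrite ler_wpM2l// divr_ge0// ltW.
have Mu0 : 0 <= 2 / 5 / lam ^+ 2 * (2 * L) + L1 * N.
  by rewrite addr_ge0 ?mulr_ge0// ?divr_ge0 ?exprn_ge0// ?invr_ge0 ?exprn_ge0// ltW.
have Mv0 : 0 <= 12 / 25 / lam * (2 * L) + L2 * N.
  by rewrite addr_ge0 ?mulr_ge0// ?invr_ge0 ltW.
apply: (le_trans (Fabs_source lam0 rp (lexx 0) rh b0 bound_le hw Mu0 Mv0 hu hv xi)).
rewrite wt0 mulr1 (le_trans (lerD (lexx _) (hP xi)))//.
rewrite [leLHS](_ : _ = (108 / 3125 + 12 / 55) * (spectral_bound / lam) * (2 * L) + L); last first.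
  by rewrite /L; field; rewrite gt_eqF.
have bl : spectral_bound / lam <= 1 by rewrite ler_pdivrMr// mul1r bound_le.
have key (y Z : R) : y <= 1 -> 0 <= Z -> (108 / 3125 + 12 / 55) * y * (2 * Z) + Z <= 2 * Z.
  move=> y1 Z0; have h1 : (108 / 3125 + 12 / 55) * y <= 1 / 2 by lra.
  have h2 : (108 / 3125 + 12 / 55) * y * (2 * Z) <= 1 / 2 * (2 * Z) by rewrite ler_wpM2r// mulr_ge0.
  lra.
exact: key.
Qed.

Lemma picard_step n xi : Fabs (fun x => picard n.+1 x - picard n x) xi <= (2 * lam) * (3 / 5) ^+ n.
Proof.
elim: n xi => [|n IH] xi.
  rewrite mulr1 (@eq_Fabs _ _ (fun x => picard 1 x + (-1) * picard 0 x)); last by move=> x; rewrite mulN1r.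
  rewrite (le_trans (FabsD _ (rapid_L1 (picard_rapid 1)) (L1Z (-1) (rapid_L1 (picard_rapid 0)))))//.
  rewrite FabsZ; last exact: rapid_L1 (picard_rapid 0).
  rewrite normrN1 mul1r mulr_natl mulr2n.
  by rewrite lerD// (le_trans (picard_bound0 _ _))// bound_le.
have hl m z : Fabs (picard m) z <= lam by exact: le_trans (picard_bound0 m z) bound_le.
have d0 : 0 <= 2 * lam * (3 / 5) ^+ n by rewrite !mulr_ge0 ?exprn_ge0// ltW.
have := source_contract p lam0 (picard_rapid n.+1) (picard_rapid n) d0 (hl n.+1) (hl n) IH xi.
by rewrite mulrCA -exprS.
Qed.

End fixed_point.

Lemma eps_abs_le {R : realType} (t : R) : `|t| <= 6 / 25 -> `|eps t| <= `|t|.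
Proof.
move=> t1; rewrite ger0_norm ?eps_ge0// (le_trans (eps_le _))//; first by lra.
by rewrite -[t ^+ 2]real_normK ?num_real// expr2 mulrA ler_piMl//; lra.
Qed.

Section limit.
Context {R : realType}.
Variables (lam Gam mu : R) (p : R -> R).
Hypotheses (lam0 : 0 < lam) (Gam0 : 0 < Gam) (mu0 : 0 <= mu) (Gl : 2 * Gam <= lam).
Hypothesis (rp : rapid p).
Hypothesis p_hat : forall xi, Fabs p xi <= Gam * wt mu xi.
Local Notation A := (cutA lam).
Local Notation picard := (picard lam p).
Let A0 : 0 < A. Proof. exact: cutA_gt0. Qed.
Let rhs n : rapid (picard n). Proof. exact: (picard_rapid lam0 Gam0 mu0 Gl rp p_hat). Qed.

Lemma conv_picard_sup k J : bl_kernel A k -> exists2 N, 0 <= N &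
  forall n x, `|x ^+ J * conv k (picard n) x| <= N.
Proof.
move=> kk; have rk := bl_kernel_Rap A0 kk.
have [N N0 hN] := picard_moments lam0 Gam0 mu0 Gl rp p_hat J.
have E (i : 'I_J.+1) : exists M, 0 <= M /\ forall h H, rapid h -> 0 <= H ->
    (forall xi, Fabs h xi <= H) -> forall x, `|conv (fun z => z ^+ (J - i) * k z) h x| <= M * H.
  by have [M M0 hM] := bl_kernel_conv_bd lam0 (bl_kernel_pow A0 (J - i) kk); exists M.
pose M i := projT1 (cid (E i)).
have M0 i : 0 <= M i by have [] := projT2 (cid (E i)).
exists (\sum_(i < J.+1) 'C(J, i)%:R * (M i * N)) => [|n x].
  by apply: sumr_ge0 => i _; rewrite mulr_ge0// mulr_ge0.
rewrite conv_moment// (le_trans (ler_norm_sum _ _ _))//; apply: ler_sum => i _.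
rewrite normrM normr_nat ler_wpM2l//.
have [_ hM] := projT2 (cid (E i)); apply: hM => //; first exact: rapid_pow.
by move=> xi; apply: hN; rewrite -ltnS.
Qed.

Lemma picard_sup J : exists2 N, 0 <= N & forall n x, `|x ^+ J * picard n x| <= N.
Proof.
have [Nu Nu0 hu] := conv_picard_sup J (bl_greenT lam0).
have [Nv Nv0 hv] := conv_picard_sup J (bl_greenT' lam0).
have [Nw Nw0 hw] := conv_picard_sup 0 (bl_greenT' lam0).
have [Np Np0 hp] := rapid_bd (rapid_pow J rp).
have l4 : 0 <= 4 * lam ^+ 2 by rewrite mulr_ge0// sqr_ge0.
have q4 : 0 <= 4^-1 :> R by rewrite invr_ge0.
exists (4^-1 * (Nv * Nw) + 4 * lam ^+ 2 * Nu + Np).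
  exact: addr_ge0 (addr_ge0 (mulr_ge0 q4 (mulr_ge0 Nv0 Nw0)) (mulr_ge0 l4 Nu0)) Np0.
move=> [|n] x /=.
  rewrite (le_trans (hp x))// lerDr.
  exact: addr_ge0 (mulr_ge0 q4 (mulr_ge0 Nv0 Nw0)) (mulr_ge0 l4 Nu0).
rewrite /source; set u := conv (greenT lam) _ x; set v := conv (greenT' lam) _ x.
have u1 : `|u| <= 6 / 25.
  have [rh hH] := picard_bound lam0 Gam0 mu0 Gl rp p_hat n.
  exact: (u_le lam0 mu0 rh (bound_ge0 lam0 Gam0) (bound_le lam0 Gam0 Gl) hH).
have v1 : `|v| <= Nw by have := hw n x; rewrite mul1r.
have eu : `|eps u| <= `|u| := eps_abs_le u1.
rewrite [X in `|X|](_ : _ = 4^-1 * ((x ^+ J * v) * v) + - (4 * lam ^+ 2) * (x ^+ J * eps u) + x ^+ J * p x); last by ring.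
rewrite (le_trans (ler_normD _ _))// lerD//.
rewrite (le_trans (ler_normD _ _))// lerD//.
  rewrite normrM (ger0_norm q4) ler_wpM2l// normrM.
  by apply: ler_pM; [exact: normr_ge0|exact: normr_ge0|exact: hv|exact: v1].
rewrite normrM normrN (ger0_norm l4) ler_wpM2l// (le_trans _ (hu n x))//.
by rewrite !normrM ler_wpM2l.
Qed.

Lemma conv_picard_cvg k x : bl_kernel A k -> cvg (conv k (picard n) x @[n --> \oo]).
Proof.
move=> kk; have [M M0 hM] := bl_kernel_conv_bd lam0 kk; have rk := bl_kernel_Rap A0 kk.
apply: (@cvg_geometric_steps _ _ (M * (2 * lam))) => n.
rewrite -conv_sub// -mulrA; apply: hM.
- exact: rapidB.
- by rewrite mulr_ge0 ?exprn_ge0// ?divr_ge0// mulr_ge0// ltW.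
- by move=> xi; exact: (picard_step lam0 Gam0 mu0 Gl rp p_hat).
Qed.

Theorem fixed_point : exists h, [/\ rapid h, h = source lam p h &
  forall xi, Fabs h xi <= spectral_bound lam Gam * wt mu xi].
Proof.
pose U x := limn (fun n => conv (greenT lam) (picard n) x).
pose V x := limn (fun n => conv (greenT' lam) (picard n) x).
have cU x : conv (greenT lam) (picard n) x @[n --> \oo] --> U x := conv_picard_cvg (x := x) (bl_greenT lam0).
have cV x : conv (greenT' lam) (picard n) x @[n --> \oo] --> V x := conv_picard_cvg (x := x) (bl_greenT' lam0).
pose h x := 4^-1 * (V x * V x) + (- (4 * lam ^+ 2)) * eps (U x) + p x.
have ch x : picard n x @[n --> \oo] --> h x.
  have : picard n.+1 x @[n --> \oo] --> h x.
    apply: cvgD; last exact: cvg_cst.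
    apply: cvgD.
      by apply: cvgM; [exact: cvg_cst|exact: cvgM].
    apply: cvgM; first exact: cvg_cst.
    exact: (cvg_comp _ _ (cU x) (@continuous_eps R (U x))).
  by rewrite (cvg_shiftS (fun n => picard n x)).
have hsup J : exists M, forall x, `|x| ^+ J * `|h x| <= M.
  have [N _ hN] := picard_sup J; exists N => x.
  have c : `|x ^+ J * picard n x| @[n --> \oo] --> `|x ^+ J * h x|.
    by apply: cvg_norm; apply: cvgM; [exact: cvg_cst|exact: ch].
  rewrite -normrX -normrM; apply: (cvgr_to_le c).
  by apply: nearW => n; exact: hN.
have [N0 N00 hN0] := picard_sup 0; have [N2 N20 hN2] := picard_sup 2.
pose g (x : R) := (N0 + N2) * (oneDsqr x)^-1.
have Lg : L1 g := L1Z _ (@L1_oneDsqrV R).1.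
have hg n x : `|picard n x| <= g x.
  rewrite /g ler_pdivlMr ?(lt_le_trans _ (oneDsqr_ge1 x))// /oneDsqr mulrDr mulr1.
  apply: lerD; first by have := hN0 n x; rewrite mul1r.
  by have := hN2 n x; rewrite normrM (ger0_norm (sqr_ge0 _)) mulrC.
have mhs n := rapid_meas (rhs n).
have [Lh _] := Rint_dominated mhs ch Lg hg.
have conv_lim k : rapid k -> forall x, conv k (picard n) x @[n --> \oo] --> conv k h x.
  move=> rk x; have [M M0 kM] := rapid_bd rk.
  apply: (@Rint_dominated _ (fun n y => picard n y * k (x - y)) _ (fun y => M * g y) _ _ _ _).2.
  - by move=> n; exact: L1_meas (conv_L1 x rk (rapid_L1 (rhs n))).
  - by move=> y; apply: cvgM; [exact: ch|exact: cvg_cst].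
  - exact: L1Z.
  - by move=> n y; rewrite normrM mulrC; apply: ler_pM.
have rG := rapid_greenT lam0; have rG' := rapid_greenT' lam0.
have UE : U = conv (greenT lam) h.
  by apply/funext => x; apply: (cvg_unique _ (cU x) (conv_lim _ rG x)); exact: norm_hausdorff.
have VE : V = conv (greenT' lam) h.
  by apply/funext => x; apply: (cvg_unique _ (cV x) (conv_lim _ rG' x)); exact: norm_hausdorff.
have [k [dk kk]] := bl_kernel_derive A0 (bl_greenT' lam0).
have contU : continuous U.
  by rewrite UE => x; exact: is_derive_continuous (conv_derive x rG rG' Lh (greenT_derive lam0)).
have contV : continuous V.
  by rewrite VE => x; exact: is_derive_continuous (conv_derive x rG' (bl_kernel_Rap A0 kk) Lh dk).
exists h; split.
- split=> [x|//].
  have c1 : {for x, continuous (fun x => 4^-1 * (V x * V x))}.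
    by apply: cvgM; [exact: cvg_cst|apply: cvgM; exact: contV].
  have c2 : {for x, continuous (fun x => - (4 * lam ^+ 2) * eps (U x))}.
    apply: cvgM; first exact: cvg_cst.
    by apply: (@continuous_comp _ _ _ U eps); [exact: contU|exact: continuous_eps].
  apply: cvgD; first by apply: cvgD; [exact: c1|exact: c2].
  by case: rp => cp _; exact: cp.
- by apply/funext => x; rewrite /source -UE -VE.
- move=> xi; apply: (Fabs_cvg_le mhs ch Lg hg) => n.
  by have [_] := picard_bound lam0 Gam0 mu0 Gl rp p_hat n; exact.
Qed.

End limit.

(** * Schwartz functions and the complex statement *)

Section real_schwartz.
Context {R : realType}.
Implicit Types (f g h k u s : R -> R).

Definition Schw f := smooth f /\ forall n, rapid (derive1n n f).

Lemma Schw_coind (P : (R -> R) -> Prop) :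
  (forall f, P f -> rapid f /\ exists f', (forall x : R, is_derive x 1 f (f' x)) /\ P f') ->
  forall f, P f -> Schw f.
Proof.
move=> step f Pf; split.
  by apply: (@smooth_coind _ P) Pf => g /step[].
move=> n; suff /step[] : P (derive1n n f) by [].
elim: n => [//|n IH]; have [_ [f' [df Pf']]] := step _ IH.
by rewrite derive1nS (_ : derive1 _ = f')//; apply/funext => x; exact: derive1_val.
Qed.

Lemma Schw_Rap f : Schw f -> rapid f. Proof. by move=> [_ /(_ 0%N)]. Qed.

Lemma Schw_derive1 f : Schw f -> Schw (derive1 f).
Proof.
move=> [sf rf]; split; first exact: smooth_derive1.
by move=> n; have := rf n.+1; rewrite derive1Sn.
Qed.

Lemma SchwD f : Schw f -> forall x : R, is_derive x 1 f (derive1 f x).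
Proof. by move=> [sf _]; exact: smoothD. Qed.

Section closure.
Variable u : R -> R.
Hypothesis su : Schw u.

Inductive schw_alg : (R -> R) -> Prop :=
| schw_base f : Schw f -> schw_alg f
| schw_scale c f : schw_alg f -> schw_alg (fun x => c * f x)
| schw_add f g : schw_alg f -> schw_alg g -> schw_alg (fun x => f x + g x)
| schw_mul f g : schw_alg f -> schw_alg g -> schw_alg (fun x => f x * g x)
| schw_exp f : schw_alg f -> schw_alg (fun x => f x * expR (u x)).

Lemma schw_alg_step f : schw_alg f ->
  rapid f /\ exists f', (forall x : R, is_derive x 1 f (f' x)) /\ schw_alg f'.
Proof.
elim=> {f}.
- move=> f sf; split; first exact: Schw_Rap.
  by exists (derive1 f); split; [exact: SchwD|apply: schw_base; exact: Schw_derive1].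
- move=> c f _ [rf [f' [df sf']]]; split; first exact: rapidZ.
  exists (fun x => c * f' x); split; last exact: schw_scale.
  move=> x; apply: (is_derive_eq (is_deriveM_fun (is_derive_cst_fun c x) (df x))).
  by rewrite mul0r add0r.
- move=> f g _ [rf [f' [df sf']]] _ [rg [g' [dg sg']]]; split; first exact: rapidD.
  exists (fun x => f' x + g' x); split; last exact: schw_add.
  by move=> x; exact: is_deriveD_fun.
- move=> f g sf [rf [f' [df sf']]] sg [rg [g' [dg sg']]]; split; first exact: rapidM.
  exists (fun x => f' x * g x + f x * g' x); split; first by move=> x; exact: is_deriveM_fun.
  by apply: schw_add; exact: schw_mul.
- move=> f sf [rf [f' [df sf']]]; split.
    have [M _ uM] := rapid_bd (Schw_Rap su).
    apply: (@rapidMb _ f (fun x => expR (u x)) (expR M)) => //.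
      move=> x; apply: (@continuous_comp _ _ _ u expR); last exact: continuous_expR.
      exact: is_derive_continuous (SchwD su x).
    move=> x; rewrite ger0_norm ?expR_ge0// ler_expR (le_trans (ler_norm _))//.
  exists (fun x => f' x * expR (u x) + f x * derive1 u x * expR (u x)); split.
    move=> x; apply: (is_derive_eq (is_deriveM_fun (df x) (is_derive_comp_fun (is_derive_expR _) (SchwD su x)))).
    by ring.
  apply: schw_add; first exact: schw_exp.
  apply: schw_exp; apply: schw_mul => //; apply: schw_base; exact: Schw_derive1.
Qed.

Lemma schw_alg_Schw f : schw_alg f -> Schw f.
Proof. by apply: Schw_coind; exact: schw_alg_step. Qed.

Lemma Schw_eps : rapid (fun x => eps (u x)) -> Schw (fun x => eps (u x)).
Proof.
move=> re; apply: (@Schw_coind (fun f => f = (fun x => eps (u x)) \/ schw_alg f)); last by left.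
move=> f [->|sf]; last first.
  by have [rf [f' [df sf']]] := schw_alg_step sf; split=> //; exists f'; split=> //; right.
split=> //; exists (fun x => derive1 u x * expR (u x) + (-1) * derive1 u x); split.
  move=> x; apply: (is_derive_eq (is_derive_comp_fun (is_derive_eps (u x)) (SchwD su x))).
  by ring.
have sdu : schw_alg (derive1 u) by apply: schw_base; exact: Schw_derive1.
by right; apply: schw_add; [exact: schw_exp|exact: schw_scale].
Qed.

End closure.

Lemma Schw_scale c f : Schw f -> Schw (fun x => c * f x).
Proof. by move=> sf; apply: (schw_alg_Schw sf); apply: schw_scale; exact: schw_base. Qed.

Lemma Schw_add f g : Schw f -> Schw g -> Schw (fun x => f x + g x).
Proof. by move=> sf sg; apply: (schw_alg_Schw sf); apply: schw_add; exact: schw_base. Qed.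

Lemma Schw_mul f g : Schw f -> Schw g -> Schw (fun x => f x * g x).
Proof. by move=> sf sg; apply: (schw_alg_Schw sf); apply: schw_mul; exact: schw_base. Qed.

Lemma Schw_conv A k h : 0 < A -> bl_kernel A k -> rapid h -> Schw (conv k h).
Proof.
move=> A0 kk rh.
apply: (@Schw_coind (fun f => exists2 k, bl_kernel A k & f = conv k h)); last by exists k.
move=> f [{kk}k kk ->]; have [k' [dk kk']] := bl_kernel_derive A0 kk.
have rk := bl_kernel_Rap A0 kk; have rk' := bl_kernel_Rap A0 kk'.
split; first exact: (conv_Rap rk rk' rh dk).
exists (conv k' h); split; last by exists k'.
by move=> x; apply: conv_derive => //; exact: rapid_L1.
Qed.

End real_schwartz.

Section complex_translation.
Context {R : realType}.
Implicit Types (f g : R -> R).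
Local Notation C f := (fun x : R => (f x)%:C).

Lemma cabs_real (r : R) : cabs r%:C = `|r|.
Proof. by rewrite /cabs /= expr0n addr0 sqrtr_sqr. Qed.

Lemma cabsE (a b : R) : cabs (a +i* b) = amp a b. Proof. by []. Qed.

Lemma cderive_real f : cderive (C f) = C (derive1 f).
Proof.
apply/funext => x; rewrite /cderive /=; congr (_ +i* _).
exact: derive1_val (is_derive_cst_fun 0 x).
Qed.

Lemma iter_cderive_real n f : iter n cderive (C f) = C (derive1n n f).
Proof. by elim: n => [//|n IH]; rewrite iterS IH cderive_real derive1nS. Qed.

Lemma schwartz_real f : Schw f <-> schwartz (C f).
Proof.
split=> [[sf rf]|[[sf _] bf]].
  split; first by split; [exact: sf|exact: smooth_cst].
  move=> m n; have [_ /(_ m)[M fM]] := rf n; exists M => x.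
  by rewrite iter_cderive_real cabs_real.
split=> // n; split.
  by move=> x; exact: is_derive_continuous (derivable_is_derive (sf n x)).
move=> m; have [M fM] := bf m n; exists M => x.
by have := fM x; rewrite iter_cderive_real cabs_real.
Qed.

Lemma fourier_real f xi : L1 f -> fourier (C f) xi = fcos f xi +i* (- fsin f xi).
Proof.
move=> Lf; rewrite /fourier /cintegral; congr (_ +i* _).
  by apply: eq_Rint => x /=; rewrite cosN mulr0 subr0 mulrC.
rewrite -[RHS]mulN1r -RintZ; last exact: L1_sin.
by apply: eq_Rint => x /=; rewrite sinN mulr0 add0r; ring.
Qed.

Lemma cabs_fourier_real f xi : L1 f -> cabs (fourier (C f) xi) = Fabs f xi.
Proof. by move=> Lf; rewrite fourier_real// cabsE /Fabs /amp sqrrN. Qed.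

Lemma exp_tail2_real (t : R) : exp_tail2 t%:C = (eps t)%:C.
Proof.
have E n : \sum_(2 <= k < n) t%:C ^+ k / (k`!)%:R = (\sum_(2 <= k < n) t ^+ k / (k`!)%:R)%:C.
  rewrite rmorph_sum/=; apply: eq_bigr => k _.
  by rewrite rmorphM/= rmorphXn/= fmorphV rmorph_nat.
have -> : exp_tail2 t%:C = clim (fun n => (\sum_(2 <= k < n) t ^+ k / (k`!)%:R)%:C).
  by congr clim; apply/funext => n; exact: E.
rewrite /clim /=; congr (_ +i* _); last exact: lim_cst.
apply: cvg_lim => //; rewrite -(cvg_shiftn 2) /=.
rewrite (_ : (fun n => _) = (fun N : nat => \sum_(i < N) t ^+ i.+2 / (i.+2)`!%:R)).
  exact: cvg_eps.
apply/funext => n; rewrite -{1}[2%N]add0n big_addn addnK big_mkord.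
by apply: eq_bigr => i _; rewrite addn2.
Qed.

Lemma Linfty_norm_le (f : R -> R[i]) (M : R) : (forall x, cabs (f x) <= M) ->
  (Linfty_norm f <= M%:E)%E.
Proof.
move=> fM; rewrite /Linfty_norm unlock /=.
have c0 x : 0 <= cabs (f x) by rewrite /cabs; case: (f x) => a b; exact: sqrtr_ge0.
case: ifPn => _.
  by apply/ess_supP; apply: aeW => x /=; rewrite lee_fin ger0_norm.
by rewrite lee_fin (le_trans (c0 0)).
Qed.

End complex_translation.

Section tail.
Context {R : realType}.

Lemma tail_integral (lam mu : R) (k : R -> R) : 0 < lam -> 0 < mu -> continuous k ->
  (forall x, 0 <= k x <= 1) -> (forall x, k (- x) = k x) -> (forall x, `|x| <= lam -> k x = 0) ->
  Rint (fun x => k x * wt mu x) <= 2 * (expR (- mu * lam) / mu).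
Proof.
move=> lam0 mu0 ck k01 ke k0.
have k_ge0 x : 0 <= k x by have /andP[] := k01 x.
have k_le1 x : k x <= 1 by have /andP[] := k01 x.
pose f x := k x * wt mu x.
have cf : continuous f by move=> x; apply: cvgM; [exact: ck|exact: continuous_expRN].
have f0 x : 0 <= f x by rewrite /f mulr_ge0// ltW// wt_gt0.
have T : (\int[@lebesgue_measure R]_(x in `[lam, +oo[) (expR (- mu * x))%:E =
    (expR (- mu * lam) / mu)%:E)%E.
  pose F x := - (mu^-1 * expR (- mu * x)).
  have dF (x : R) : is_derive x 1 F (expR (- mu * x)).
    apply: (is_derive_eq (is_deriveN_fun (is_deriveM_fun (is_derive_cst_fun mu^-1 x) (is_derive_comp_fun (is_derive_expR _) (is_deriveM_fun (is_derive_cst_fun (- mu) x) (is_derive_id_fun x)))))).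
    by field; rewrite gt_eqF.
  rewrite (@ge0_continuous_FTC2y R _ F lam 0).
  - by rewrite -EFinB /F sub0r opprK mulrC.
  - by move=> x _; exact: expR_ge0.
  - apply: continuous_subspaceT => x.
    exact: (is_derive_continuous (is_derive_comp_fun (is_derive_expR _) (is_deriveM_fun (is_derive_cst_fun (- mu) x) (is_derive_id_fun x)))).
  - rewrite -[X in _ --> X]oppr0 -[X in - X](mulr0 mu^-1); apply: cvgN; apply: cvgM; first exact: cvg_cst.
    under eq_fun do rewrite mulNr.
    apply: (cvg_comp (fun x => mu * x) (fun x => expR (- x))); last exact: cvgr_expR.
    apply/cvgryPge => B; exists (B / mu); split; first exact: num_real.
    by move=> x; rewrite ltr_pdivrMr// => /ltW; rewrite mulrC.
  - by move=> x _; case: (dF x).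
  - by apply: cvg_at_right_filter; exact: (is_derive_continuous (dF lam)).
  - by move=> x _; exact: derive1_val (dF x).
have E : ((\int[@lebesgue_measure R]_x (f x)%:E) <= (2 * (expR (- mu * lam) / mu))%:E)%E.
  rewrite ge0_symfun_integralT//; last by move=> x; rewrite /f /= ke wtN.
  rewrite EFinM -T lee_pmul2l//.
  rewrite -set_itvcy (_ : `[0, +oo[%classic = `[0, lam[%classic `|` `[lam, +oo[%classic); last first.
    by rewrite -itv_bndbnd_setU ?bnd_simp// ltW.
  have mf : measurable_fun setT (EFin \o f).
    by apply/measurable_EFinP; exact: continuous_measurable_fun.
  rewrite ge0_integral_setU//=; last 3 first.
  - exact: measurable_funTS.
  - by move=> x _; rewrite lee_fin.
  - by apply/disj_setPS => y [/=]; rewrite !in_itv/= => /andP[_ yl]; rewrite andbT leNgt yl.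
  rewrite integral0_eq ?add0e; last first.
    move=> x /=; rewrite in_itv/= => /andP[x0 xl].
    by rewrite /f k0 ?mul0r// ger0_norm// ltW.
  apply: ge0_le_integral => //.
  - by move=> x _; rewrite lee_fin.
  - exact: measurable_funTS.
  - apply: measurable_funTS; apply/measurable_EFinP; apply: continuous_measurable_fun => x.
    exact: (is_derive_continuous (is_derive_comp_fun (is_derive_expR _) (is_deriveM_fun (is_derive_cst_fun (- mu) x) (is_derive_id_fun x)))).
  - move=> x /=; rewrite in_itv/= andbT => xl; rewrite lee_fin /f /wt.
    have x0 : 0 <= x by rewrite (le_trans _ xl)// ltW.
    by rewrite (ger0_norm x0) ler_piMl// expR_ge0.
have Lf : L1 f.
  apply: (@L1_le _ f (wt mu)); [exact: continuous_measurable_fun|exact: L1_expRN|].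
  by move=> x; rewrite ger0_norm// ler_piMl// ltW// wt_gt0.
by rewrite -lee_fin EFin_Rint.
Qed.

End tail.

Section opT_real.
Context {R : realType}.
Implicit Types (f g s u : R -> R).

Lemma fsin_opp f x : L1 f -> fsin f (- x) = - fsin f x.
Proof.
move=> Lf; rewrite /fsin -[RHS]mulN1r -RintZ; last exact: L1_sin.
by apply: eq_Rint => y; rewrite mulrN sinN; ring.
Qed.

Lemma Fabs_L1 u M mu : 0 < mu -> L1 u -> (forall xi, Fabs u xi <= M * wt mu xi) -> L1 (Fabs u).
Proof.
move=> mu0 Lu uM.
have cF : continuous (Fabs u).
  move=> xi; apply: (@continuous_comp _ _ _ (fun xi => fcos u xi ^+ 2 + fsin u xi ^+ 2) Num.sqrt).
    have c1 := continuous_fcos Lu (x := xi); have c2 := continuous_fsin Lu (x := xi).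
    by apply: cvgD; [exact: (cvgM c1 c1)|exact: (cvgM c2 c2)].
  exact: sqrt_continuous.
apply: (@L1_le _ _ (fun xi => M * wt mu xi)).
- exact: continuous_measurable_fun.
- exact: (L1Z M (L1_expRN mu0)).
- by move=> xi; rewrite ger0_norm ?Fabs_ge0.
Qed.

Lemma opT_real lam s u : L1 s -> rapid u -> L1 (Fabs u) ->
  (forall xi, fcos u xi = fcos s xi / (4 * lam ^+ 2 - xi ^+ 2)) ->
  (forall xi, fsin u xi = fsin s xi / (4 * lam ^+ 2 - xi ^+ 2)) ->
  opT lam (fun x => (s x)%:C) = (fun x => (u x)%:C).
Proof.
move=> Ls ru LF uc us; apply/funext => x; have Lu := rapid_L1 ru.
have [M _ uM] := rapid_bd ru.
rewrite /opT (_ : (fun xi => _) = (fun xi => (fcos u xi * cos (x * xi) + fsin u xi * sin (x * xi)) +i*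
   (fcos u xi * sin (x * xi) + - fsin u xi * cos (x * xi)))); last first.
  apply/funext => xi; rewrite fourier_real// -fmorphV/= uc us /cexpi.
  move: (fcos s xi) (fsin s xi) (cos _) (sin _) (_^-1) => a b c d e.
  by apply/eqP; rewrite eq_complex/= !mulr0; apply/andP; split; apply/eqP; ring.
rewrite /cintegral /=.
have -> : \int[lebesgue_measure]_x0 (fcos u x0 * sin (x * x0) + - fsin u x0 * cos (x * x0)) = 0.
  apply: Rint_odd.
  - move=> xi; apply: cvgD; apply: cvgM.
    + exact: continuous_fcos.
    + exact: continuous_Msin.
    + by apply: cvgN; exact: continuous_fsin.
    + exact: continuous_Mcos.
  - apply: (@L1_le _ _ (Fabs u)) => // [|xi].
      apply: continuous_measurable_fun => xi; apply: cvgD; apply: cvgM.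
      + exact: continuous_fcos.
      + exact: continuous_Msin.
      + by apply: cvgN; exact: continuous_fsin.
      + exact: continuous_Mcos.
    rewrite addrC (le_trans (amp_cos_sin _ _ _))//.
    by rewrite /Fabs /amp sqrrN addrC.
  - by move=> xi; rewrite fcos_opp fsin_opp// mulrN sinN cosN; ring.
rewrite (inversion x (rapid_cont ru) uM Lu LF).
by apply/eqP; rewrite eq_complex/= !mulr0 !mul0r addr0 subr0 !eqxx.
Qed.

End opT_real.

Section kernel_transforms.
Context {R : realType}.
Variable lam : R.
Hypothesis lam0 : 0 < lam.
Variable h : R -> R.
Hypothesis rh : rapid h.
Let A0 : 0 < cutA lam. Proof. exact: cutA_gt0. Qed.

Definition cutK (x : R) : R := (2 * pi)^-1 * fcos (cut lam) x.

Lemma bl_cutK : bl_kernel (cutA lam) cutK.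
Proof.
rewrite (_ : cutK = fcos (fun x => (2 * pi)^-1 * cut lam x)).
  by apply: bl_kernel_fcos; apply: Cc_scale; exact: Cc_cut.
by apply/funext => x; rewrite fcosZ//; exact: (Cc_L1 A0 (Cc_cut lam0)).
Qed.

Lemma fcos_cutK xi : fcos (conv cutK h) xi = cut lam xi * fcos h xi.
Proof.
have [E1 E2] := even_kernel A0 xi (Cc_cut lam0) (@cut_even _ lam).
by rewrite (fcos_conv xi (bl_kernel_Rap A0 bl_cutK) rh) E1 E2 mul0r subr0.
Qed.

Lemma fsin_cutK xi : fsin (conv cutK h) xi = cut lam xi * fsin h xi.
Proof.
have [E1 E2] := even_kernel A0 xi (Cc_cut lam0) (@cut_even _ lam).
by rewrite (fsin_conv xi (bl_kernel_Rap A0 bl_cutK) rh) E1 E2 mul0r add0r.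
Qed.

Lemma fcos_conv_greenT xi : fcos (conv (greenT lam) h) xi = fcos (conv cutK h) xi / (4 * lam ^+ 2 - xi ^+ 2).
Proof.
have E (a a' b b' c d : R) : a = a' -> b = b' -> a * c - b * d = a' * c - b' * d by move=> -> ->.
apply: etrans (fcos_conv xi (rapid_greenT lam0) rh) _.
apply: etrans (E _ _ _ _ _ _ (fcos_greenT lam0 xi) (fsin_greenT lam0 xi)) _.
by rewrite fcos_cutK gamE; ring.
Qed.

Lemma fsin_conv_greenT xi : fsin (conv (greenT lam) h) xi = fsin (conv cutK h) xi / (4 * lam ^+ 2 - xi ^+ 2).
Proof.
have E (a a' b b' c d : R) : a = a' -> b = b' -> a * c + b * d = a' * c + b' * d by move=> -> ->.
apply: etrans (fsin_conv xi (rapid_greenT lam0) rh) _.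
apply: etrans (E _ _ _ _ _ _ (fsin_greenT lam0 xi) (fcos_greenT lam0 xi)) _.
by rewrite fsin_cutK gamE; ring.
Qed.

End kernel_transforms.

Unset Implicit Arguments.

Theorem theorem12 (R : realType) (q x t p : R -> R) (lambda Gamma mu : R)
  (q_smooth : smooth q)
  (q_gt0 : forall u : R, 0 < q u)
  (xE : forall u : R, x u = integral_from0 (fun v => Num.sqrt (q v)) u)
  (x_diffeo : diffeo_with_inverse x t)
  (pE : forall y : R, p y = 2 * schwarzian t y)
  (p_schwartz : schwartz (fun y => (p y)%:C))
  (lambda_gt0 : 0 < lambda) (Gamma_gt0 : 0 < Gamma) (mu_gt0 : 0 < mu)
  (lambda_large : 2 * Num.max (1 / mu) Gamma < lambda)
  (p_hat : forall xi : R,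
     cabs (fourier (fun y => (p y)%:C) xi) <= Gamma * expR (- mu * `|xi|)) :
  exists sigma nu : R -> R[i],
    schwartz sigma /\ schwartz nu /\
    (forall y : R,
       sigma y = opS lambda (opT lambda sigma) y + (p y)%:C + nu y) /\
    (forall xi : R, `|xi| <= Num.sqrt 2 * lambda ->
       cabs (fourier sigma xi) <=
         (1 + 2 * Gamma / lambda) * Gamma * expR (- mu * `|xi|)) /\
    (forall xi : R, Num.sqrt 2 * lambda < `|xi| -> fourier sigma xi = 0) /\
    (Linfty_norm nu <=
       (Gamma / (2 * mu) * (1 + 4 * Gamma / lambda)
          * expR (- mu * lambda))%:E)%E.
Proof.
clear pE x_diffeo xE q_gt0 q_smooth x t q.
have lam0 := lambda_gt0.
have Gl : 2 * Gamma <= lambda.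
  rewrite (le_trans _ (ltW lambda_large))// ler_wpM2l// le_max lexx orbT//.
have sp : Schw p by apply/schwartz_real.
have rp := Schw_Rap sp.
have phat xi : Fabs p xi <= Gamma * wt mu xi.
  by rewrite -cabs_fourier_real ?p_hat//; exact: rapid_L1.
have [h [rh hE hF]] := fixed_point lam0 Gamma_gt0 (ltW mu_gt0) Gl rp phat.
have A0 := cutA_gt0 lam0.
have b0 := bound_ge0 lam0 Gamma_gt0.
pose u := conv (greenT lambda) h; pose v := conv (greenT' lambda) h; pose s := conv (cutK lambda) h.
have kB := bl_cutK lam0.
have rB := bl_kernel_Rap A0 kB; have rG := rapid_greenT lam0.
have su : Schw u := Schw_conv A0 (bl_greenT lam0) rh.
have sv : Schw v := Schw_conv A0 (bl_greenT' lam0) rh.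
have ss : Schw s := Schw_conv A0 kB rh.
have seu : Schw (fun x => eps (u x)).
  apply: (Schw_eps su).
  exact: (rapid_eps lam0 (ltW mu_gt0) rh b0 (bound_le lam0 Gamma_gt0 Gl) hF).
have hx y : h y = 4^-1 * (v y * v y) + (- (4 * lambda ^+ 2)) * eps (u y) + p y.
  by rewrite {1}hE.
have sh : Schw h.
  rewrite (funext hx); apply: Schw_add => //.
  by apply: Schw_add; apply: Schw_scale => //; exact: Schw_mul.
pose nu x := s x + (-1) * h x.
have snu : Schw nu by apply: Schw_add => //; exact: Schw_scale.
have rs := Schw_Rap ss; have ru := Schw_Rap su; have rnu := Schw_Rap snu.
have fcs xi : fcos s xi = cut lambda xi * fcos h xi by exact: fcos_cutK.
have fss xi : fsin s xi = cut lambda xi * fsin h xi by exact: fsin_cutK.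
have fcu xi : fcos u xi = fcos s xi / (4 * lambda ^+ 2 - xi ^+ 2) by exact: fcos_conv_greenT.
have fsu xi : fsin u xi = fsin s xi / (4 * lambda ^+ 2 - xi ^+ 2) by exact: fsin_conv_greenT.
have LFu : L1 (Fabs u).
  apply: (@Fabs_L1 _ u (2 / 5 / lambda ^+ 2 * spectral_bound lambda Gamma) mu) => //; first exact: rapid_L1.
  move=> xi; rewrite (Fabs_conv xi rG rh) -[leRHS]mulrA.
  by apply: ler_pM; [exact: Fabs_ge0|exact: Fabs_ge0|exact: (Fabs_greenT lam0)|exact: hF].
have Ts : opT lambda (fun x => (s x)%:C) = (fun x => (u x)%:C).
  by apply: opT_real => //; exact: rapid_L1.
have du : derive1 u = v.
  apply/funext => y; apply: derive1_val.
  exact: (conv_derive y rG (rapid_greenT' lam0) (rapid_L1 rh) (greenT_derive lam0)).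
exists (fun x => (s x)%:C), (fun x => (nu x)%:C); split; first exact/schwartz_real.
split; first exact/schwartz_real.
split.
  move=> y; rewrite Ts /opS cderive_real exp_tail2_real du.
  rewrite -(rmorph_nat (real_complex R) 4) -fmorphV -rmorphXn -!rmorphM -rmorphB -!rmorphD/=.
  by congr (_ +i* _); rewrite /nu hx; field.
split.
  move=> xi _; rewrite cabs_fourier_real; last exact: rapid_L1.
  have -> : Fabs s xi = cut lambda xi * Fabs h xi.
    by rewrite /Fabs fcs fss ampZ ger0_norm ?cut_ge0.
  apply: le_trans (hF xi).
  by rewrite ler_piMl ?Fabs_ge0// cut_le1.
split.
  move=> xi hxi; rewrite fourier_real; last exact: rapid_L1.
  have c0 : cut lambda xi = 0.
    apply: (Cc_cut lam0).2; apply: le_lt_trans hxi; rewrite /cutA ler_wpM2r ?(ltW lam0)//.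
    rewrite -[leLHS]ger0_norm ?divr_ge0// -sqrtr_sqr ler_wsqrtr//.
    by rewrite exprMn; lra.
  by rewrite fcs fss c0 !mul0r oppr0.
have Fnu xi : Fabs nu xi = (1 - cut lambda xi) * Fabs h xi.
  have Lh1 := L1Z (-1) (rapid_L1 rh).
  rewrite /Fabs fcosD ?fsinD ?fcosZ ?fsinZ//; try exact: rapid_L1.
  rewrite fcs fss -!mulrDl -[1 - _]opprK opprB ampZ.
  by rewrite ler0_norm ?opprB ?opprK// subr_le0 cut_le1.
pose k (xi : R) := 1 - cut lambda xi.
have ck : continuous k.
  move=> xi; apply: cvgB; first exact: cvg_cst.
  by have [sc _] := Cc_cut lam0; exact: smooth_cont.
have k01 xi : 0 <= k xi <= 1.
  by rewrite /k subr_ge0 cut_le1// gerBl cut_ge0.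
have kle xi : Fabs nu xi <= spectral_bound lambda Gamma * (k xi * wt mu xi).
  rewrite Fnu mulrCA ler_wpM2l//; first by have /andP[] := k01 xi.
have LFnu : L1 (Fabs nu).
  apply: (@Fabs_L1 _ nu (spectral_bound lambda Gamma) mu) => //; first exact: rapid_L1.
  move=> xi; rewrite (le_trans (kle xi))// ler_wpM2l//.
  by have /andP[_ k1] := k01 xi; rewrite ler_piMl// ltW// wt_gt0.
have tail := tail_integral lam0 mu_gt0 ck k01.
have Lkw : L1 (fun xi => k xi * wt mu xi).
  apply: (@L1_le _ _ (wt mu)); last 2 first.
  - exact: L1_expRN.
  - move=> xi; have /andP[k0 k1] := k01 xi.
    by rewrite ger0_norm ?mulr_ge0 ?(ltW (wt_gt0 _ _))// ler_piMl// ltW// wt_gt0.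
  apply: continuous_measurable_fun => xi; apply: cvgM; first exact: ck.
  exact: continuous_expRN.
have {}tail : Rint (fun xi => k xi * wt mu xi) <= 2 * (expR (- mu * lambda) / mu).
  by apply: tail => xi; [rewrite /k cut_even|move=> h1; rewrite /k cut_one// subrr].
apply: Linfty_norm_le => x; rewrite cabs_real.
have [M _ nuM] := rapid_bd rnu.
rewrite (inversion x (rapid_cont rnu) nuM (rapid_L1 rnu) LFnu) normrM.
have P0 : 0 < (2 * pi)^-1 :> R by rewrite invr_gt0 mulr_gt0// pi_gt0.
have P4 : (2 * pi)^-1 <= 4^-1 :> R.
  by rewrite lef_pV2 ?posrE// ?mulr_gt0 ?pi_gt0//; have := pi_ge2 R; lra.
rewrite (ger0_norm (ltW P0)).
have E : `|Rint (fun xi => fcos nu xi * cos (x * xi) + fsin nu xi * sin (x * xi))| <=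
    spectral_bound lambda Gamma * (2 * (expR (- mu * lambda) / mu)).
  apply: (le_trans (norm_Rint_le (g := fun xi => spectral_bound lambda Gamma * (k xi * wt mu xi)) _ _ _)).
  - apply: (@L1_le _ _ (Fabs nu)) => // [|xi]; last exact: amp_cos_sin.
    apply: continuous_measurable_fun => xi; apply: cvgD; apply: cvgM.
    + by apply: continuous_fcos; exact: rapid_L1.
    + exact: continuous_Mcos.
    + by apply: continuous_fsin; exact: rapid_L1.
    + exact: continuous_Msin.
  - exact: L1Z.
  - by move=> xi; rewrite (le_trans _ (kle xi))//; exact: amp_cos_sin.
  by rewrite RintZ// ler_wpM2l.
rewrite (le_trans (ler_pM (ltW P0) (normr_ge0 _) P4 E))//.
have e0 : 0 <= expR (- mu * lambda) by exact: expR_ge0.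
rewrite [leLHS](_ : _ = Gamma / (2 * mu) * (1 + 2 * Gamma / lambda) * expR (- mu * lambda)); last first.
  by rewrite /spectral_bound; field; rewrite !gt_eqF.
rewrite ler_wpM2r// ler_wpM2l ?divr_ge0 ?mulr_ge0 ?(ltW Gamma_gt0) ?(ltW mu_gt0)//.
rewrite lerD2l ler_wpM2r ?invr_ge0 ?(ltW lambda_gt0)// ler_wpM2r ?(ltW Gamma_gt0)//.
by rewrite ler_nat.
Qed.
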